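(* Let $n\ge 5$ be an integer, let $k$ be an integer with $1\le k<\left[\frac n2\right]$, and let $M>0$. For every $\delta>0$ there exists $\epsilon>0$ with the following property. Let $u\in C^3(\partial B)$ and let $\Omega=\left\{\left(1+u\left(\frac{x}{|x|}\right)\right)x : x\in B\right\}\subseteq\mathbb{R}^{n+1}$. Suppose $\operatorname{bar}(\Omega)=0$, $I_0(\Omega)=I_0(B)$, $\|u\|_{C^2}\le M$ and $\|u\|_{C^1}<\epsilon$. Then $$\int_{\partial\Omega}\Big(\sigma_k(h)+\sum_{j=1}^{k}\sigma_j(h)^-\Big)\,d\mu-\int_{\partial B}C_n^k\,dA\;\ge\;-\delta .$$
   Context: $B$ is the unit ball centered at the origin in $\mathbb{R}^{n+1}$ and $\partial B=\mathbb{S}^n$ is the unit sphere with its round metric; $dA$ is the area measure on $\partial B$ and $d\mu$ the area measure on $\partial\Omega$. The norms $\|u\|_{C^1},\|u\|_{C^2}$ are those on $\partial B$. $\operatorname{bar}(\Omega)$ is the barycenter of $\Omega$, $[\cdot]$ is the integer part, and $C_n^k=\frac{n!}{k!(n-k)!}$. $h$ is the second fundamental form of the boundary (sign chosen so that the unit sphere has all principal curvatures equal to $1$), $\sigma_j(h)$ is the $j$-th elementary symmetric polynomial of the principal curvatures, $\sigma_0=1$. $I_m(\Omega)=\int_{\partial\Omega}\sigma_m(h)\,d\mu$; in particular $I_0$ is the surface area of the boundary. For a real function $f$, $f^-=\max(0,-f)$. *)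

(* Defs.v *)
From HB Require Import structures.
From mathcomp Require Import all_boot all_order all_algebra.
From mathcomp Require Import all_classical all_reals all_analysis.

Set Implicit Arguments.
Unset Strict Implicit.
Unset Printing Implicit Defensive.
Import Order.TTheory GRing.Theory Num.Theory.
Import numFieldNormedType.Exports.
Local Open Scope classical_set_scope.
Local Open Scope ring_scope.

Definition tuple_cons {R : realType} {m : nat} (p : R * m.-tuple R) :
  m.+1.-tuple R := [tuple of p.1 :: p.2].

Lemma measurable_tuple_cons {R : realType} {m : nat} :
  measurable_fun setT (@tuple_cons R m).
Proof. exact: measurable_cons. Qed.

Definition lebesgue_cons {R : realType} {m : nat}
    (mu : {sigma_finite_measure set (m.-tuple R) -> \bar R}) :
  set (m.+1.-tuple R) -> \bar R :=
  pushforward (@lebesgue_measure R \x mu)%E tuple_cons.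

Section LebesgueCons.
Context {R : realType} {m : nat}
  (mu : {sigma_finite_measure set (m.-tuple R) -> \bar R}).

Let pushforward_mu : {measure set (m.+1.-tuple R) -> \bar R}.
Proof.
refine (pushforward (@lebesgue_measure R \x mu)%E tuple_cons
  : {measure set _ -> \bar R}).
exact: measurable_tuple_cons.
Defined.

HB.instance Definition _ := isMeasure.Build _ _ _ (lebesgue_cons mu)
  (measure0 pushforward_mu) (measure_ge0 pushforward_mu)
  (@measure_semi_sigma_additive _ _ _ pushforward_mu).

Let lebesgue_cons_sigma_finite : sigma_finite setT (lebesgue_cons mu).
Proof.
have /sigma_finiteP[F [TF ndF Foo]] := sigma_finiteT (@lebesgue_measure R).
have /sigma_finiteP[G [TG ndG Goo]] := sigma_finiteT mu.
pose uncons (t : m.+1.-tuple R) := (thead t, [tuple of behead t]).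
have mu_uncons : measurable_fun setT uncons.
  apply/measurable_fun_pair => /=; last exact: measurable_behead.
  exact: (@measurable_tnth _ _ _ ord0).
have uncons_cons A : tuple_cons @^-1` (uncons @^-1` A) = A.
  apply/seteqP; split => -[x t] /=; rewrite /uncons /tuple_cons theadE;
    by rewrite (_ : [tuple of behead [tuple of x :: t]] = t)//; exact: val_inj.
exists (fun i => uncons @^-1` (F i `*` G i)).
  rewrite -preimage_bigcup (_ : \bigcup_i (F i `*` G i) = setT) ?preimage_setT//.
  apply/seteqP; split => // -[x y] _.
  have [i _ Fix] : (\bigcup_i F i) x by rewrite -TF.
  have [j _ Gjy] : (\bigcup_i G i) y by rewrite -TG.
  exists (maxn i j) => //; split => /=.
    by move: x Fix; exact/subsetPset/ndF/leq_maxl.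
  by move: y Gjy; exact/subsetPset/ndG/leq_maxr.
move=> i; have [mF Fioo] := Foo i; have [mG Gioo] := Goo i; split.
  by rewrite -[X in measurable X]setTI; apply: mu_uncons => //; exact: measurableX.
rewrite /lebesgue_cons /pushforward uncons_cons product_measure1E//.
by rewrite lte_mul_pinfty// ge0_fin_numE.
Qed.

HB.instance Definition _ := Measure_isSigmaFinite.Build _ _ _
  (lebesgue_cons mu) lebesgue_cons_sigma_finite.

End LebesgueCons.

(* Lebesgue measure on R^m, as the m-fold product of the one on R *)
Fixpoint lebesgue_tuple (R : realType) (m : nat) :
    {sigma_finite_measure set (m.-tuple R) -> \bar R} :=
  match m with
  | 0 => \d_ [tuple]
  | m'.+1 => lebesgue_cons (lebesgue_tuple R m')
  end.

Section Euclidean.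
Context {R : realType} {m : nat}.
Implicit Types (x v w : 'rV[R]_m) (U : set 'rV[R]_m).

Definition dotp v w : R := \sum_i v 0 i * w 0 i.

(* The canonical norm on 'rV[R]_m is the sup norm. *)
Definition enorm v : R := Num.sqrt (dotp v v).

Definition unit_ball : set 'rV[R]_m := [set x | enorm x < 1].
Definition unit_sphere : set 'rV[R]_m := [set x | enorm x = 1].

(* x / |x|, with value 0 at x = 0 *)
Definition direction x : 'rV[R]_m := (enorm x)^-1 *: x.

Definition unit_tangent x : set 'rV[R]_m :=
  [set v | dotp x v = 0 /\ enorm v = 1].

Definition space_integral U (f : 'rV[R]_m -> R) : R :=
  \int[lebesgue_tuple R m]_(t in [set t | U (\row_i tnth t i)])
    f (\row_i tnth t i).

Definition volume U : R := space_integral U (fun=> 1).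

Definition barycenter U : 'rV[R]_m :=
  (volume U)^-1 *: \row_i space_integral U (fun x => x 0 i).

(* f is of class C^r on the open set U: all iterated directional derivatives
   up to order r exist on U, those of order r being continuous. *)
Fixpoint class_C (r : nat) U (f : 'rV[R]_m -> R) : Prop :=
  match r with
  | 0 => forall x, U x -> {for x, continuous f}
  | r'.+1 => forall v, (forall x, U x -> derivable f x v) /\
                       class_C r' U ('D_v f)
  end.

End Euclidean.

(* A function on the unit sphere of R^m is represented by a function on R^m of
   which only the values on the sphere matter. It is differentiated through its
   positively 0-homogeneous extension: at x on the sphere and for v tangent to
   the sphere at x, the derivative of [extend f] along v is df_x(v). *)
Definition extend {R : realType} {m : nat} {T : Type} (f : 'rV[R]_m -> T) :
  'rV[R]_m -> T := fun y => f (direction y).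

Section SphereFunctions.
Context {R : realType} {m : nat}.
Implicit Type u : 'rV[R]_m -> R.

Definition sphere_class_C (r : nat) u : Prop :=
  class_C r [set x | x != 0] (extend u).

(* sup |u|, sup |grad u| and sup |Hess u| over the unit sphere, where |.| is
   the operator norm. Since [extend u] is constant along rays, its second
   derivatives in tangent directions at a point of the sphere are the
   covariant ones: D_v (D_w (extend u)) = (Hess u)(v, w). *)
Definition sup_value u : \bar R :=
  ereal_sup [set `|u x|%:E | x in unit_sphere].

Definition sup_gradient u : \bar R :=
  ereal_sup [set y | exists x v, [/\ unit_sphere x, unit_tangent x v &
    y = `|'D_v (extend u) x|%:E]].

Definition sup_hessian u : \bar R :=
  ereal_sup [set y | exists x v w,
    [/\ unit_sphere x, unit_tangent x v, unit_tangent x w &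
      y = `|'D_v ('D_w (extend u)) x|%:E]].

Definition C1_norm u : \bar R := (sup_value u + sup_gradient u)%E.

Definition C2_norm u : \bar R :=
  (sup_value u + sup_gradient u + sup_hessian u)%E.

(* Integral for the area measure dA of the unit sphere, where dA(A) is m times
   the volume of the cone {t x | 0 < t < 1, x in A} over A. *)
Definition sphere_integral (f : 'rV[R]_m -> R) : R :=
  m%:R * space_integral unit_ball (extend f).

End SphereFunctions.

(* The boundary of the domain { (1 + u (x / |x|)) x | x in B } is the
   hypersurface parametrized over the unit sphere by [radial u]. *)
Section Radial.
Context {R : realType} {m : nat}.
Implicit Type u : 'rV[R]_m -> R.

Definition radial u (x : 'rV[R]_m) : 'rV[R]_m := (1 + u x) *: x.

Definition radial_domain u : set 'rV[R]_m :=
  [set (1 + u (direction x)) *: x | x in unit_ball].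

End Radial.

(* Geometry of the hypersurface of R^(n+1) parametrized by the restriction of
   X to the unit sphere. *)
Section Hypersurface.
Context {R : realType} {n : nat}.
Implicit Types (X : 'rV[R]_n.+1 -> 'rV[R]_n.+1) (x : 'rV[R]_n.+1).

(* The rows form an orthonormal basis of the tangent space of the sphere at x.
   A change of basis conjugates the matrices below by an orthogonal matrix, so
   that the principal curvatures and det g do not depend on the choice. *)
Definition tangent_frame x : 'M[R]_(n, n.+1) :=
  xget 0 [set E : 'M[R]_(n, n.+1) | E *m E^T = 1%:M /\ E *m x^T = 0].

Definition dframe (Y : 'rV[R]_n.+1 -> 'rV[R]_n.+1) x (i : 'I_n) :
  'rV[R]_n.+1 := 'D_(row i (tangent_frame x)) (extend Y) x.

Definition first_form X x : 'M[R]_n :=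
  \matrix_(i, j) dotp (dframe X x i) (dframe X x j).

(* Outward unit normal at X x, for a hypersurface that is star-shaped with
   respect to the origin. *)
Definition outer_normal X x : 'rV[R]_n.+1 :=
  xget 0 [set nu : 'rV[R]_n.+1 | [/\ enorm nu = 1,
    forall v, dotp x v = 0 -> dotp nu ('D_v (extend X) x) = 0 &
    0 < dotp nu (X x)]].

(* h(v, w) = < dnu(v), dX(w) >, which is the identity for the unit sphere *)
Definition second_form X x : 'M[R]_n :=
  \matrix_(i, j) dotp (dframe (outer_normal X) x i) (dframe X x j).

(* the eigenvalues, with multiplicity, of the second fundamental form with
   respect to the first one *)
Definition principal_curvatures X x : 'rV[R]_n :=
  xget 0 [set kappa : 'rV[R]_n |
    char_poly (second_form X x *m invmx (first_form X x)) =
    \prod_(i < n) ('X - (kappa 0 i)%:P)].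

Definition elementary_symmetric (j : nat) (kappa : 'rV[R]_n) : R :=
  \sum_(S : {set 'I_n} | #|S| == j) \prod_(i in S) kappa 0 i.

Definition sigma X (j : nat) x : R :=
  elementary_symmetric j (principal_curvatures X x).

(* Integral for the area measure dmu of the hypersurface, i.e. the Riemannian
   measure of the metric induced by X: dmu = sqrt (det g) dA, g being the
   metric in an orthonormal frame of the sphere. *)
Definition surface_integral X (f : 'rV[R]_n.+1 -> R) : R :=
  sphere_integral (fun x => f x * Num.sqrt (\det (first_form X x))).

Definition curvature_integral (j : nat) X : R :=
  surface_integral X (sigma X j).

End Hypersurface.

Definition neg_part {R : realType} (a : R) : R := Num.max 0 (- a).

(* Main.v *)
Require Import Defs.
From HB Require Import structures.
From mathcomp Require Import all_boot all_order all_algebra.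
From mathcomp Require Import fingroup perm complex.
From mathcomp Require Import all_classical all_reals all_analysis.
From mathcomp Require Import measurable_realfun ring lra.

Set Implicit Arguments.
Unset Strict Implicit.
Unset Printing Implicit Defensive.
Import Order.TTheory GRing.Theory Num.Theory.
Import numFieldNormedType.Exports.
Local Open Scope classical_set_scope.
Local Open Scope ring_scope.

(** Dropping the terms sigma_j^-, which are nonnegative, it suffices that the
    integral of sigma_k over the boundary be close to C(n, k) times the area
    of the sphere. The curvatures themselves need not be close to 1: u is small
    in C^1 only, its second derivatives being merely bounded. The closeness
    appears after integration, and is due to the fact that Jacobian
    determinants are null Lagrangians.

    Let X be the parametrization x |-> (1 + u x) x and nu the outer normal,
    both extended to functions homogeneous of degree 0 outside the origin, and
    let P_s(y) = |y| (X + s nu) be the parallel hypersurface at distance s,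
    extended with degree 1. Steiner's formula reads
      sqrt (det g) * sum_j s^j sigma_j = det (DP_s) / (<X, nu> + s)
    on the sphere, and is a matter of linear algebra ([pencil_det_identity],
    [curvature_density]). A linear combination of these identities for
    s = 1, ..., n + 1, given by an inverse Vandermonde matrix
    ([interpolation_weights]), isolates sigma_k sqrt (det g). For u = 0 one has
    P_s(y) = (1 + s) y, so that the right-hand side is (1 + s)^n, of which the
    same combination is C(n, k). It remains to see, for each of the finitely
    many s, that the integral over the unit ball of the right-hand side is
    close to that of (1 + s)^n.

    The map P_s and the support function <X, nu> involve first derivatives of
    u only: they are uniformly close to (1 + s) y and to 1 when the C^1 norm
    of u is small, while DP_s stays bounded thanks to the bound on the C^2
    norm ([parallel_close], [support_close_everywhere], [derive_parallel_le]).
    For a cutoff chi that vanishes near the origin and outside the ball, an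
    integration by parts gives
      int chi det (DZ) = - int Z_a det (DZ with row a replaced by grad chi)
    ([null_lagrangian]): the row of derivatives of Z_a is traded for its
    values. Passing from (1 + s) y to P_s one component at a time,
    det (DP_s) - (1 + s)^(n + 1) becomes a sum of Jacobian determinants of maps
    having one uniformly small component, whence a small integral against chi
    ([det_weak_continuity]). The cutoff is fixed first, so that the region
    where it is not 1 contributes little ([cutoff_exists]), and the bound on
    the C^1 norm is chosen afterwards ([ball_det_close]). *)

(** * Determinants, matrix pencils and interpolation *)

(** Generalized eigenvalues of a symmetric matrix relative to a positive
    definite one are real: over the complex numbers, v h = z (v g) for g := A
    A^T, paired with the conjugate of v, gives z q = z^* q where q = |v A|^2
    does not vanish. *)
Lemma pencil_char_poly_splits (R : rcfType) n m (h : 'M[R]_n)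
    (A : 'M[R]_(n, m)) :
  h^T = h -> A *m A^T \in unitmx ->
  exists kappa : 'rV[R]_n, char_poly (h *m invmx (A *m A^T)) =
    \prod_(i < n) ('X - (kappa 0 i)%:P).
Proof.
move=> hT gu; set g := A *m A^T in gu *.
pose C := (complex.complex R : numClosedFieldType).
pose f : {rmorphism R -> C} := complex.real_complex R.
pose p := char_poly (h *m invmx g).
have [r Hr] := closed_field_poly_normal (map_poly f p : {poly C}).
have p_mon : map_poly f p \is monic by rewrite map_monic char_poly_monic.
rewrite (monicP p_mon) scale1r in Hr.
have f_conj (a : R) : (f a)^* = f a by exact: complex.conjc_real.
have r_real z : z \in r -> z = f (complex.Re z).
  move=> zr.
  have : root (map_poly f p) z by rewrite Hr root_prod_XsubC.
  rewrite map_char_poly -eigenvalue_root_char => /eigenvalueP[v Hv v0].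
  have vh : v *m map_mx f h = z *: (v *m map_mx f g).
    have -> : h = h *m invmx g *m g by rewrite mulmxKV.
    by rewrite map_mxM mulmxA Hv -scalemxAl.
  pose ct k l (B : 'M[C]_(k, l)) := (map_mx Num.conj B)^T.
  have ctM k l q (B : 'M[C]_(k, l)) (D : 'M[C]_(l, q)) :
    ct k q (B *m D) = ct l q D *m ct k l B by rewrite /ct map_mxM trmx_mul.
  have ctf k l (B : 'M[R]_(k, l)) : ct k l (map_mx f B) = map_mx f B^T.
    by rewrite /ct -map_mx_comp -map_trmx; congr trmx; apply/matrixP => i j;
      rewrite !mxE /= f_conj.
  have ctK k l (B : 'M[C]_(k, l)) : ct l k (ct k l B) = B.
    by apply/matrixP => i j; rewrite !mxE conjCK.
  pose q := v *m map_mx f g *m ct 1%N n v.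
  have qE : q = (v *m map_mx f A) *m ct 1%N m (v *m map_mx f A).
    by rewrite ctM ctf /q /g map_mxM !mulmxA.
  have q_sa : ct 1%N 1%N q = q by rewrite qE ctM ctK.
  have h_sa : ct 1%N 1%N (v *m map_mx f h *m ct 1%N n v)
      = v *m map_mx f h *m ct 1%N n v.
    by rewrite !ctM ctK ctf hT mulmxA.
  have q0 : q 0 0 != 0.
    apply/negP => /eqP q0.
    have vA : v *m map_mx f A = 0.
      apply/rowP => j; rewrite [RHS]mxE; apply/eqP.
      move: q0; rewrite qE mxE => /eqP.
      rewrite psumr_eq0; last first.
        by move=> i _; rewrite [ct _ _ _ _ _]mxE [map_mx Num.conj _ _ _]mxE mul_conjC_ge0.
      move=> /allP/(_ j); rewrite mem_index_enum => /(_ isT) /=.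
      by rewrite [ct _ _ _ _ _]mxE [map_mx Num.conj _ _ _]mxE mul_conjC_eq0.
    have : v *m map_mx f g = 0.
      by rewrite /g map_mxM mulmxA vA mul0mx.
    move=> /(congr1 (mulmx^~ (map_mx f (invmx g)))).
    rewrite mul0mx -mulmxA -map_mxM mulmxV// map_mx1 mulmx1 => v0'.
    by rewrite v0' eqxx in v0.
  have zz : z * q 0 0 = z^* * q 0 0.
    have zq : v *m map_mx f h *m ct 1%N n v = z *: q by rewrite vh -scalemxAl.
    move: h_sa; rewrite zq => /(congr1 (fun B : 'M[C]_1 => B 0 0)).
    have := congr1 (fun B : 'M[C]_1 => B 0 0) q_sa.
    by rewrite /ct !mxE rmorphM /= => -> ->.
  have /(mulIf q0) := zz.
  case: z {zr vh Hv zz} => a b; move/eqP.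
  rewrite complex.eq_complex /= => /andP[_ /eqP bb].
  by congr complex.Complex; apply/eqP; move: bb => /eqP; rewrite -addr_eq0 -mulr2n mulrn_eq0.
pose r' := [seq complex.Re z | z <- r].
have rE : r = map f r'.
  by rewrite -map_comp -[LHS]map_id; apply/eq_in_map => z /r_real {1}->.
have pE : p = \prod_(a <- r') ('X - a%:P).
  apply: (map_poly_inj f); rewrite Hr rE big_map rmorph_prod /=.
  by apply: eq_bigr => a _; rewrite map_polyXsubC.
have sr : size r' = n.
  apply: succn_inj; rewrite -(size_prod_XsubC _ id) /= -pE; exact: size_char_poly.
exists (\row_i nth 0 r' i).
rewrite -/p pE (big_nth 0) big_mkord sr; apply: eq_bigr => i _.
by rewrite mxE.
Qed.

Lemma elementary_symmetric_gen (R : comRingType) n (kappa : 'rV[R]_n) (s : R) :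
  \prod_(i < n) (1 + s * kappa 0 i) =
  \sum_(j < n.+1) s ^+ j *
    \sum_(S : {set 'I_n} | #|S| == j) \prod_(i in S) kappa 0 i.
Proof.
have -> : \prod_(i < n) (1 + s * kappa 0 i) =
    \sum_(S : {set 'I_n}) s ^+ #|S| * \prod_(i in S) kappa 0 i.
  under eq_bigr do rewrite addrC.
  rewrite bigA_distr; apply: eq_bigr => S _.
  rewrite -prodr_const -big_split /= [RHS]big_mkcond /=.
  by apply: eq_bigr => i _; case: ifP.
under [RHS]eq_bigr do rewrite mulr_sumr.
have card_lt (S : {set 'I_n}) : (#|S| < n.+1)%N.
  by rewrite ltnS -[X in (_ <= X)%N]card_ord max_card.
rewrite (partition_big (fun S => Ordinal (card_lt S)) xpredT) //=.
apply: eq_bigr => j _; apply: eq_big => [S|S /eqP <-].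
  by rewrite -val_eqE.
by [].
Qed.

(** A column of the inverse of the Vandermonde matrix at the nodes 1, ..., n +
    1: these weights recover the coefficient of degree k of a polynomial of
    degree at most n from its values at the nodes. *)
Lemma interpolation_weights (R : numFieldType) n (k : 'I_n.+1) :
  exists lam : 'I_n.+1 -> R, forall j : 'I_n.+1,
    \sum_s lam s * (s.+1)%:R ^+ j = (j == k)%:R.
Proof.
pose V := Vandermonde n.+1 (\row_(s < n.+1) ((s.+1)%:R : R)).
have Vu : V \in unitmx.
  rewrite unitmxE det_Vandermonde unitfE.
  apply/prodf_neq0 => i _; apply/prodf_neq0 => j ij.
  rewrite !mxE subr_eq0 eqr_nat eqSS; apply: contraTneq ij => ->.
  by rewrite ltnn.
exists (fun s => invmx V s k) => j.
have := congr1 (fun M : 'M[R]_n.+1 => M j k) (mulmxV Vu).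
rewrite !mxE => <-; apply: eq_bigr => s _; rewrite !mxE mulrC //.
Qed.

(** Both sides come from the value of the characteristic polynomial at - 1 / s.
    *)
Lemma char_poly_pencil_det (R : fieldType) n (S : 'M[R]_n) (kappa : 'rV[R]_n) s :
  char_poly S = \prod_(i < n) ('X - (kappa 0 i)%:P) -> s != 0 ->
  \det (1%:M + s *: S) = \prod_(i < n) (1 + s * kappa 0 i).
Proof.
move=> Hc s0.
have -> : 1%:M + s *: S = (- s) *: ((- s^-1)%:M - S).
  rewrite scalerBr scale_scalar_mx mulrNN mulfV // scaleNr opprK //.
have := congr1 (fun p => (p.[- s^-1])) Hc.
rewrite detZ /char_poly -horner_evalE -det_map_mx.
have -> : map_mx (horner_eval (- s^-1)) (char_poly_mx S) = (- s^-1)%:M - S.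
  apply/matrixP => i j; rewrite !mxE /horner_eval !hornerE.
  by case: (i == j); rewrite ?mulr1n ?mulr0n !hornerE.
move=> ->; rewrite horner_prod -[X in _ ^+ X]card_ord -prodr_const -big_split /=.
apply: eq_bigr => i _; rewrite !hornerE mulrBr mulrNN mulfV //.
by rewrite mulNr opprK.
Qed.

Lemma mulmx_col_det0 (R : fieldType) n (M : 'M[R]_n) (v : 'cV[R]_n) :
  M *m v = 0 -> v != 0 -> \det M = 0.
Proof.
move=> Mv v0; rewrite -det_tr; apply/eqP/det0P; exists v^T.
  by rewrite trmx_eq0.
by rewrite -trmx_mul Mv trmx0.
Qed.

(** The rows of B are replaced by those of A one at a time; two successive
    matrices differ in one row, in which the determinant is linear. Every term
    has a full row of A - B. *)
Lemma det_row_telescope (R : comRingType) n (A B : 'M[R]_n) :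
  \det A - \det B = \sum_(a < n) \det (\matrix_(i, j)
    (if (i < a)%N then A i j else if i == a then A i j - B i j else B i j)).
Proof.
pose T k : 'M[R]_n := \matrix_(i, j) if (i < k)%N then A i j else B i j.
have AT : A = T n by apply/matrixP => i j; rewrite mxE ltn_ord.
have BT : B = T 0%N by apply/matrixP => i j; rewrite mxE.
rewrite [in X in \det X - _]AT [in X in _ - \det X]BT.
rewrite -(telescope_sumr (fun k => \det (T k))) // big_mkord.
apply: eq_bigr => a _; apply/eqP; rewrite subr_eq; apply/eqP.
set C := (X in _ = \det X + _).
rewrite [LHS](@determinant_multilinear _ _ _ C (T a) a 1 1) ?mul1r //.
- by apply/rowP => j; rewrite !mxE ltnSn eqxx ltnn !mul1r subrK.
- apply/matrixP => i j; rewrite !mxE; have: lift a i != a by rewrite eq_sym neq_lift.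
  by move: (lift a i) => l la; rewrite ltnS [(l <= a)%N]leq_eqVlt (negbTE (la : l != a :> nat)) ?(negbTE la).
- apply/matrixP => i j; rewrite !mxE; have: lift a i != a by rewrite eq_sym neq_lift.
  by move: (lift a i) => l la; rewrite ltnS [(l <= a)%N]leq_eqVlt (negbTE (la : l != a :> nat)) ?(negbTE la).
Qed.

Lemma card_permutations n : #|{perm 'I_n}| = n`!.
Proof.
rewrite -[in RHS](card_ord n) -(cardsT 'I_n) -card_perm; apply: eq_card => s.
by rewrite !inE; apply/esym/fintype.subsetP => i _; rewrite inE.
Qed.

Lemma det_le (R : realDomainType) n (A : 'M[R]_n) (K : R) :
  (forall i j, `|A i j| <= K) -> `|\det A| <= n`!%:R * K ^+ n.
Proof.
move=> AK; apply: le_trans (ler_norm_sum _ _ _) _.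
rewrite -card_permutations mulr_natl -sumr_const.
apply: ler_sum => s _; rewrite normrM normrX normrN1 expr1n mul1r normr_prod.
by rewrite -[X in K ^+ X]card_ord -prodr_const; apply: ler_prod => i _; rewrite normr_ge0 AK.
Qed.

Lemma det_row_le (R : realDomainType) n (A : 'M[R]_n) (K e : R) (a : 'I_n) :
  (forall i j, i != a -> `|A i j| <= K) -> (forall j, `|A a j| <= e) ->
  `|\det A| <= n`!%:R * (e * K ^+ n.-1).
Proof.
move=> AK Ae; apply: le_trans (ler_norm_sum _ _ _) _.
rewrite -card_permutations mulr_natl -sumr_const.
apply: ler_sum => s _; rewrite normrM normrX normrN1 expr1n mul1r normr_prod.
rewrite (bigD1 a) //=; apply: ler_pM => //; first exact: prodr_ge0.
rewrite -[X in K ^+ X.-1]card_ord -(cardC1 a) -prodr_const.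
by apply: ler_prod => i ia; rewrite normr_ge0 AK.
Qed.

Lemma row_orthogonal_mx (R : fieldType) n (x : 'rV[R]_n.+1) (E : 'M[R]_(n, n.+1)) :
  x *m x^T = 1%:M -> E *m E^T = 1%:M -> E *m x^T = 0 ->
  \det (col_mx x E : 'M[R]_n.+1) ^+ 2 = 1.
Proof.
move=> xx EE Ex; set J : 'M[R]_n.+1 := col_mx x E.
rewrite expr2 -{2}(det_tr J) -det_mulmx.
suff -> : J *m J^T = 1%:M by rewrite det1.
rewrite /J (@tr_col_mx _ 1 n) (@mul_col_row _ 1 n _ 1 n) xx EE Ex -[x *m E^T]trmxK trmx_mul trmxK Ex.
by rewrite trmx0 -(@scalar_mx_block _ 1 n).
Qed.

(** Only the component of Y along nu counts: the rest of Y is orthogonal to nu,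
    like the rows of M, and n + 1 such rows are dependent. *)
Lemma det_col_mx_orthogonal (R : fieldType) n (nu Y : 'rV[R]_n.+1)
    (M : 'M[R]_(n, n.+1)) :
  nu *m nu^T = 1%:M -> M *m nu^T = 0 ->
  \det (col_mx Y M : 'M[R]_n.+1) =
  (Y *m nu^T) 0 0 * \det (col_mx nu M : 'M[R]_n.+1).
Proof.
move=> nn Mn; set c := (Y *m nu^T) 0 0; pose tau := Y - c *: nu.
have -> : \det (col_mx Y M : 'M[R]_n.+1) =
    c * \det (col_mx nu M : 'M[R]_n.+1) + 1 * \det (col_mx tau M : 'M[R]_n.+1).
  apply: (determinant_multilinear (i0 := (lshift n ord0 : 'I_(1 + n)))).
  - by rewrite !rowKu !row_id scale1r addrC subrK.
  - by apply/matrixP => i j; rewrite !mxE; case: splitP => // k /=; rewrite ord1.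
  - by apply/matrixP => i j; rewrite !mxE; case: splitP => // k /=; rewrite ord1.
suff -> : \det (col_mx tau M : 'M[R]_n.+1) = 0 by rewrite mulr0 addr0.
apply: (@mulmx_col_det0 _ _ _ nu^T).
- rewrite (@mul_col_mx _ 1 n) Mn mulmxBl -scalemxAl nn.
  rewrite [Y *m nu^T]mx11_scalar -/c scale_scalar_mx mulr1 subrr.
  exact: (@col_mx0 _ 1 n 1).
- apply/eqP => /(congr1 trmx); rewrite trmxK trmx0 => n0; move: nn.
  by rewrite n0 mul0mx => /matrixP/(_ 0 0)/eqP; rewrite !mxE eq_sym oner_eq0.
Qed.

(** The linear algebra behind Steiner's formula. A0 and B0 stand for the
    differentials of the hypersurface X and of its normal nu, extended with
    degree 0 (hence x A0 = x B0 = 0), and x^T X is the radial part of the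
    differential of |y| X. Multiplying by the orthogonal matrix J with rows x
    and E turns the determinant into that of the matrix with rows X + s nu and A
    + s B, where A = E A0 and B = E B0; its first row may be replaced by (<X,
    nu> + s) nu. The determinant d s with first row nu satisfies d s * d 0 = det
    (g + s h), and the sign condition on det (A0 + x^T X) gives sqrt (det g) =
    det J * d 0. *)
Lemma pencil_det_identity (R : rcfType) n (x X nu : 'rV[R]_n.+1)
    (A0 B0 : 'M[R]_n.+1) (E : 'M[R]_(n, n.+1)) :
  x *m x^T = 1%:M -> E *m E^T = 1%:M -> E *m x^T = 0 ->
  nu *m nu^T = 1%:M -> A0 *m nu^T = 0 -> B0 *m nu^T = 0 ->
  x *m A0 = 0 -> x *m B0 = 0 ->
  0 < (X *m nu^T) 0 0 -> 0 < \det (A0 + x^T *m X) ->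
  let g := E *m A0 *m (E *m A0)^T in
  let h := E *m B0 *m (E *m A0)^T in
  0 < \det g /\
  forall s, 0 < s -> Num.sqrt (\det g) * \det (1%:M + s *: (h *m invmx g)) =
    \det (A0 + s *: B0 + x^T *m (X + s *: nu)) / ((X *m nu^T) 0 0 + s).
Proof.
move=> xx EE Ex nn An Bn xA xB b0 D0; set b := (X *m nu^T) 0 0 in b0 *.
set A := E *m A0; set B := E *m B0 => g h.
pose J : 'M[R]_n.+1 := col_mx x E.
have J2 : \det J ^+ 2 = 1 by exact: row_orthogonal_mx.
pose d s := \det (col_mx nu (A + s *: B) : 'M[R]_n.+1).
have Mn s : (A + s *: B) *m nu^T = 0.
  by rewrite mulmxDl -scalemxAl -!mulmxA An Bn !mulmx0 scaler0 addr0.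
have JD s : \det J * \det (A0 + s *: B0 + x^T *m (X + s *: nu)) = (b + s) * d s.
  rewrite -det_mulmx /J (@mul_col_mx _ 1 n) !mulmxDr -!scalemxAr xA xB !mulmxA xx Ex.
  rewrite !mul0mx !mul1mx !scaler0 !add0r !addr0.
  rewrite -/A -/B (det_col_mx_orthogonal _ nn (Mn s)) // mulmxDl -scalemxAl nn.
  by congr (_ * _); rewrite mxE -/b scale_scalar_mx mulr1 mxE eqxx.
have d0E : \det J * d 0 = \det (A0 + x^T *m X) / b.
  apply: (canRL (mulfK (lt0r_neq0 b0))).
  have := JD 0; rewrite !scale0r !addr0 => JD0.
  by rewrite -mulrA [d 0 * b]mulrC -JD0 mulrA -expr2 J2 mul1r.
have Jd0 : 0 < \det J * d 0 by rewrite d0E divr_gt0.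
have dd s : d s * d 0 = \det (g + s *: h).
  rewrite /d -[\det (col_mx nu (A + 0 *: B))]det_tr -det_mulmx.
  rewrite scale0r addr0 (@tr_col_mx _ 1 n) (@mul_col_row _ 1 n _ 1 n) nn Mn mulmxDl -scalemxAl -/g -/h.
  have -> : nu *m A^T = 0.
    by have := congr1 trmx (Mn 0); rewrite scale0r addr0 trmx_mul trmxK trmx0.
  by rewrite (@det_ublock _ 1 n) det1 mul1r.
have gE : \det g = d 0 ^+ 2 by rewrite expr2 dd scale0r addr0.
have d00 : d 0 != 0 by apply: contraTneq Jd0 => ->; rewrite mulr0 ltxx.
have g0 : 0 < \det g by rewrite gE exprn_even_gt0.
split => // s s0.
have -> : Num.sqrt (\det g) = \det J * d 0.
  by rewrite -[\det g]mul1r -J2 gE -exprMn sqrtr_sqr gtr0_norm.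
have gu : g \in unitmx by rewrite unitmxE unitfE gt_eqF.
have -> : \det (1%:M + s *: (h *m invmx g)) = d s / d 0.
  apply: (mulIf (lt0r_neq0 g0)); rewrite -det_mulmx mulmxDl mul1mx -scalemxAl.
  by rewrite mulmxKV // -dd gE expr2 mulrA divfK.
apply: (canRL (mulfK (lt0r_neq0 (addr_gt0 b0 s0)))).
transitivity (\det J * ((b + s) * d s)); last by rewrite -JD mulrA -expr2 J2 mul1r.
by field.
Qed.

(** The reflection H exchanging x and the first basis vector is orthogonal, and
    its first row is x: the other rows are the complement. *)
Lemma orthonormal_complement (R : rcfType) n (x : 'rV[R]_n.+1) :
  x *m x^T = 1%:M ->
  exists E : 'M[R]_(n, n.+1), E *m E^T = 1%:M /\ E *m x^T = 0.
Proof.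
move=> xx; pose e : 'rV[R]_n.+1 := delta_mx 0 0.
have [H [HH HT eH]] : exists H : 'M[R]_n.+1, [/\ H *m H^T = 1%:M, H^T = H & e *m H = x].
  have ee : e *m e^T = 1%:M.
    by apply/matrixP => i j; rewrite !ord1 trmx_delta mul_delta_mx !mxE.
  have [->|xe] := eqVneq x e.
    by exists 1%:M; split; rewrite ?trmx1 ?mulmx1.
  pose w := x - e; pose q := (w *m w^T) 0 0.
  pose c := (x *m e^T) 0 0.
  have xeC : x *m e^T = c%:M by rewrite [LHS]mx11_scalar.
  have exC : e *m x^T = c%:M.
    by rewrite -[LHS]trmxK trmx_mul trmxK xeC tr_scalar_mx.
  have wwE : w *m w^T = q%:M by rewrite [LHS]mx11_scalar.
  have qE : q = 2 - 2 * c.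
    rewrite /q /w linearB /= mulmxBl !mulmxBr xx ee xeC exC !mxE !eqxx /=.
    by rewrite mulr1n; ring.
  have q0 : q != 0.
    apply: contra_neq xe => q0; apply/eqP; rewrite -subr_eq0; apply/eqP/rowP => j.
    move/eqP: q0; rewrite /q mxE psumr_eq0; last by move=> i _; rewrite [w^T _ _]mxE -expr2 sqr_ge0.
    move=> /allP/(_ j); rewrite mem_index_enum => /(_ isT) /=.
    by rewrite [w^T _ _]mxE mulf_eq0 orbb => /eqP ->; rewrite mxE.
  exists (1%:M - (2 / q) *: (w^T *m w)).
  have HT : (1%:M - (2 / q) *: (w^T *m w))^T = 1%:M - (2 / q) *: (w^T *m w).
    by rewrite linearB linearZ /= trmx_mul trmxK trmx1.
  split => //.
    have SS : (w^T *m w) *m (w^T *m w) = q *: (w^T *m w).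
      by rewrite mulmxA -[w^T *m w *m w^T]mulmxA wwE mul_mx_scalar -scalemxAl.
    rewrite HT; move: SS; set S := w^T *m w => SS.
    rewrite mulmxBl mul1mx mulmxBr mulmx1 -!scalemxAl -!scalemxAr SS [_ *: (q *: _)]scalerA divfK // scalerA.
    have -> : 2 / q * 2 = 2 / q + 2 / q by ring.
    by rewrite scalerDl opprB addrK subrK.
  rewrite mulmxBr mulmx1 -scalemxAr mulmxA.
  have -> : e *m w^T = (c - 1)%:M by rewrite linearB /= mulmxBr exC ee -raddfB.
  rewrite mul_scalar_mx scalerA.
  have -> : 2 / q * (c - 1) = -1.
    by apply: (mulIf q0); rewrite mulrAC divfK // qE; ring.
  by rewrite scaleN1r opprK /w addrC subrK.
exists (dsubmx (H : 'M[R]_(1 + n, n.+1))).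
have xE : usubmx (H : 'M[R]_(1 + n, n.+1)) = x.
  rewrite -eH; apply/rowP => j; rewrite !mxE (bigD1 0) //= big1 ?addr0.
    by rewrite mxE !eqxx mul1r; congr (H _ _); apply/val_inj.
  by move=> i i0; rewrite mxE (negbTE i0) andbF mul0r.
set E := dsubmx _.
have HE : H = col_mx x E by rewrite -xE vsubmxK.
have := HH; rewrite HE (@tr_col_mx _ 1 n) (@mul_col_row _ 1 n _ 1 n).
by rewrite (@scalar_mx_block _ 1 n) => /(@eq_block_mx _ 1 n 1 n)[_ _ -> ->].
Qed.

(** c + N is the square of sqrt c + N / (2 sqrt c), so its determinant is
    nonnegative, and it is invertible because (c + N) (c - N) = c^2. *)
Lemma det_scalar_nilpotent (R : rcfType) n (N : 'M[R]_n.+1) (c : R) :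
  N *m N = 0 -> 0 < c -> 0 < \det (c%:M + N).
Proof.
move=> NN c0; pose r := Num.sqrt c; have r0 : 0 < r by rewrite sqrtr_gt0.
have rr : r * r = c by rewrite -expr2 sqr_sqrtr // ltW.
pose S : 'M[R]_n.+1 := r%:M + (2 * r)^-1 *: N.
have SS : c%:M + N = S *m S.
  have NN' : ((2 * r)^-1 *: N) *m ((2 * r)^-1 *: N) = 0.
    by rewrite -scalemxAl -scalemxAr NN !scaler0.
  rewrite /S mulmxDl !mulmxDr NN' addr0 mul_mx_scalar !mul_scalar_mx mul_mx_scalar.
  rewrite scale_scalar_mx rr !scalerA -addrA -scalerDl.
  have -> : r * (2 * r)^-1 + r * (2 * r)^-1 = 1 by field; rewrite gt_eqF.
  by rewrite scale1r.
rewrite lt_def; apply/andP; split; last by rewrite SS det_mulmx -expr2 sqr_ge0.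
have E : (c%:M + N) *m (c%:M - N) = (c * c)%:M.
  rewrite mulmxDl !mulmxBr NN subr0 !mul_scalar_mx mul_mx_scalar scale_scalar_mx.
  by rewrite subrK.
have : \det ((c%:M + N) *m (c%:M - N)) != 0.
  by rewrite E det_scalar expf_neq0 // mulf_neq0 // gt_eqF.
by rewrite det_mulmx mulf_eq0 negb_or => /andP[].
Qed.

(** * Functions of class C^r *)

Lemma continuous_at_sum (R : realType) (T : topologicalType) (I : Type)
    (s : seq I) (P : pred I) (F : I -> T -> R) (x : T) :
  (forall i, P i -> {for x, continuous (F i)}) ->
  {for x, continuous (fun y => \sum_(i <- s | P i) F i y)}.
Proof.
move=> Fc; elim: s => [|i s IHs].
  have -> : (fun y => \sum_(i <- [::] | P i) F i y) = (fun=> 0).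
    by apply/funext => y; rewrite big_nil.
  exact: cst_continuous.
have -> : (fun y => \sum_(j <- i :: s | P j) F j y) =
    (fun y => if P i then F i y + \sum_(j <- s | P j) F j y
              else \sum_(j <- s | P j) F j y).
  by apply/funext => y; rewrite big_cons.
case: (boolP (P i)) => // Pi; by apply: (@continuousD R R T (F i) (fun y => \sum_(j <- s | P j) F j y)) => //; exact: Fc.
Qed.

Section Calculus.
Context {R : realType} {m : nat}.
Implicit Types (f g : 'rV[R]_m -> R) (x v w : 'rV[R]_m) (U : set 'rV[R]_m).

Lemma coord_le_norm v i : `|v 0 i| <= `|v|.
Proof.
rewrite [leRHS]/Num.Def.normr /= mx_normrE.
exact: (le_bigmax _ (fun ij : 'I_1 * 'I_m => `|v ij.1 ij.2|) (0, i)).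
Qed.

Lemma rV_norm_le v (r : R) : 0 <= r -> (forall i, `|v 0 i| <= r) -> `|v| <= r.
Proof.
move=> r0 vr; rewrite [leLHS]/Num.Def.normr /= mx_normrE.
by apply: bigmax_le => // -[i j] _ /=; rewrite ord1.
Qed.

Lemma line_growth f x v (t : R) :
  (fun h : R => h^-1 *: (((fun r : R => f (x + r *: v)) \o shift t) (h *: (1 : R))
     - f (x + t *: v))) =
  (fun h => h^-1 *: ((f \o shift (x + t *: v)) (h *: v) - f (x + t *: v))).
Proof.
apply/funext => h /=; congr (_ *: (f _ - _)).
by rewrite -[h *: 1]/(h * 1) mulr1 scalerDl addrCA.
Qed.

Lemma is_derive_line f x v (t : R) : derivable f (x + t *: v) v ->
  is_derive t (1 : R) (fun r : R => f (x + r *: v)) ('D_v f (x + t *: v)).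
Proof.
move=> df; split; first by rewrite /derivable line_growth.
by rewrite /derive line_growth.
Qed.

(** Stated with |t| <= |h| so that no sign of h has to be distinguished later.
    *)
Lemma derive_mean_value f x v (h : R) :
  (forall t : R, `|t| <= `|h| -> derivable f (x + t *: v) v) ->
  exists2 t : R, `|t| <= `|h| & f (x + h *: v) - f x = h * 'D_v f (x + t *: v).
Proof.
move=> df; pose F (r : R) := f (x + r *: v).
pose dF (r : R) := 'D_v f (x + r *: v).
have dFP (t : R) : `|t| <= `|h| -> is_derive t (1 : R) F (dF t).
  by move=> th; apply: is_derive_line; exact: df.
have cF (a b : R) : (forall t : R, t \in `[a, b]%R -> `|t| <= `|h|) ->
    {within `[a, b], continuous F}.
  move=> ab; apply: derivable_within_continuous => t /ab /dFP[]//.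
have x0 : f x = F 0 by rewrite /F scale0r addr0.
case: (lerP 0 h) => h0.
  have th (t : R) : t \in `[0, h]%R -> `|t| <= `|h|.
    by rewrite in_itv /= => /andP[t0 th]; rewrite !ger0_norm.
  have [t th' E] := @MVT_segment R F dF 0 h h0
    (fun t tI => dFP t (th t (subset_itv_oo_cc tI))) (cF _ _ th).
  exists t; first exact: th.
  by rewrite x0 -/(F h) E subr0 mulrC.
have th (t : R) : t \in `[h, 0]%R -> `|t| <= `|h|.
  by rewrite in_itv /= => /andP[ht t0]; rewrite (ltr0_norm h0) ler0_norm // lerN2.
have [t th' E] := @MVT_segment R F dF h 0 (ltW h0)
  (fun t tI => dFP t (th t (subset_itv_oo_cc tI))) (cF _ _ th).
exists t; first exact: th.
by rewrite x0 -/(F h) -opprB E sub0r mulrN opprK mulrC.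
Qed.

Lemma near_translate U x v w : open U -> U x ->
  exists2 d : R, 0 < d & forall s t : R, `|s| < d -> `|t| < d ->
    U (x + s *: v + t *: w).
Proof.
move=> oU Ux; have /nbhs_ballP[e /= e0 eU] := open_nbhs_nbhs (conj oU Ux).
exists (e / (`|v| + `|w| + 1)).
  by rewrite divr_gt0 // ltr_wpDl // addr_ge0.
move=> s t; rewrite !ltr_pdivlMr ?ltr_wpDl ?addr_ge0 // => sd td.
apply: eU; rewrite -ball_normE /= -addrA opprD addrA subrr sub0r normrN.
have [st|ts] := lerP `|s| `|t|.
  apply: le_lt_trans td; rewrite (le_trans (ler_normD _ _)) // !normrZ.
  have := ler_wpM2r (normr_ge0 v) st; have := normr_ge0 t; lra.
apply: le_lt_trans sd; rewrite (le_trans (ler_normD _ _)) // !normrZ.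
have := ler_wpM2r (normr_ge0 w) (ltW ts); have := normr_ge0 s; lra.
Qed.

(** The second difference of f over a small parallelogram is computed by two
    mean value theorems, in both orders; each gives a mixed derivative at a
    point close to x, and these derivatives are continuous at x. *)
Lemma class_C_Schwarz U f x v w : open U -> class_C 2 U f -> U x ->
  'D_v ('D_w f) x = 'D_w ('D_v f) x.
Proof.
move=> oU fC Ux; apply/eqP; rewrite -subr_eq0 -normr_le0.
apply/ler_addgt0Pl => e e0; rewrite addr0.
have cvw a b : {for x, continuous ('D_a ('D_b f))} by have [_ /(_ a)[_]] := fC b; apply.
have e2 : 0 < e / 2 by rewrite divr_gt0.
have [d1 d10 dU] := near_translate v w oU Ux.
have [d2 d20 H2] : exists2 d : R, 0 < d & forall s t : R, `|s| < d -> `|t| < d ->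
    `|'D_v ('D_w f) x - 'D_v ('D_w f) (x + s *: v + t *: w)| < e / 2 /\
    `|'D_w ('D_v f) x - 'D_w ('D_v f) (x + s *: v + t *: w)| < e / 2.
  have := cvw v w => /cvgrPdist_lt/(_ _ e2)/nbhs_ballP[r1 /= r10 R1].
  have := cvw w v => /cvgrPdist_lt/(_ _ e2)/nbhs_ballP[r2 /= r20 R2].
  have [da da0 A] := near_translate v w (ball_open x r1) (ballxx x r10).
  have [db db0 B] := near_translate v w (ball_open x r2) (ballxx x r20).
  exists (Num.min da db); first by rewrite lt_min da0.
  move=> s t; rewrite !lt_min => /andP[sa sb] /andP[ta tb]; split.
    exact: (R1 _ (A s t sa ta)).
  exact: (R2 _ (B s t sb tb)).
pose h := Num.min d1 d2 / 2.
have h0 : 0 < h by rewrite divr_gt0 // lt_min d10.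
have hd : `|h| < Num.min d1 d2.
  by rewrite gtr0_norm // /h gtr_pMr ?lt_min ?d10 // invf_lt1 // ltr1n.
have lth (t : R) : `|t| <= `|h| -> `|t| < d1 /\ `|t| < d2.
  by move=> th; have := le_lt_trans th hd; rewrite lt_min => /andP.
have key a b (da : forall s t : R, `|s| < d1 -> `|t| < d1 -> U (x + s *: a + t *: b)) :
  exists s t : R, [/\ `|s| <= `|h|, `|t| <= `|h| &
    f (x + h *: a + h *: b) - f (x + h *: a) - (f (x + h *: b) - f x) =
    h * (h * 'D_b ('D_a f) (x + s *: a + t *: b))].
  pose g y := f (y + h *: b) - f y.
  have shiftd (c y z : 'rV[R]_m) : derivable f (y + z) c ->
      is_derive y c (fun y => f (y + z)) ('D_c f (y + z)).
    move=> df.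
    have E : (fun r : R => r^-1 *: (((fun y => f (y + z)) \o shift y) (r *: c) - f (y + z)))
        = (fun r => r^-1 *: ((f \o shift (y + z)) (r *: c) - f (y + z))).
      by apply/funext => r /=; rewrite addrA.
    by split; rewrite /derivable /derive E.
  have df y c : U y -> derivable f y c by move=> Uy; have [/(_ y Uy)] := fC c.
  have gd (s : R) : `|s| <= `|h| ->
     is_derive (x + s *: a) a g ('D_a f (x + s *: a + h *: b) - 'D_a f (x + s *: a)).
    move=> /lth[sd1 _]; apply: is_deriveB.
      by apply: shiftd; apply: df; apply: da => //; have [] := lth h (lexx _).
    apply: derivableP; apply: df.
    have := da s 0 sd1; rewrite scale0r addr0; apply; by rewrite normr0.
  have [|s sh Es] := @derive_mean_value g x a h; first by move=> t /gd[].
  have [|t th Et] := @derive_mean_value ('D_a f) (x + s *: a) b h.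
    move=> t th; have [_ /(_ b)[+ _]] := fC a; apply.
    by apply: da; [have [] := lth s sh|have [] := lth t th].
  exists s, t; split => //; rewrite -Et.
  by have [_ <-] := gd s sh; rewrite -Es.
have [s [t [sh th E1]]] := key v w dU.
have [|s' [t' [sh' th' E2]]] := key w v.
  by move=> s' t' sd td; rewrite addrAC; apply: dU.
have C1 : x + h *: w + h *: v = x + h *: v + h *: w by rewrite addrAC.
have C2 : x + t' *: v + s' *: w = x + s' *: w + t' *: v by rewrite addrAC.
rewrite {}C1 in E2.
have h2 (a b : R) : h * (h * a) = h * (h * b) -> a = b.
  by move=> /(mulfI (lt0r_neq0 h0))/(mulfI (lt0r_neq0 h0)).
have sw (p q r z : R) : p - q - (r - z) = p - r - (q - z) by ring.
have E : 'D_w ('D_v f) (x + s *: v + t *: w) = 'D_v ('D_w f) (x + s' *: w + t' *: v).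
  exact: h2 (etrans (esym E1) (etrans (sw _ _ _ _) E2)).
have [sd1 sd2] := lth _ sh; have [td1 td2] := lth _ th.
have [sd1' sd2'] := lth _ sh'; have [td1' td2'] := lth _ th'.
have [A1 _] := H2 t' s' td2' sd2'; rewrite {}C2 -E in A1.
have [_ A2] := H2 s t sd2 td2.
move: ('D_w ('D_v f) (x + s *: v + t *: w)) A1 A2 => y.
move: ('D_v ('D_w f) x) ('D_w ('D_v f) x) => a b A1 A2.
rewrite (splitr e) -(subrKA y); apply: le_trans (ler_normD _ _) _.
by apply: lerD; rewrite ?[`|y - b|]distrC ltW.
Qed.

(** The class is defined by directional derivatives, so that total
    differentiability has to be recovered: the increment f (x + h) - f x is cut
    into increments parallel to the axes, and each one is treated by the mean
    value theorem. *)
Lemma class_C1_differentiable U f x :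
  open U -> class_C 1 U f -> U x -> differentiable f x.
Proof.
move=> oU fC Ux; pose e i : 'rV[R]_m := delta_mx 0 i.
pose df v := \sum_i v 0 i * 'D_(e i) f x.
have df_lin : linear df.
  move=> c a b; rewrite /df scaler_sumr -big_split /=; apply: eq_bigr => i _.
  by rewrite !mxE mulrDl -mulrA.
pose dfM := GRing.isLinear.Build _ _ _ _ _ df_lin.
pose dfL : {linear 'rV[R]_m -> R} := HB.pack df dfM.
have dfc : continuous dfL.
  move=> y; rewrite /= /df; apply: continuous_at_sum => i _.
  apply: (@continuousM R _ (fun v : 'rV[R]_m => v 0 i) (fun=> 'D_(e i) f x)).
    exact: coord_continuous.
  exact: cst_continuous.
have E : f \o shift x = cst (f x : R^o) + (dfL : 'rV[R]_m -> R^o)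
    +o_ (0 : 'rV[R]_m) id.
  apply/eqaddoP => _/posnumP[eps].
  pose e1 := eps%:num / (m.+1)%:R.
  have e10 : 0 < e1 by rewrite divr_gt0.
  have near_d : \forall y \near x, U y /\ forall i,
      `|'D_(e i) f x - 'D_(e i) f y| <= e1.
    near=> y; split; first by near: y; exact: open_nbhs_nbhs.
    near: y; apply: filter_forall => i.
    have [_ /(_ x Ux)/cvgrPdist_le/(_ _ e10)] := fC (e i).
    exact.
  have /nbhs_ballP[r /= r0 Hr] := near_d.
  near=> h.
  have hr : `|h| < r.
    by near: h; apply/nbhs_ballP; exists r => //= y; rewrite -ball_normE /= sub0r normrN.
  pose xk k := x + \row_i (if (i < k)%N then h 0 i else 0).
  have xk0 : xk 0%N = x by rewrite /xk -[RHS]addr0; congr (_ + _); apply/rowP => i; rewrite !mxE.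
  have xkm : xk m = h + x.
    by rewrite /xk addrC; congr (_ + _); apply/rowP => i; rewrite !mxE ltn_ord.
  rewrite -[(_ - _) h]/(f (h + x) - (f x + df h)) opprD addrA.
  rewrite -xkm -{1}xk0 -(telescope_sumr (fun k => f (xk k))) // big_mkord /df -sumrB.
  apply: le_trans (ler_norm_sum _ _ _) _.
  apply: (@le_trans _ _ (\sum_(i < m) e1 * `|h|)); last first.
    rewrite sumr_const card_ord -mulr_natr mulrAC ler_wpM2r //.
    by rewrite /e1 mulrAC ler_pdivrMr // ler_wpM2l // ler_nat.
  apply: ler_sum => i _.
  have xkS : xk i.+1 = xk i + h 0 i *: e i.
    rewrite /xk -addrA; congr (_ + _); apply/rowP => j; rewrite !mxE ltnS leq_eqVlt eqxx /=.
    case: (eqVneq j i) => [->|ji]; first by rewrite eqxx ltnn add0r mulr1.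
    by rewrite (negbTE (ji : j != i :> nat)) mulr0 addr0.
  have seg (t : R) : `|t| <= `|h 0 i| -> ball x r (xk i + t *: e i).
    move=> th; rewrite -ball_normE /= /xk -addrA opprD addrA subrr sub0r normrN.
    apply: le_lt_trans hr; apply: rV_norm_le => // j; rewrite !mxE eqxx /=.
    case: (eqVneq j i) => [->|ji]; last first.
      by rewrite mulr0 addr0; case: ifP => _; rewrite ?normr0 ?coord_le_norm.
    by rewrite ltnn add0r mulr1 (le_trans th) // coord_le_norm.
  rewrite xkS.
  have [|t th ->] := @derive_mean_value f (xk i) (e i) (h 0 i).
    move=> t th; have [+ _] := fC (e i); apply.
    by have [] := Hr _ (seg t th).
  rewrite -mulrBr normrM mulrC ler_pM ?coord_le_norm //.
  by rewrite distrC; have [_ ->] := Hr _ (seg t th).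
have dE := diff_unique dfc E.
by apply/diff_locallyP; rewrite dE.
Unshelve. all: by end_near. Qed.

(** On an open set, directional derivatives depend only on the values taken in
    that set. *)
Lemma class_C_ext r U f g : open U -> (forall x, U x -> f x = g x) ->
  class_C r U f -> class_C r U g.
Proof.
move=> oU; elim: r f g => [|r IHr] f g fg /=.
  move=> fc x Ux.
  have nfg : {near x, f =1 g}.
    by apply: filterS (open_nbhs_nbhs (conj oU Ux)) => y /fg.
  rewrite /prop_for /continuous_at -(fg x Ux).
  exact: (cvg_trans (near_eq_cvg nfg) (fc x Ux)).
move=> fc v; have [df dfc] := fc v.
have nfg x : U x -> {near x, f =1 g}.
  by move=> Ux; apply: filterS (open_nbhs_nbhs (conj oU Ux)) => y /fg.
split=> [x Ux|]; first exact: near_eq_derivable (nfg x Ux) (df x Ux).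
by apply: IHr dfc => x Ux; apply: near_eq_derive; exact: nfg.
Qed.

Lemma class_CS r U f : open U -> class_C r.+1 U f -> class_C r U f.
Proof.
move=> oU; elim: r f => [|r IHr] f fC.
  by move=> x Ux; apply: differentiable_continuous; exact: class_C1_differentiable fC Ux.
by move=> v; have [df dfC] := fC v; split => //; exact: IHr.
Qed.

Lemma class_C_le r s U f : open U -> (r <= s)%N -> class_C s U f -> class_C r U f.
Proof.
move=> oU /subnK <-; elim: (s - r)%N => // k IHk /(class_CS oU); exact: IHk.
Qed.

Lemma class_C_differentiable r U f x : open U -> (0 < r)%N ->
  class_C r U f -> U x -> differentiable f x.
Proof.
move=> oU r0 fC; apply: class_C1_differentiable => //; exact: class_C_le fC.
Qed.

Lemma class_C_cst r U (c : R) : class_C r U (fun=> c).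
Proof.
elim: r c => [|r IHr] c /=; first by move=> x Ux; exact: cst_continuous.
move=> v; split=> [x _|]; first exact: derivable_cst.
suff -> : 'D_v (fun=> c) = (fun=> 0) by exact: IHr.
by apply/funext => x; rewrite derive_cst.
Qed.

Lemma is_derive_coord x v i : is_derive x v (fun y : 'rV[R]_m => y 0 i) (v 0 i).
Proof.
split; first by apply: diff_derivable; exact: differentiable_coord.
have := @derive_mx _ _ 1 m id x v (derivable_id (x := x) (v := v)).
by rewrite derive_id => /rowP/(_ i); rewrite mxE.
Qed.

Lemma class_C_coord r U i : class_C r U (fun y => y 0 i).
Proof.
case: r => [|r] /=; first by move=> x _; exact: coord_continuous.
move=> v; split=> [x _|]; first by have [] := is_derive_coord x v i.
suff -> : 'D_v (fun y : 'rV[R]_m => y 0 i) = (fun=> v 0 i) by exact: class_C_cst.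
by apply/funext => x; have [] := is_derive_coord x v i.
Qed.

Lemma class_CD r U f g : open U -> class_C r U f -> class_C r U g ->
  class_C r U (fun y => f y + g y).
Proof.
move=> oU; elim: r f g => [|r IHr] f g fC gC /=.
  by move=> x Ux; apply: (@continuousD R R _ f g); [exact: fC|exact: gC].
move=> v; have [df dfC] := fC v; have [dg dgC] := gC v; split=> [x Ux|].
  by apply: derivableD; [exact: df|exact: dg].
apply: class_C_ext (IHr _ _ dfC dgC) => // x Ux.
by rewrite -deriveD //; [exact: df|exact: dg].
Qed.

Lemma class_CM r U f g : open U -> class_C r U f -> class_C r U g ->
  class_C r U (fun y => f y * g y).
Proof.
move=> oU; elim: r f g => [|r IHr] f g fC gC /=.
  by move=> x Ux; apply: (@continuousM R _ f g); [exact: fC|exact: gC].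
move=> v; have [df dfC] := fC v; have [dg dgC] := gC v; split=> [x Ux|].
  by apply: derivableM; [exact: df|exact: dg].
have := class_CD oU (IHr _ _ (class_CS oU fC) dgC) (IHr _ _ (class_CS oU gC) dfC).
apply: class_C_ext => // x Ux.
by rewrite (@deriveM _ _ f g) //; [exact: df|exact: dg].
Qed.

Lemma class_CN r U f : open U -> class_C r U f -> class_C r U (fun y => - f y).
Proof.
move=> oU fC; apply: class_C_ext (class_CM oU (@class_C_cst r U (-1)) fC) => // x _.
by rewrite mulN1r.
Qed.

Lemma class_CB r U f g : open U -> class_C r U f -> class_C r U g ->
  class_C r U (fun y => f y - g y).
Proof. by move=> oU fC gC; apply: class_CD => //; exact: class_CN. Qed.

Lemma class_C_sum r U (I : Type) (s : seq I) (P : pred I) (F : I -> 'rV[R]_m -> R) :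
  open U -> (forall i, P i -> class_C r U (F i)) ->
  class_C r U (fun y => \sum_(i <- s | P i) F i y).
Proof.
move=> oU FC; elim: s => [|i s IHs].
  by under eq_fun do rewrite big_nil; exact: class_C_cst.
under eq_fun do rewrite big_cons; case: (boolP (P i)) => // Pi.
by apply: class_CD => //; exact: FC.
Qed.

Lemma class_C_prod r U (I : Type) (s : seq I) (P : pred I) (F : I -> 'rV[R]_m -> R) :
  open U -> (forall i, P i -> class_C r U (F i)) ->
  class_C r U (fun y => \prod_(i <- s | P i) F i y).
Proof.
move=> oU FC; elim: s => [|i s IHs].
  by under eq_fun do rewrite big_nil; exact: class_C_cst.
under eq_fun do rewrite big_cons; case: (boolP (P i)) => // Pi.
by apply: class_CM => //; exact: FC.
Qed.

Lemma class_CV r U f : open U -> (forall x, U x -> f x != 0) ->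
  class_C r U f -> class_C r U (fun y => (f y)^-1).
Proof.
move=> oU f0; elim: r => [|r IHr] fC /=.
  by move=> x Ux; apply: (@continuousV R _ f); [exact: f0|exact: fC].
move=> v; have [df dfC] := fC v; split=> [x Ux|].
  by apply: (@derivableV _ _ f); [exact: f0|exact: df].
have fV := IHr (class_CS oU fC).
apply: class_C_ext (class_CN oU (class_CM oU (class_CM oU fV fV) dfC)) => // x Ux.
rewrite (@deriveV _ _ f) ?f0 //; last exact: df.
by rewrite -mulNr expr2 invfM.
Qed.

Lemma is_derive_outer (G : R -> R) (d : R) f x v :
  is_derive (f x) (1 : R) G d -> differentiable f x ->
  is_derive x v (fun y => G (f y)) (d * 'D_v f x).
Proof.
move=> GD df.
have dG : differentiable G (f x) by apply/derivable1_diffP; have [] := GD.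
have dc : differentiable (G \o f) x by exact: differentiable_comp.
split; first exact: diff_derivable.
rewrite -[fun _ => _]/(G \o f) deriveE // diff_comp //= deriveE //.
have -> (a : R) : 'd G (f x) a = a *: 'd G (f x) 1.
  by rewrite -linearZ /= -[a *: 1]/(a * 1) mulr1.
have -> : 'd G (f x) 1 = d by have [_ <-] := GD; rewrite deriveE.
by rewrite -[_ *: _]/(_ * _) mulrC.
Qed.

Lemma is_derive_sqrt f x v : 0 < f x -> differentiable f x ->
  is_derive x v (fun y => Num.sqrt (f y)) ((2 * Num.sqrt (f x))^-1 * 'D_v f x).
Proof. by move=> f0; apply: is_derive_outer; exact: is_derive1_sqrt. Qed.

(** Needed beside the closure of the classes under algebraic operations for the
    square of the positive part, which is of class C^1 but not C^2. *)
Lemma class_C1_outer U (G dG : R -> R) f :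
  (forall y, is_derive y (1 : R) G (dG y)) -> continuous dG -> open U ->
  class_C 1 U f -> class_C 1 U (fun y => G (f y)).
Proof.
move=> GD dGc oU fC v.
have D x : U x -> is_derive x v (fun y => G (f y)) (dG (f x) * 'D_v f x).
  by move=> Ux; apply: is_derive_outer => //; exact: class_C1_differentiable fC Ux.
split=> [x /D[]//|].
have dC : class_C 0 U (fun y => dG (f y)).
  move=> x Ux; apply: continuous_comp; last exact: dGc.
  by apply: differentiable_continuous; exact: class_C1_differentiable fC Ux.
have dvC : class_C 0 U ('D_v f) by have [] := fC v.
apply: class_C_ext (class_CM oU dC dvC) => // x Ux.
by have [_ ->] := D x Ux.
Qed.

Lemma class_C_sqrt r U f : open U -> (forall x, U x -> 0 < f x) ->
  class_C r U f -> class_C r U (fun y => Num.sqrt (f y)).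
Proof.
move=> oU f0; elim: r => [|r IHr] fC /=.
  by move=> x Ux; apply: continuous_comp; [exact: fC|exact: sqrt_continuous].
have dfx x : U x -> differentiable f x by exact: class_C_differentiable fC.
move=> v; have [df dfC] := fC v; split=> [x Ux|].
  by have [] := is_derive_sqrt v (f0 x Ux) (dfx x Ux).
have fS := IHr (class_CS oU fC).
have sV : class_C r U (fun y => (2 * Num.sqrt (f y))^-1).
  apply: class_CV => //; first by move=> x Ux; rewrite mulf_neq0 // gt_eqF // sqrtr_gt0 f0.
  by apply: class_CM => //; exact: class_C_cst.
apply: class_C_ext (class_CM oU sV dfC) => // x Ux.
by have [_ ->] := is_derive_sqrt v (f0 x Ux) (dfx x Ux).
Qed.

End Calculus.

(** * Integration on R^m *)

Definition tuple_row {R : realType} {m : nat} (t : m.-tuple R) : 'rV[R]_m :=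
  \row_i tnth t i.

Lemma tuple_row_cons {R : realType} {m : nat} (x : R) (t : m.-tuple R) :
  tuple_row (tuple_cons (x, t)) = tuple_row (tuple_cons (0, t)) + x *: delta_mx 0 0.
Proof.
apply/rowP => i; rewrite !mxE eqxx /= !(tnth_nth 0) /=.
by case: (unliftP ord0 i) => [j ->|->] /=; rewrite ?mulr0 ?addr0 ?mulr1 ?add0r.
Qed.

Section Measurability.
Context {R : realType} {m : nat}.
Implicit Types (f : 'rV[R]_m -> R) (U : set 'rV[R]_m).

(** An open set is the union of the countably many boxes with rational centre
    and radius 1 / (k + 1) that it contains, and boxes are measurable for the
    product sigma-algebra on tuples. *)
Lemma measurable_open_rV U : open U -> measurable [set t : m.-tuple R | U (tuple_row t)].
Proof.
move=> oU.
pose box (p : 'rV[rat]_m * nat) : set (m.-tuple R) :=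
  \bigcap_(i in [set: 'I_m])
    ((fun t : m.-tuple R => tnth t i) @^-1` ball (ratr (p.1 0 i) : R) (p.2.+1%:R^-1)).
pose good p := box p `<=` [set t : m.-tuple R | U (tuple_row t)].
have -> : [set t : m.-tuple R | U (tuple_row t)] =
    \bigcup_p (if `[< good p >] then box p else set0).
  apply/seteqP; split=> t /=; last first.
    by move=> [p _]; case: asboolP => // gp /gp.
  move=> Ut; have /nbhs_ballP[e /= e0 eU] := open_nbhs_nbhs (conj oU Ut).
  have [k k0] : exists k : nat, k.+1%:R^-1 < e / 2.
    have [k _ /(_ k (leqnn k)) /= Hk] : \forall k \near \oo, (k.+1%:R^-1 : R) < e / 2.
      by apply: near_infty_natSinv_lt (PosNum (divr_gt0 e0 (ltr0n _ 2))).
    by exists k.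
  have kp : 0 < (k.+1%:R^-1 : R) by rewrite invr_gt0.
  have qex i : exists q : rat, `|ratr q - tnth t i| < (k.+1%:R^-1 : R).
    have [|q] := @rat_in_itvoo R (tnth t i) (tnth t i + k.+1%:R^-1).
      by rewrite ltrDl.
    rewrite in_itv /= => /andP[q1 q2]; exists q.
    by rewrite ger0_norm ?subr_ge0 ?ltW // ltrBlDl.
  pose q : 'rV[rat]_m := \row_i sval (cid (qex i)).
  have qP i : `|ratr (q 0 i) - tnth t i| < (k.+1%:R^-1 : R).
    by rewrite mxE; case: cid.
  exists (q, k) => //; case: asboolP => [_ i _ /=|]; first exact: qP.
  case=> s /= sb; apply: eU; rewrite -ball_normE /=.
  have se i : `|tnth t i - tnth s i| <= 2 * k.+1%:R^-1.
    rewrite -(subrKA (ratr (q 0 i))) (le_trans (ler_normD _ _)) // mulr2n mulrDl mul1r.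
    by apply: lerD; rewrite ltW // ?[`|tnth t i - _|]distrC ?qP //; exact: (sb i).
  apply: (@le_lt_trans _ _ (2 * k.+1%:R^-1)); last by rewrite mulrC -ltr_pdivlMr.
  by apply: rV_norm_le => [|i]; [rewrite mulr_ge0 // ltW|rewrite !mxE].
apply: countable_bigcupT_measurable; first exact: countableP.
move=> p; case: ifP => _ //; apply: fin_bigcap_measurable => // i _.
rewrite -[X in measurable X]setTI; apply: measurable_tnth => //.
by apply: open_measurable; exact: ball_open.
Qed.

Lemma measurable_fun_rV U f : open U -> (forall x, U x -> {for x, continuous f}) ->
  measurable_fun [set t : m.-tuple R | U (tuple_row t)] (f \o tuple_row).
Proof.
move=> oU fc mD; apply: (measurability _ (RGenOpens.measurableE R)) => //.
move=> _ [_ [a [b ->] <-]].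
rewrite (_ : _ `&` _ = [set t | (U `&` f @^-1` `]a, b[%classic) (tuple_row t)]) //.
apply: measurable_open_rV; rewrite openE => x [Ux fx].
apply: filterI; first exact: open_nbhs_nbhs.
by apply: (fc x Ux); apply: open_nbhs_nbhs; split => //; exact: interval_open.
Qed.

Lemma measurable_fun_rVT f : continuous f -> measurable_fun setT (f \o @tuple_row R m).
Proof.
move=> fc; rewrite (_ : setT = [set t | [set: 'rV[R]_m] (tuple_row t)]) //.
by apply: measurable_fun_rV => [|x _]; [exact: openT|exact: fc].
Qed.

End Measurability.

Definition tuple_box {R : realType} (m : nat) (r : R) : set (m.-tuple R) :=
  [set t | forall i, `|tnth t i| <= r].
Arguments tuple_box {R} m r _ : rename.

Lemma measurable_tuple_box {R : realType} (m : nat) (r : R) :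
  measurable (tuple_box m r).
Proof.
have -> : tuple_box m r = \bigcap_(i in [set: 'I_m])
    ((fun t : m.-tuple R => tnth t i) @^-1` `[- r, r]%classic).
  apply/seteqP; split=> t H i => [_|]; have := H i; rewrite ?ler_norml /= ?in_itv //=.
  exact.
apply: fin_bigcap_measurable => // i _.
by rewrite -[X in measurable X]setTI; apply: measurable_tnth.
Qed.

Lemma tuple_cons_box {R : realType} (m : nat) (r : R) :
  tuple_cons @^-1` (tuple_box m.+1 r) = `[- r, r]%classic `*` tuple_box m r.
Proof.
apply/seteqP; split=> -[x t] /=.
  move=> H; split.
    by have := H ord0; rewrite (tnth_nth 0) /= in_itv /= -ler_norml.
  by move=> i; have := H (lift ord0 i); rewrite !(tnth_nth 0).
rewrite in_itv /= -ler_norml => -[xr tr] i; rewrite (tnth_nth 0) /=.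
by case: (unliftP ord0 i) => [j ->|->] //=; have := tr j; rewrite (tnth_nth 0).
Qed.

Lemma lebesgue_tuple_box_fin {R : realType} (m : nat) (r : R) :
  (lebesgue_tuple R m (tuple_box m r) < +oo)%E.
Proof.
elim: m => [|m IHm].
  by rewrite /= diracE; case: (_ \in _); rewrite ?ltry.
rewrite /= /lebesgue_cons /pushforward tuple_cons_box.
rewrite product_measure1E //; last exact: measurable_tuple_box.
rewrite lte_mul_pinfty //.
  by rewrite /= lebesgue_measure_itv /=; case: ifP.
Qed.

Lemma lebesgue_tuple_point {R : realType} (m : nat) (t : m.+1.-tuple R) :
  (lebesgue_tuple R m.+1 [set t] = 0)%E.
Proof.
rewrite /= /lebesgue_cons /pushforward.
have pE : tuple_cons @^-1` [set t] = [set thead t] `*` [set [tuple of behead t]].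
  apply/seteqP; split=> -[x s] /=.
    by move=> <-; split; [rewrite theadE|apply: val_inj].
  by move=> [-> ->]; rewrite /tuple_cons /= -tuple_eta.
have m1 : measurable [set [tuple of behead t]].
  have -> : [set [tuple of behead t]] = \bigcap_(i in [set: 'I_m])
      ((fun s : m.-tuple R => tnth s i) @^-1` [set tnth [tuple of behead t] i]).
    apply/seteqP; split=> s /=; first by move=> -> i _.
    by move=> H; apply: eq_from_tnth => i; exact: H.
  apply: fin_bigcap_measurable => // i _.
  by rewrite -[X in measurable X]setTI; apply: measurable_tnth.
by rewrite pE product_measure1E //= lebesgue_measure_set1 mul0e.
Qed.

Lemma bounded_support_integrable {d : measure_display} {T : measurableType d}
    {R : realType} (mu : {measure set T -> \bar R}) (D : set T) (f : T -> R) (C : R) :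
  measurable D -> (mu D < +oo)%E -> measurable_fun setT f ->
  (forall x, D x -> `|f x| <= C) -> (forall x, ~ D x -> f x = 0) ->
  mu.-integrable setT (EFin \o f).
Proof.
move=> mD muD mf fC f0.
have : mu.-integrable D (EFin \o f).
  apply: measurable_bounded_integrable => //.
    exact: measurable_funS mf.
  exists C; split; first exact: num_real.
  by move=> M CM x Dx; apply: le_trans (fC x Dx) (ltW CM).
rewrite integrable_mkcond //; congr (_.-integrable _ _).
apply/funext => x; rewrite patchE; case: ifPn => // /negP xD /=.
by rewrite f0 // => Dx; apply: xD; rewrite inE.
Qed.

Lemma box_support_bounded {R : realType} {m : nat} (f : 'rV[R]_m -> R) (r : R) :
  continuous f -> (forall (x : 'rV[R]_m) (j : 'I_m), r < `|x 0 j| -> f x = 0) ->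
  exists2 C, 0 <= C & forall x, `|f x| <= C.
Proof.
move=> fc f0; pose K := [set x : 'rV[R]_m | forall i, `[- r, r]%classic (x 0 i)].
have cK : compact K.
  by apply: (@rV_compact R m (fun=> `[- r, r]%classic)) => i; exact: segment_compact.
have cfK : compact (f @` K).
  by apply: continuous_compact => //; apply: continuous_subspaceT.
have [C [_ HC]] := compact_bounded cfK.
exists (Num.max (C + 1) 0); first by rewrite le_max lexx orbT.
move=> x; have [xK|/existsNP[j xj]] := pselect (K x).
  by rewrite le_max; apply/orP; left; apply: (HC (C + 1)); [rewrite ltrDl|exists x].
rewrite (f0 x j) ?normr0 ?le_max ?lexx ?orbT //.
by rewrite ltNge ler_norml; apply/negP => /andP[a b]; apply: xj; rewrite /= in_itv /= a.
Qed.

Lemma rV_support_integrable {R : realType} {m : nat} (f : 'rV[R]_m -> R) (r : R) :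
  continuous f -> (forall (x : 'rV[R]_m) (j : 'I_m), r < `|x 0 j| -> f x = 0) ->
  (lebesgue_tuple R m).-integrable setT (EFin \o (f \o tuple_row)).
Proof.
move=> fc f0; have [C _ HC] := box_support_bounded fc f0.
apply: (@bounded_support_integrable _ _ _ _ (tuple_box m r) _ C) => //.
- exact: measurable_tuple_box.
- exact: lebesgue_tuple_box_fin.
- exact: measurable_fun_rVT.
- by move=> t _ /=.
- move=> t; rewrite /tuple_box /= => /existsNP[i /negP]; rewrite -ltNge => ti.
  by apply: (f0 _ i); rewrite mxE.
Qed.

Lemma integral_derive_line {R : realType} (h dh : R -> R) (r : R) :
  0 < r -> (forall x, is_derive x (1 : R) h (dh x)) -> continuous dh ->
  (forall x, r <= `|x| -> h x = 0) -> (forall x, r <= `|x| -> dh x = 0) ->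
  (\int[lebesgue_measure]_x (dh x)%:E = 0)%E.
Proof.
move=> r0 hD dhc h0 dh0.
transitivity (\int[lebesgue_measure]_(x in `[(- r)%R, r]) (dh x)%:E)%E.
  rewrite [RHS]integral_mkcond; apply: eq_integral => x _.
  rewrite patchE; case: ifPn => // /negP; rewrite inE /= in_itv /= => xr.
  rewrite dh0 //; case: (leP r `|x|) => // /ltW; rewrite ler_norml => xr'.
  by case: xr.
have hc : continuous h.
  by move=> x; apply: differentiable_continuous; apply/derivable1_diffP; have [] := hD x.
rewrite (@continuous_FTC2 R dh h).
- by rewrite !h0 ?normrN ?gtr0_norm // subee.
- by rewrite -subr_gt0 opprK addr_gt0.
- by apply: continuous_subspaceT.
- split.
  + by move=> x _; have [] := hD x.
  + by apply: cvg_at_right_filter; exact: hc.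
  + by apply: cvg_at_left_filter; exact: hc.
- by move=> x _; rewrite derive1E; have [] := hD x.
Qed.

Section DivergenceCoordinate.
Context {R : realType}.

Lemma derive_outside {m} (phi : 'rV[R]_m -> R) (v : 'rV[R]_m) (r : R) :
  (forall (x : 'rV[R]_m) (j : 'I_m), r < `|x 0 j| -> phi x = 0) ->
  forall (x : 'rV[R]_m) (j : 'I_m), r < `|x 0 j| -> 'D_v phi x = 0.
Proof.
move=> f0 x j xj; rewrite -(derive_cst (V := 'rV[R]_m) (0 : R) x v).
apply: near_eq_derive; have := @coord_continuous R 1 m 0 j x => /cvgrPdist_lt.
have d0 : 0 < `|x 0 j| - r by rewrite subr_gt0.
move=> /(_ _ d0); apply: filterS => y /= xy; apply: (f0 _ j).
have := lerB_dist (x 0 j) (x 0 j - y 0 j).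
rewrite subKr => H.
lra.
Qed.

(** The divergence theorem for one coordinate and a function supported in a box.
    By Fubini, either the coordinate of differentiation is the first one, and
    the inner integral vanishes by the fundamental theorem of calculus, or the
    slices orthogonal to the first axis satisfy the same hypotheses in one
    dimension less. *)
Lemma integral_derive_coord m (i : 'I_m) (phi : 'rV[R]_m -> R) (r : R) :
  (forall x, derivable phi x (delta_mx 0 i)) -> continuous ('D_(delta_mx 0 i) phi) ->
  (forall (x : 'rV[R]_m) (j : 'I_m), r < `|x 0 j| -> phi x = 0) ->
  (\int[lebesgue_tuple R m]_t ('D_(delta_mx 0 i) phi (tuple_row t))%:E = 0)%E.
Proof.
elim: m i phi r => [[]//|m IHm] i phi r phiD dc phi0.
set g := 'D_(delta_mx 0 i) phi in dc *.
have g0 : forall (x : 'rV[R]_m.+1) (j : 'I_m.+1), r < `|x 0 j| -> g x = 0 by exact: derive_outside.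
pose f := (EFin \o (g \o @tuple_row R m.+1)).
have mf : measurable_fun setT f.
  by apply/measurable_EFinP; exact: measurable_fun_rVT.
have fi : (@lebesgue_measure R \x lebesgue_tuple R m)%E.-integrable setT
    (f \o tuple_cons).
  have [C _ HC] := box_support_bounded dc g0.
  have -> : f \o tuple_cons = EFin \o ((g \o @tuple_row R m.+1) \o tuple_cons) by [].
  apply: (@bounded_support_integrable _ (measurableTypeR R * m.-tuple R)%type R
    (@lebesgue_measure R \x lebesgue_tuple R m)%E (`[- r, r]%classic `*` tuple_box m r)
    ((g \o @tuple_row R m.+1) \o tuple_cons) C) => //.
  - by apply: measurableX => //; exact: measurable_tuple_box.
  - rewrite /= product_measure1E //; last exact: measurable_tuple_box.
    rewrite lte_mul_pinfty //=; first by rewrite lebesgue_measure_itv /=; case: ifP.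
    exact: lebesgue_tuple_box_fin.
  - apply: measurableT_comp; first exact: measurable_fun_rVT.
    exact: measurable_tuple_cons.
  - by move=> p _ /=.
  - move=> p; rewrite -tuple_cons_box /tuple_box /= => /existsNP[j /negP]; rewrite -ltNge => pj.
    by apply: (g0 _ j); rewrite mxE.
have -> : (\int[lebesgue_tuple R m.+1]_t (g (tuple_row t))%:E =
    \int[(@lebesgue_measure R \x lebesgue_tuple R m)]_p (f (tuple_cons p)))%E.
  have := @integral_pushforward _ _ (measurableTypeR R * m.-tuple R)%type
    (m.+1.-tuple R) R tuple_cons measurable_tuple_cons
    (@lebesgue_measure R \x lebesgue_tuple R m)%E setT f mf.
  by rewrite preimage_setT => /(_ fi measurableT) <-.
case: (unliftP ord0 i) => [j ij|i0].
  rewrite -integral12_prod_meas1 //.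
  apply: integral0_eq => x _; rewrite /fubini_F /f /=.
  (* the slice orthogonal to the first axis at height x *)
  pose c (y : 'rV[R]_m) : 'rV[R]_m.+1 :=
    \row_k (if unlift ord0 k is Some l then y 0 l else x).
  have cE t : tuple_row (tuple_cons (x, t)) = c (tuple_row t).
    apply/rowP => k; rewrite !mxE; case: unliftP => [l ->|->].
      by rewrite mxE !(tnth_nth 0).
    by rewrite (tnth_nth 0).
  have cD y (h : R) : c (h *: delta_mx 0 j + y) = h *: delta_mx 0 i + c y.
    apply/rowP => k; rewrite !mxE; case: unliftP => [l ->|->]; rewrite ij ?mxE.
      by rewrite (inj_eq lift_inj).
    by rewrite (negbTE (neq_lift _ _)) mulr0n mulr0 add0r.
  have cgr y : (fun h : R => h^-1 *: (((phi \o c) \o shift y) (h *: delta_mx 0 j) - (phi \o c) y))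
      = (fun h => h^-1 *: ((phi \o shift (c y)) (h *: delta_mx 0 i) - phi (c y))).
    by apply/funext => h /=; rewrite cD.
  have dE y : 'D_(delta_mx 0 j) (phi \o c) y = g (c y).
    by rewrite /derive cgr.
  have cc : continuous c.
    move=> y A /nbhs_ballP[e e0 eA]; apply/nbhs_ballP; exists e => // z.
    rewrite -ball_normE /= => yz; apply: eA; rewrite -ball_normE /=.
    apply: le_lt_trans yz; apply: rV_norm_le => // k.
    rewrite !mxE; case: unliftP => [l _|_]; last by rewrite subrr normr0.
    by have := coord_le_norm (y - z) l; rewrite !mxE.
  under eq_integral do rewrite cE -dE.
  apply: (IHm j (phi \o c) r).
  - by move=> y; rewrite /derivable cgr; exact: phiD.
  - rewrite (_ : 'D_(delta_mx 0 j) (phi \o c) = g \o c); last exact/funext/dE.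
    by move=> y; apply: continuous_comp; [exact: cc|exact: dc].
  - move=> y l yl /=; apply: (phi0 _ (lift ord0 l)).
    by rewrite mxE liftK.
rewrite -integral21_prod_meas1 //.
apply: integral0_eq => t _; rewrite /fubini_G /f /=.
pose b := tuple_row (tuple_cons (0, t)).
(* the one-dimensional lemma wants a positive radius, at which the function
   already vanishes *)
pose r' := `|r| + 1.
have out x : r' <= `|x| -> r < `|(b + x *: delta_mx 0 ord0) 0 ord0|.
  rewrite !mxE /= (tnth_nth 0) /= add0r mulr1; apply: lt_le_trans.
  by rewrite (le_lt_trans (ler_norm r)) // ltrDl.
under eq_integral do rewrite tuple_row_cons -/b.
apply: (@integral_derive_line R (fun x => phi (b + x *: delta_mx 0 ord0))
  (fun x => g (b + x *: delta_mx 0 ord0)) r').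
- by rewrite /r' ltr_wpDl.
- move=> x; rewrite /g i0; apply: is_derive_line.
  by rewrite -i0; exact: phiD.
- move=> x; apply: (@cvg_comp _ _ _ (fun x : R => b + x *: delta_mx 0 ord0) g
    (nbhs x) (nbhs (b + x *: delta_mx 0 ord0))); last exact: dc.
  apply: cvgD; first exact: cvg_cst.
  exact: scalel_continuous.
- by move=> x /out; exact: phi0.
- by move=> x /out; exact: g0.
Qed.

End DivergenceCoordinate.

(** * Jacobian determinants are null Lagrangians *)

Section NullLagrangian.
Context {R : realType} {m : nat}.
Implicit Types (f g chi : 'rV[R]_m -> R) (x v w : 'rV[R]_m) (U V : set 'rV[R]_m).

(** Homogeneous extensions of functions on the sphere are regular only outside
    the origin. *)
Definition punctured : set 'rV[R]_m := [set x | x != 0].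

Lemma open_punctured : open punctured.
Proof.
have -> : punctured = ~` [set (0 : 'rV[R]_m)].
  by apply/seteqP; split => x /= /eqP.
by apply: closed_openC; apply: accessible_closed_set1; apply: hausdorff_accessible; exact: norm_hausdorff.
Qed.

Lemma class_C_sub r U V f : V `<=` U -> class_C r U f -> class_C r V f.
Proof.
move=> VU; elim: r f => [|r IHr] f fC; first by move=> x /VU; exact: fC.
by move=> v; have [df dfC] := fC v; split=> [x /VU|]; [exact: df|exact: IHr].
Qed.

Lemma class_CU r U V f : class_C r U f -> class_C r V f -> class_C r (U `|` V) f.
Proof.
elim: r f => [|r IHr] f fU fV; first by move=> x [/fU|/fV].
move=> v; have [dU dUC] := fU v; have [dV dVC] := fV v.
by split=> [x [/dU|/dV]|] //; exact: IHr.
Qed.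

(** This is how a product with a cutoff vanishing near the origin becomes
    regular everywhere. *)
Lemma class_C_vanish_near0 r f (rho : R) : 0 < rho ->
  (forall x, `|x| < rho -> f x = 0) -> class_C r punctured f -> class_C r setT f.
Proof.
move=> rho0 f0 fC.
have f0C : class_C r (ball 0 rho) f.
  apply: (@class_C_ext _ _ _ _ (fun=> 0)); [exact: ball_open| |exact: class_C_cst].
  by move=> x; rewrite -ball_normE /= sub0r normrN => /f0.
apply: class_C_sub (class_CU fC f0C) => x _; rewrite /punctured /=.
have [->|] := eqVneq x 0; last by left.
by right; exact: ballxx.
Qed.

Lemma class_C_derive r U f v : class_C r.+1 U f -> class_C r U ('D_v f).
Proof. by move=> /(_ v)[]. Qed.

Lemma class_C0_continuous f : class_C 0 setT f -> continuous f.
Proof. by move=> fC x; exact: fC. Qed.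

Lemma is_derive_prod (I : eqType) (s : seq I) (P : pred I)
    (F dF : I -> 'rV[R]_m -> R) x v :
  uniq s -> (forall i, P i -> is_derive x v (F i) (dF i x)) ->
  is_derive x v (fun y => \prod_(i <- s | P i) F i y)
    (\sum_(b <- s | P b) dF b x * \prod_(i <- s | P i && (i != b)) F i x).
Proof.
move=> + FD; elim: s => [_|i s IHs /= /andP[ni us]].
  have -> : (fun y => \prod_(i <- [::] | P i) F i y) = (fun=> 1).
    by apply/funext => y; rewrite big_nil.
  by rewrite big_nil; exact: is_derive_cst.
have -> : (fun y => \prod_(j <- i :: s | P j) F j y) =
    (fun y => if P i then F i y * \prod_(j <- s | P j) F j y
              else \prod_(j <- s | P j) F j y).
  by apply/funext => y; rewrite big_cons.
rewrite big_cons; have [Pi|nPi] := boolP (P i); last first.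
  apply: is_derive_eq; first exact: IHs.
  apply: eq_bigr => b Pb; rewrite [in RHS]big_cons (negbTE nPi) //.
have D1 := FD i Pi; have D2 := IHs us.
have D3 := @is_deriveM R _ (F i) (fun y => \prod_(j <- s | P j) F j y) x v _ _ D1 D2.
apply: (is_derive_eq D3).
rewrite -![_ *: _]/(_ * _) addrC; congr (_ + _).
  rewrite mulrC; congr (_ * _); rewrite big_cons eqxx andbF.
  rewrite big_seq_cond [RHS]big_seq_cond; apply: eq_bigl => j.
  by case: (eqVneq j i) => [->|]; rewrite ?(negbTE ni) ?andbT.
rewrite mulr_sumr [LHS]big_seq_cond [RHS]big_seq_cond.
apply: eq_bigr => b /andP[bs Pb]; rewrite [in RHS]big_cons.
have -> : P i && (i != b).
  by rewrite Pi; apply: contraNneq ni => ->.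
by rewrite mulrCA.
Qed.

Definition jacobian_mx (Z : 'I_m -> 'rV[R]_m -> R) x : 'M[R]_m :=
  \matrix_(j, i) 'D_(delta_mx 0 i) (Z j) x.

Local Notation e i := (delta_mx (0 : 'I_1) (i : 'I_m) : 'rV[R]_m).

(** Composing the permutation with the transposition of a and b changes the sign
    and, since second derivatives commute, nothing else. *)
Lemma minor_antisymmetry (Z : 'I_m -> 'rV[R]_m -> R) (a b : 'I_m) x :
  x != 0 -> a != b -> (forall j, class_C 2 punctured (Z j)) ->
  \sum_(s : {perm 'I_m}) (-1) ^+ s * ('D_(e (s a)) ('D_(e (s b)) (Z b)) x *
    \prod_(j | (j != a) && (j != b)) 'D_(e (s j)) (Z j) x) = 0.
Proof.
move=> x0 ab ZC; set S := LHS.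
suff : S = - S by move=> /eqP; rewrite -addr_eq0 -mulr2n mulrn_eq0 /= => /eqP.
rewrite {1}/S (reindex_inj (mulgI (tperm a b))) /S -sumrN; apply: eq_bigr => s _.
have E1 := class_C_Schwarz (e (s b)) (e (s a)) open_punctured (ZC b) x0.
have E2 : \prod_(j | (j != a) && (j != b)) 'D_(e ((tperm a b * s)%g j)) (Z j) x =
    \prod_(j | (j != a) && (j != b)) 'D_(e (s j)) (Z j) x.
  apply: eq_bigr => j /andP[ja jb].
  have aj : a != j by rewrite eq_sym; exact: ja.
  have bj : b != j by rewrite eq_sym; exact: jb.
  by rewrite permM (tpermD aj bj).
rewrite E2 odd_mul_tperm ab signrN mulNr !permM tpermL tpermR.
by move: ('D_(e (s b)) _ _) E1 => y ->.
Qed.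

Section Identity.
Variables (chi : 'rV[R]_m -> R) (Z : 'I_m -> 'rV[R]_m -> R) (a : 'I_m) (rho r : R).
Hypothesis rho0 : 0 < rho.
Hypothesis chiC : class_C 1 setT chi.
Hypothesis chi0 : forall x, `|x| < rho -> chi x = 0.
Hypothesis chir : forall (x : 'rV[R]_m) (j : 'I_m), r < `|x 0 j| -> chi x = 0.
Hypothesis ZC : forall j, class_C 2 punctured (Z j).

Let phi (s : {perm 'I_m}) x :=
  chi x * (Z a x * \prod_(j | j != a) 'D_(e (s j)) (Z j) x).

Let phiC s : class_C 1 setT (phi s).
Proof.
apply: (class_C_vanish_near0 rho0) => [x /chi0 c0|]; first by rewrite /phi c0 mul0r.
apply: class_CM; first exact: open_punctured.
  exact: class_C_sub chiC.
apply: class_CM; first exact: open_punctured.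
  by apply: class_CS; [exact: open_punctured|exact: ZC].
by apply: class_C_prod; [exact: open_punctured|move=> j _; exact: class_C_derive].
Qed.

Let grad_chi := jacobian_mx (fun j => if j == a then chi else Z j).

(** The left-hand side is the divergence of chi Z_a times the vector of
    cofactors of row a. In its expansion the terms with second derivatives of Z
    cancel, and what remains are the Leibniz expansions of two determinants. *)
Lemma null_lagrangian_pointwise x :
  \sum_(s : {perm 'I_m}) (-1) ^+ s * 'D_(e (s a)) (phi s) x =
  chi x * \det (jacobian_mx Z x) + Z a x * \det (grad_chi x).
Proof.
have [x0|xn0] := eqVneq x 0.
  have near0 : \forall y \near x, `|y| < rho.
    rewrite x0; apply/nbhs_ballP; exists rho => //= y.
    by rewrite -ball_normE /= sub0r normrN.
  have D0 f v : (forall y, `|y| < rho -> f y = 0) -> 'D_v f x = 0.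
    move=> f0; rewrite -(derive_cst (V := 'rV[R]_m) (0 : R) x v).
    by apply: near_eq_derive; apply: filterS near0 => y /f0.
  rewrite big1 => [|s _]; last first.
    by rewrite D0 ?mulr0 // => y /chi0 c0; rewrite /phi c0 mul0r.
  rewrite chi0 ?x0 ?normr0 // mul0r add0r.
  rewrite (expand_det_row _ a) big1 ?mulr0 // => j _.
  by rewrite mxE eqxx -x0 D0 ?mul0r.
pose Pr (s : {perm 'I_m}) := \prod_(j | j != a) 'D_(e (s j)) (Z j) x.
pose Q (s : {perm 'I_m}) := \sum_(b | b != a)
  'D_(e (s a)) ('D_(e (s b)) (Z b)) x *
  \prod_(j | (j != a) && (j != b)) 'D_(e (s j)) (Z j) x.
have phiD (s : {perm 'I_m}) : 'D_(e (s a)) (phi s) x =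
    'D_(e (s a)) chi x * (Z a x * Pr s) +
    chi x * ('D_(e (s a)) (Z a) x * Pr s) + (chi x * Z a x) * Q s.
  have DZ : derivable (Z a) x (e (s a)).
    by have [+ _] := ZC a (e (s a)); apply.
  have Dchi : derivable chi x (e (s a)).
    by have [+ _] := chiC (e (s a)); apply.
  have DP := @is_derive_prod _ (index_enum 'I_m) (fun j => j != a)
    (fun j => 'D_(e (s j)) (Z j))
    (fun j => 'D_(e (s a)) ('D_(e (s j)) (Z j))) x (e (s a)) (index_enum_uniq _) _.
  have {}DP := DP _.
  have [|DP1 DP2] := DP.
    move=> j _; apply: derivableP.
    by have [_ /(_ (e (s a)))[+ _]] := ZC j (e (s j)); apply.
  have DZP := @derivableM _ _ (Z a) _ x _ DZ DP1.
  rewrite /phi (deriveM Dchi DZP) (deriveM DZ DP1) DP2 -/(Q s) -![_ *: _]/(_ * _).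
  rewrite -[(Z a * _) x]/(Z a x * Pr s) -/(Pr s); ring.
have ZPr (f : 'I_m -> 'rV[R]_m -> R) (s : {perm 'I_m}) : (forall j, j != a -> f j = Z j) ->
    \prod_j jacobian_mx f x j (s j) = 'D_(e (s a)) (f a) x * Pr s.
  move=> fZ; rewrite (bigD1 a) //= mxE; congr (_ * _).
  by apply: eq_bigr => j ja; rewrite mxE fZ.
under eq_bigr do rewrite phiD !mulrDr.
rewrite !big_split /= addrAC addrC.
have Q0 : \sum_(s : {perm 'I_m}) (-1) ^+ s * (chi x * Z a x * Q s) = 0.
  under eq_bigr do rewrite mulrCA /Q mulr_sumr.
  rewrite -mulr_sumr exchange_big /= big1 ?mulr0 // => b ba.
  by apply: minor_antisymmetry => //; rewrite eq_sym.
rewrite Q0 addr0; congr (_ + _).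
  rewrite /determinant mulr_sumr; apply: eq_bigr => s _.
  by rewrite (ZPr Z) // mulrCA.
rewrite /determinant mulr_sumr; apply: eq_bigr => s _.
rewrite (ZPr (fun j => if j == a then chi else Z j)) ?eqxx; last by move=> j /negbTE ->.
rewrite [in RHS]mulrCA; congr (_ * _); exact: mulrCA.
Qed.

(** The integral of a compactly supported divergence vanishes. This expresses
    the integral of a Jacobian determinant through the values of Z_a instead of
    its derivatives. *)
Lemma null_lagrangian :
  \int[lebesgue_tuple R m]_t (chi (tuple_row t) * \det (jacobian_mx Z (tuple_row t)) +
     Z a (tuple_row t) * \det (grad_chi (tuple_row t))) = 0.
Proof.
under eq_Rintegral do rewrite -null_lagrangian_pointwise.
have phi0 (s : {perm 'I_m}) (x : 'rV[R]_m) (j : 'I_m) : r < `|x 0 j| -> phi s x = 0.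
  by move=> xj; rewrite /phi (chir xj) mul0r.
have dphi0 (s : {perm 'I_m}) : forall (x : 'rV[R]_m) (j : 'I_m), r < `|x 0 j| ->
    (-1) ^+ s * 'D_(e (s a)) (phi s) x = 0.
  move=> x j xj; rewrite (derive_outside _ (phi0 s) xj) mulr0 //.
have dphic (s : {perm 'I_m}) : continuous (fun x => (-1) ^+ s * 'D_(e (s a)) (phi s) x).
  move=> x; apply: (@continuousM R _ (fun=> (-1) ^+ s) ('D_(e (s a)) (phi s))).
    exact: cst_continuous.
  by have [_ +] := phiC s (e (s a)); apply.
rewrite /Rintegral; under eq_integral do rewrite -sumEFin.
rewrite integral_sum //; last first.
  by move=> s; exact: rV_support_integrable (dphic s) (dphi0 s).
rewrite big1 // => s _.
under eq_integral do rewrite EFinM.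
rewrite integralZl //; last first.
  apply: (@rV_support_integrable _ _ ('D_(e (s a)) (phi s)) r).
    by move=> x; have [_ +] := phiC s (e (s a)); apply.
  exact: derive_outside (phi0 s).
rewrite (@integral_derive_coord _ _ _ _ r) ?mule0 //.
- by move=> x; have [+ _] := phiC s (e (s a)); apply.
- by move=> x; have [_ +] := phiC s (e (s a)); apply.
- exact: phi0.
Qed.

End Identity.
End NullLagrangian.

(** * The Euclidean norm and the squared positive part *)

Section Euclid.
Context {R : realType} {m : nat}.
Implicit Types (x v w : 'rV[R]_m).

Lemma dotp_ge0 v : 0 <= dotp v v.
Proof. by apply: sumr_ge0 => i _; rewrite -expr2 sqr_ge0. Qed.

Lemma enorm_sqr v : enorm v ^+ 2 = dotp v v.
Proof. by rewrite sqr_sqrtr // dotp_ge0. Qed.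

Lemma enorm_ge0 v : 0 <= enorm v.
Proof. exact: sqrtr_ge0. Qed.

Lemma coord_le_enorm v i : `|v 0 i| <= enorm v.
Proof.
rewrite -(ler_pXn2r (n := 2)) // ?nnegrE ?enorm_ge0 // enorm_sqr real_normK ?num_real //.
rewrite /dotp (bigD1 i) //= -expr2 lerDl.
by apply: sumr_ge0 => j _; rewrite -expr2 sqr_ge0.
Qed.

Lemma enorm_eq0 v : (enorm v == 0) = (v == 0).
Proof.
apply/eqP/eqP => [v0|->].
  apply/rowP => i; apply/eqP; rewrite mxE -normr_le0 -v0; exact: coord_le_enorm.
by rewrite /enorm /dotp big1 ?sqrtr0 // => i _; rewrite mxE mul0r.
Qed.

Lemma enorm_gt0 v : (0 < enorm v) = (v != 0).
Proof. by rewrite lt_def enorm_eq0 enorm_ge0 andbT. Qed.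

Lemma enormZ (c : R) v : enorm (c *: v) = `|c| * enorm v.
Proof.
rewrite /enorm -sqrtr_sqr -sqrtrM ?sqr_ge0 //; congr Num.sqrt.
by rewrite /dotp mulr_sumr; apply: eq_bigr => i _; rewrite !mxE mulrACA expr2.
Qed.

Lemma class_C_dotp r (U : set 'rV[R]_m) : open U -> class_C r U (fun y => dotp y y).
Proof.
move=> oU; apply: class_C_sum => // i _; apply: class_CM => //; exact: class_C_coord.
Qed.

Lemma dotp_continuous : continuous (fun y : 'rV[R]_m => dotp y y).
Proof. by move=> x; apply: (@class_C_dotp 0 setT); first exact: openT. Qed.

Lemma unit_ballE : unit_ball = [set x : 'rV[R]_m | dotp x x < 1].
Proof.
by apply/seteqP; split=> x /=; rewrite -enorm_sqr -[X in _ < X](expr1n _ 2);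
  rewrite ltr_pXn2r ?nnegrE ?enorm_ge0.
Qed.

Lemma open_unit_ball : open (unit_ball : set 'rV[R]_m).
Proof.
rewrite unit_ballE openE => x /= x1; rewrite /interior.
by have /cvgr_lt/(_ _ x1) := @dotp_continuous x.
Qed.

End Euclid.

Section SquaredPositivePart.
Context {R : realType}.

Lemma is_derive_sqr_pos (y : R) :
  is_derive y (1 : R) (fun z => Num.max 0 z ^+ 2) (2 * Num.max 0 y).
Proof.
have key : (fun h : R => h^-1 *: (((fun z : R => Num.max 0 z ^+ 2) \o shift y) (h *: (1 : R))
    - Num.max 0 y ^+ 2)) @ 0^' --> 2 * Num.max 0 y.
  apply/cvgrPdist_le => e e0; near=> h.
  have h0 : h != 0 by near: h; exact: nbhs_dnbhs_neq.
  have he : `|h| <= e by near: h; exact: dnbhs0_le.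
  apply: le_trans he.
  rewrite /= -[h *: 1]/(h * 1) mulr1 -[_ *: _]/(_ * _).
  rewrite -(@ler_pM2l _ `|h|) ?normr_gt0 // -normrM mulrBr.
  rewrite [h * (h^-1 * _)]mulrA mulfV // mul1r -[`|h| * `|h|]expr2 real_normK ?num_real //.
  (* the increment of the squared positive part differs from 2 h max (0, y) by
     at most h^2 *)
  by rewrite ler_norml; case: (ltrP 0 y) => y0; case: (ltrP 0 (h + y)) => hy; apply/andP; split; nra.
by split; [apply/cvg_ex; exists (2 * Num.max 0 y)|exact: cvg_lim].
Unshelve. all: by end_near. Qed.

Lemma continuous_pos : continuous (fun y : R => 2 * Num.max 0 y).
Proof.
move=> y; apply: (@cvgM R R (nbhs y) _ (fun=> 2) (fun y => Num.max 0 y)).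
  exact: cvg_cst.
by apply: (@continuous_max R R (fun=> 0) id); [exact: cst_continuous|exact: cvg_id].
Qed.

End SquaredPositivePart.

(** * Integrals over the punctured unit ball *)

Section BallIntegral.
Context {R : realType} {m : nat}.
Local Notation V := ('rV[R]_m.+1).
Local Notation mu := (lebesgue_tuple R m.+1).
Implicit Types (f g : V -> R) (x : V).

Let oP := @open_punctured R m.+1.

Definition punctured_ball : set (m.+1.-tuple R) :=
  [set t | (punctured `&` unit_ball) (tuple_row t)].

(** The integrands are homogeneous extensions, irregular at the origin; as the
    origin is negligible, it is removed from the ball. *)
Definition ball_integral f : R := \int[mu]_(t in punctured_ball) f (tuple_row t).

Definition ball_volume : R := fine (mu punctured_ball).

Lemma measurable_punctured_ball : measurable punctured_ball.
Proof.
by apply: measurable_open_rV; apply: openI; [exact: open_punctured|exact: open_unit_ball].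
Qed.

Lemma punctured_ball_fin : (mu punctured_ball < +oo)%E.
Proof.
apply: le_lt_trans (lebesgue_tuple_box_fin m.+1 1).
apply: le_measure; rewrite ?inE.
- exact: measurable_punctured_ball.
- exact: measurable_tuple_box.
- move=> t [_ /= t1] i.
  by have := coord_le_enorm (tuple_row t) i; rewrite mxE => /le_trans; apply; exact: ltW.
Qed.

Lemma measurable_fun_ball f : class_C 0 punctured f ->
  measurable_fun punctured_ball (f \o tuple_row).
Proof.
move=> fc; apply: measurable_fun_rV.
  by apply: openI; [exact: open_punctured|exact: open_unit_ball].
by move=> x [x0 _]; exact: fc.
Qed.

(** A convenient algebra of integrable functions on the punctured ball. *)
Definition tame f := class_C 0 punctured f /\
  exists C, forall x, x != 0 -> `|f x| <= C.

Lemma tame_integrable f : tame f ->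
  mu.-integrable punctured_ball (EFin \o (f \o tuple_row)).
Proof.
move=> [fc [C fC]]; apply: measurable_bounded_integrable.
- exact: measurable_punctured_ball.
- exact: punctured_ball_fin.
- exact: measurable_fun_ball.
- exists C; split; first exact: num_real.
  by move=> M CM t [t0 _] /=; apply: le_trans (fC _ t0) (ltW CM).
Qed.

Lemma tame_cst (c : R) : tame (fun=> c).
Proof. by split; [exact: class_C_cst|exists `|c|]. Qed.

Lemma tame_add f g : tame f -> tame g -> tame (fun x => f x + g x).
Proof.
move=> [fc [C fC]] [gc [D gD]]; split; first exact: (class_CD oP fc gc).
by exists (C + D) => x x0; apply: le_trans (ler_normD _ _) _; rewrite lerD ?fC ?gD.
Qed.

Lemma tame_mul f g : tame f -> tame g -> tame (fun x => f x * g x).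
Proof.
move=> [fc [C fC]] [gc [D gD]]; split; first exact: (class_CM oP fc gc).
by exists (C * D) => x x0; rewrite normrM ler_pM ?fC ?gD.
Qed.

Lemma tame_sub f g : tame f -> tame g -> tame (fun x => f x - g x).
Proof.
move=> [fc [C fC]] [gc [D gD]]; split; first exact: (class_CB oP fc gc).
by exists (C + D) => x x0; apply: le_trans (ler_normB _ _) _; rewrite lerD ?fC ?gD.
Qed.

Lemma tame_sum (I : Type) (s : seq I) (F : I -> V -> R) :
  (forall i, tame (F i)) -> tame (fun x => \sum_(i <- s) F i x).
Proof.
move=> Ft; elim: s => [|i s IHs].
  have -> : (fun x => \sum_(i <- [::]) F i x) = (fun=> 0).
    by apply/funext => y; rewrite big_nil.
  exact: tame_cst.
have -> : (fun x => \sum_(j <- i :: s) F j x) = (fun x => F i x + \sum_(j <- s) F j x).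
  by apply/funext => y; rewrite big_cons.
exact: tame_add.
Qed.

Lemma ball_volume_ge0 : 0 <= ball_volume.
Proof. exact: fine_ge0. Qed.

Lemma ball_integral_cst (c : R) : ball_integral (fun=> c) = c * ball_volume.
Proof. by rewrite /ball_integral Rintegral_cst //; exact: measurable_punctured_ball. Qed.

Lemma ball_integral_le f g : tame f -> tame g ->
  (forall x, x != 0 -> f x <= g x) -> ball_integral f <= ball_integral g.
Proof.
move=> ft gt fg; apply: le_Rintegral.
- exact: measurable_punctured_ball.
- exact: tame_integrable.
- exact: tame_integrable.
- by move=> t [t0 _]; exact: fg.
Qed.

Lemma ball_integralD f g : tame f -> tame g ->
  ball_integral (fun x => f x + g x) = ball_integral f + ball_integral g.
Proof.
move=> ft gt; apply: RintegralD; first exact: measurable_punctured_ball.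
  exact: tame_integrable.
exact: tame_integrable.
Qed.

Lemma ball_integralB f g : tame f -> tame g ->
  ball_integral (fun x => f x - g x) = ball_integral f - ball_integral g.
Proof.
move=> ft gt; apply: RintegralB; first exact: measurable_punctured_ball.
  exact: tame_integrable.
exact: tame_integrable.
Qed.

Lemma ball_integralZ f (c : R) : tame f ->
  ball_integral (fun x => c * f x) = c * ball_integral f.
Proof.
move=> ft; apply: RintegralZl; first exact: measurable_punctured_ball.
exact: tame_integrable.
Qed.

Lemma ball_integral_sum (I : finType) (F : I -> V -> R) :
  (forall i, tame (F i)) ->
  ball_integral (fun x => \sum_i F i x) = \sum_i ball_integral (F i).
Proof.
move=> Ft; rewrite /ball_integral /Rintegral.
under eq_integral do rewrite -sumEFin.
have Fi i := tame_integrable (Ft i).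
rewrite (integral_sum measurable_punctured_ball Fi).
apply/esym/sum_fine => i _.
exact: (integrable_fin_num measurable_punctured_ball (Fi i)).
Qed.

Lemma ball_integral_norm_le f g : tame f -> tame g ->
  (forall x, x != 0 -> `|f x| <= g x) -> `|ball_integral f| <= ball_integral g.
Proof.
move=> ft gt fg; rewrite ler_norml; apply/andP; split.
  rewrite -mulN1r -(ball_integralZ _ gt).
  apply: ball_integral_le => // [|x x0].
    exact: (tame_mul (tame_cst _) gt).
  rewrite mulN1r lerNl; apply: le_trans (fg x x0).
  by rewrite -normrN ler_norm.
apply: ball_integral_le => // x x0.
by apply: le_trans (fg x x0); exact: ler_norm.
Qed.

Lemma eq_ball_integral f g : (forall x, x != 0 -> f x = g x) ->
  ball_integral f = ball_integral g.
Proof.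
by move=> fg; apply: eq_Rintegral => t; rewrite inE => -[t0 _]; exact: fg.
Qed.

Lemma tuple_row_nseq0 : tuple_row (nseq_tuple m.+1 (0 : R)) = 0.
Proof. by apply/rowP => i; rewrite !mxE (tnth_nth 0) nth_nseq; case: ifP. Qed.

Lemma space_integral_ball f : tame f ->
  space_integral unit_ball f = ball_integral f.
Proof.
move=> [fc [C fC]]; rewrite /space_integral /ball_integral.
pose t0 : m.+1.-tuple R := nseq_tuple m.+1 (0 : R).
pose D := [set t : m.+1.-tuple R | unit_ball (tuple_row t)].
have mD : measurable D by apply: measurable_open_rV; exact: open_unit_ball.
have mP := measurable_punctured_ball.
have row_inj t : tuple_row t = 0 -> t = t0.
  move=> /rowP t00; apply: eq_from_tnth => i.
  by have := t00 i; rewrite !mxE => ->; rewrite (tnth_nth 0) nth_nseq; case: ifP.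
have PE : D `\` [set t0] = punctured_ball.
  apply/seteqP; split=> t [a b]; split => //=.
    by apply/eqP => /row_inj.
  by move=> t00; move: a; rewrite /punctured /= t00 tuple_row_nseq0 eqxx.
have m0 : measurable [set t0].
  have -> : [set t0] = D `\` punctured_ball.
    rewrite -PE setDD; apply/seteqP; split=> t /=; last by case.
    move=> ->; split => //; rewrite /D /unit_ball /= tuple_row_nseq0.
    have /eqP -> : enorm (0 : V) == 0 by rewrite enorm_eq0.
    exact: ltr01.
  exact: measurableD.
have DE : D = punctured_ball `|` [set t0].
  rewrite -PE setUC; apply/esym/setDUK => t /= ->.
  rewrite /D /unit_ball /= tuple_row_nseq0.
  by have /eqP -> : enorm (0 : V) == 0 by rewrite enorm_eq0.
have mf : measurable_fun D (f \o tuple_row).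
  rewrite DE; apply/measurable_funU => //; split; first exact: measurable_fun_ball.
  exact: measurable_fun_set1.
rewrite /Rintegral -PE (@negligible_integral _ _ _ mu D [set t0]) //.
  apply: (@measurable_bounded_integrable _ _ _ mu (f \o tuple_row) D) => //.
    rewrite DE; apply: le_lt_trans (measureU2 _ _ _) _ => //.
    rewrite [X in (_ + X)%E]lebesgue_tuple_point adde0; exact: punctured_ball_fin.
  exists (Num.max C `|f 0|); split; first exact: num_real.
  move=> M; rewrite gt_max => /andP[CM fM] t _ /=.
  have [->|tn0] := eqVneq (tuple_row t) 0; first exact: ltW.
  by apply: le_trans (fC _ tn0) (ltW CM).
exact: lebesgue_tuple_point.
Qed.

End BallIntegral.

(** * A cutoff exhausting the punctured ball *)

Section Cutoff.
Context {R : realType} {m : nat}.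
Local Notation V := ('rV[R]_m.+1).
Local Notation mu := (lebesgue_tuple R m.+1).
Implicit Types (x : V).

Let a_ (k : nat) : R := k.+1%:R^-1.
(** w_ k is 1 near the origin and outside the unit ball, and tends to 0
    elsewhere: the squared positive part is supported in the shell a_ k <= |x|^2
    <= 1. It is of class C^1 like the squared positive part. *)
Let w_ (k : nat) (x : V) : R :=
  (1 + k%:R * Num.max 0 ((dotp x x - a_ k) * (1 - dotp x x)) ^+ 2)^-1.

Let den_ge1 k x : 1 <= 1 + k%:R * Num.max 0 ((dotp x x - a_ k) * (1 - dotp x x)) ^+ 2.
Proof. by rewrite lerDl mulr_ge0 // sqr_ge0. Qed.

Let wC k : class_C 1 setT (w_ k).
Proof.
have oT := @openT V.
apply: class_CV => //.
  by move=> x _; rewrite gt_eqF // (lt_le_trans _ (den_ge1 k x)).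
apply: class_CD => //; first exact: class_C_cst.
apply: class_CM => //; first exact: class_C_cst.
apply: (@class_C1_outer _ _ _ (fun z => Num.max 0 z ^+ 2) (fun z => 2 * Num.max 0 z)) => //.
- exact: is_derive_sqr_pos.
- exact: continuous_pos.
apply: class_CM => //; apply: class_CB => //; try exact: class_C_dotp; exact: class_C_cst.
Qed.

Let w_bounds k x : 0 <= w_ k x <= 1.
Proof.
have d1 := den_ge1 k x; have d0 := lt_le_trans ltr01 d1.
by rewrite invr_ge0 (ltW d0) /= invf_le1.
Qed.

Let w_cvg0 x : x != 0 -> enorm x < 1 -> w_ k x @[k --> \oo] --> (0 : R).
Proof.
move=> x0 x1; set q := dotp x x.
have q0 : 0 < q by rewrite /q -enorm_sqr exprn_gt0 // enorm_gt0.
have q1 : q < 1.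
  by rewrite /q -enorm_sqr expr_lt1 ?enorm_ge0.
pose c := (q / 2) * (1 - q).
have c0 : 0 < c by rewrite mulr_gt0 ?divr_gt0 ?subr_gt0.
apply/cvgrPdist_le => e e0.
have near_a : \forall k \near \oo, a_ k < q / 2.
  by apply: near_infty_natSinv_lt (PosNum (divr_gt0 q0 (ltr0n _ 2))).
near=> k.
have ak : a_ k < q / 2 by near: k.
have kc : (e * c ^+ 2)^-1 <= k%:R by near: k; exact: nbhs_infty_ger.
rewrite sub0r normrN ger0_norm; last by have /andP[] := w_bounds k x.
rewrite /w_ -/q; set p := (q - a_ k) * (1 - q).
have cp : c <= p.
  rewrite /c /p ler_pM2r ?subr_gt0 //; lra.
have p0 := lt_le_trans c0 cp.
rewrite (max_idPr (ltW p0)) -[e]invrK lef_pV2 ?posrE ?invr_gt0 //; last first.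
  by rewrite ltr_pwDl // mulr_ge0 // sqr_ge0.
have ec : 0 < e * c ^+ 2 by rewrite mulr_gt0 // exprn_gt0.
have k0 : 0 < (k%:R : R) by apply: lt_le_trans kc; rewrite invr_gt0.
apply: (@le_trans _ _ (k%:R * c ^+ 2)).
  by rewrite -ler_pdivrMr ?exprn_gt0 // -invfM mulrC mulrC.
rewrite (@le_trans _ _ (k%:R * p ^+ 2)) ?lerDr //.
by rewrite ler_pM2l // ler_pXn2r // nnegrE ltW.
Unshelve. all: by end_near. Qed.

(** The functions 1 - w_ k tend to 1 in the punctured ball, so by dominated
    convergence one of them has the required integral. *)
Lemma cutoff_exists (delta : R) : 0 < delta ->
  exists chi : V -> R, exists rho : R,
  [/\ 0 < rho, class_C 1 setT chi, (forall x, `|x| < rho -> chi x = 0),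
      (forall x (j : 'I_m.+1), 1 < `|x 0 j| -> chi x = 0) &
      (forall x, 0 <= chi x <= 1) /\ (forall x, 1 <= enorm x -> chi x = 0) /\
      ball_integral (fun x => 1 - chi x) < delta].
Proof.
move=> delta0.
have cvg_int : (\int[mu]_(t in punctured_ball) (w_ k (tuple_row t))%:E)%E
    @[k --> \oo] --> (\int[mu]_(t in punctured_ball) (0 : \bar R))%E.
  apply: (@dominated_cvg _ _ _ mu punctured_ball measurable_punctured_ball
    (fun k t => (w_ k (tuple_row t))%:E) _ (fun=> 1%E)) => //.
  - move=> k; apply/measurable_EFinP; apply: measurable_fun_ball.
    apply: class_CS; first exact: open_punctured.
    exact: class_C_sub (wC k).
  - move=> t [t0 t1]; apply/cvg_EFin; first by near=> k.
    exact: w_cvg0.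
  - exact: (tame_integrable (tame_cst 1)).
  - move=> k t _; have /andP[w0 w1] := w_bounds k (tuple_row t).
    by rewrite lee_fin ger0_norm.
rewrite integral0 in cvg_int.
have [k kd] : exists k, (\int[mu]_(t in punctured_ball) (w_ k (tuple_row t))%:E < delta%:E)%E.
  have [|k _ /(_ k (leqnn k))] := cvg_int [set x | (x < delta%:E)%E].
    apply: open_nbhs_nbhs; split; first exact: open_ereal_lt_ereal.
    by rewrite /= lte_fin.
  by move=> ?; exists k.
have near0 : exists2 rho, 0 < rho & forall x, `|x| < rho -> dotp x x < a_ k.
  have ak0 : dotp (0 : V) 0 < a_ k.
    by rewrite -enorm_sqr (eqP (_ : enorm 0 == 0)) ?enorm_eq0 // expr0n invr_gt0.
  have /cvgr_lt/(_ _ ak0)/nbhs_ballP[rho /= rho0 H] := @dotp_continuous R m.+1 0.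
  exists rho => // x xr; apply: H.
  by rewrite -ball_normE /= sub0r normrN.
have [rho rho0 rhoP] := near0.
have far x : 1 <= enorm x -> 1 - w_ k x = 0.
  move=> x1; rewrite /w_ (max_idPl _) ?expr0n ?mulr0 ?addr0 ?invr1 ?subrr //.
  have q1 : 1 <= dotp x x by rewrite -enorm_sqr expr_ge1 ?enorm_ge0.
  have a1 : a_ k <= 1 by rewrite invf_le1 // ler1n.
  by rewrite mulr_ge0_le0 ?subr_le0 ?subr_ge0 // (le_trans a1).
exists (fun x => 1 - w_ k x), rho; split => //.
- apply: class_CB; [exact: openT|exact: class_C_cst|exact: wC].
- move=> x /rhoP qa; rewrite /w_ (max_idPl _) ?expr0n ?mulr0 ?addr0 ?invr1 ?subrr //.
  have a1 : a_ k <= 1 by rewrite invf_le1 // ler1n.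
  by rewrite mulr_le0_ge0 ?subr_le0 ?subr_ge0 ?ltW // (lt_le_trans qa).
- move=> x j xj; apply: far; apply: ltW; exact: lt_le_trans xj (coord_le_enorm x j).
split; first by move=> x; have := w_bounds k x; lra.
split; first exact: far.
rewrite (eq_ball_integral (g := w_ k)); last by move=> x _; rewrite subKr.
rewrite /ball_integral /Rintegral -lte_fin fineK //.
rewrite ge0_fin_numE; first exact: lt_trans kd (ltry _).
by apply: integral_ge0 => t _; rewrite lee_fin; have /andP[] := w_bounds k (tuple_row t).
Unshelve. all: by end_near. Qed.

End Cutoff.

(** * Weak continuity of Jacobian determinants *)

Lemma class_C_det {R : realType} {m p : nat} r (U : set 'rV[R]_m)
    (M : 'rV[R]_m -> 'M[R]_p) : open U ->
  (forall i j, class_C r U (fun x => M x i j)) -> class_C r U (fun x => \det (M x)).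
Proof.
move=> oU MC; apply: class_C_sum => // s _; apply: class_CM => //.
  exact: class_C_cst.
by apply: class_C_prod.
Qed.

Section WeakContinuity.
Context {R : realType} {m : nat}.
Local Notation V := ('rV[R]_m.+1).
Local Notation mu := (lebesgue_tuple R m.+1).
Local Notation e_ i := (delta_mx (0 : 'I_1) (i : 'I_m.+1) : V).
Implicit Types (f g : V -> R) (x : V).

Definition space_int f : R := \int[mu]_t f (tuple_row t).

Definition box_volume : R := fine (mu (tuple_box m.+1 1)).

Lemma ball_space_int f : (forall x, ~ (punctured `&` unit_ball) x -> f x = 0) ->
  ball_integral f = space_int f.
Proof.
move=> f0; rewrite /ball_integral Rintegral_mkcond; apply: eq_Rintegral => t _.
by rewrite patchE; case: ifPn => //; rewrite notin_setE => /f0 ->.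
Qed.

Lemma space_int_integrable f : continuous f ->
  (forall x (j : 'I_m.+1), 1 < `|x 0 j| -> f x = 0) ->
  mu.-integrable setT (EFin \o (f \o tuple_row)).
Proof. exact: rV_support_integrable. Qed.

Lemma space_int_le f (B : R) : continuous f ->
  (forall x (j : 'I_m.+1), 1 < `|x 0 j| -> f x = 0) ->
  (forall x, `|f x| <= B) -> `|space_int f| <= B * box_volume.
Proof.
move=> fc f0 fB; have mB := @measurable_tuple_box R m.+1 1.
have -> : space_int f = \int[mu]_(t in tuple_box m.+1 1) f (tuple_row t).
  rewrite [RHS]Rintegral_mkcond; apply: eq_Rintegral => t _; rewrite patchE.
  case: ifPn => //; rewrite notin_setE /tuple_box /= => /existsNP[i /negP].
  by rewrite -ltNge => ti; apply: (f0 _ i); rewrite mxE.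
have fi : mu.-integrable (tuple_box m.+1 1) (EFin \o (f \o tuple_row)).
  by apply: integrableS (space_int_integrable fc f0).
apply: le_trans (le_normr_Rintegral mB fi) _.
rewrite -(Rintegral_cst mu mB); apply: le_Rintegral => //.
- exact: (@integrable_norm _ _ _ mu _ (f \o tuple_row)).
- apply: measurable_bounded_integrable => //.
    exact: lebesgue_tuple_box_fin.
  exists `|B|; split; first exact: num_real.
  by move=> M BM t _ /=; exact: ltW.
- by move=> t _; exact: fB.
Qed.

Lemma space_int_sum (I : finType) (F : I -> V -> R) :
  (forall i, continuous (F i)) ->
  (forall i x (j : 'I_m.+1), 1 < `|x 0 j| -> F i x = 0) ->
  space_int (fun x => \sum_i F i x) = \sum_i space_int (F i).
Proof.
move=> Fc F0; rewrite /space_int /Rintegral.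
under eq_integral do rewrite -sumEFin.
have Fi i := space_int_integrable (Fc i) (F0 i).
rewrite integral_sum //.
by apply/esym/sum_fine => i _; apply: integrable_fin_num => //; exact: Fi.
Qed.

Variables (chi : V -> R) (rho Kchi : R).
Hypothesis rho0 : 0 < rho.
Hypothesis chiC : class_C 1 setT chi.
Hypothesis chi_near : forall x, `|x| < rho -> chi x = 0.
Hypothesis chi_box : forall x (j : 'I_m.+1), 1 < `|x 0 j| -> chi x = 0.
Hypothesis chi_ball : forall x, 1 <= enorm x -> chi x = 0.
Hypothesis chi_grad : forall x i, `|'D_(e_ i) chi x| <= Kchi.

Let chi_at0 : chi 0 = 0.
Proof. by apply: chi_near; rewrite normr0. Qed.

Lemma jacobian_mx_class_C r (Z : 'I_m.+1 -> V -> R) i j :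
  class_C r.+1 punctured (Z j) -> class_C r punctured (fun x => jacobian_mx Z x j i).
Proof.
move=> ZC; rewrite (_ : (fun _ => _) = 'D_(e_ i) (Z j)); last first.
  by apply/funext => x; rewrite mxE.
exact: class_C_derive.
Qed.

(** By [null_lagrangian], Z_a enters the integral only through its values, which
    are at most e, while the row of its derivatives is replaced by the gradient
    of chi. *)
Lemma null_lagrangian_le (Z : 'I_m.+1 -> V -> R) (a : 'I_m.+1) (K e : R) :
  0 <= e -> 0 <= K -> (forall j, class_C 2 punctured (Z j)) ->
  (forall x, x != 0 -> forall j i, j != a -> `|jacobian_mx Z x j i| <= K) ->
  (forall x, x != 0 -> (forall l, `|x 0 l| <= 1) -> `|Z a x| <= e) ->
  `|space_int (fun x => chi x * \det (jacobian_mx Z x))| <=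
    e * (m.+1`!%:R * (Kchi * K ^+ m)) * box_volume.
Proof.
move=> e0 K0 ZC ZK Ze; have Kchi0 : 0 <= Kchi by apply: le_trans (chi_grad 0 a).
have oP := @open_punctured R m.+1.
set G := jacobian_mx (fun j => if j == a then chi else Z j).
have chiP : class_C 1 punctured chi by exact: class_C_sub chiC.
have G0 (H : V -> Prop) x : open H -> H x -> (forall y, H y -> chi y = 0) -> \det (G x) = 0.
  move=> oH Hx chi0; rewrite (expand_det_row _ a) big1 // => j _.
  rewrite mxE eqxx -(derive_cst (V := V) (0 : R) x (e_ j)).
  rewrite (@near_eq_derive _ _ _ _ (cst 0)) ?derive_cst ?mul0r //.
  by apply: filterS (open_nbhs_nbhs (conj oH Hx)) => y /chi0.
have G_near x : `|x| < rho -> \det (G x) = 0.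
  move=> xr; apply: (G0 (ball 0 rho)).
  - exact: ball_open.
  - by rewrite -ball_normE /= sub0r normrN.
  - by move=> y; rewrite -ball_normE /= sub0r normrN => /chi_near.
have G_box x (j : 'I_m.+1) : 1 < `|x 0 j| -> \det (G x) = 0.
  move=> xj; rewrite (expand_det_row _ a) big1 // => k _.
  by rewrite mxE eqxx (derive_outside _ chi_box xj) mul0r.
have f1c : continuous (fun x => chi x * \det (jacobian_mx Z x)).
  apply: class_C0_continuous; apply: (class_C_vanish_near0 rho0).
    by move=> x /chi_near ->; rewrite mul0r.
  apply: class_CM => //; first exact: class_CS chiP.
  apply: class_C_det => // i j.
  by apply: jacobian_mx_class_C; exact: (class_CS oP (ZC _)).
have f2c : continuous (fun x => Z a x * \det (G x)).
  apply: class_C0_continuous; apply: (class_C_vanish_near0 rho0).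
    by move=> x /G_near ->; rewrite mulr0.
  apply: class_CM => //; first exact: (class_C_le oP (leq0n 2) (ZC a)).
  apply: class_C_det => // i j; apply: jacobian_mx_class_C.
  case: eqP => _; [exact: chiP|exact: (class_CS oP (ZC _))].
have f10 x (j : 'I_m.+1) : 1 < `|x 0 j| -> chi x * \det (jacobian_mx Z x) = 0.
  by move=> /chi_box ->; rewrite mul0r.
have f20 x (j : 'I_m.+1) : 1 < `|x 0 j| -> Z a x * \det (G x) = 0.
  by move=> /G_box ->; rewrite mulr0.
have := null_lagrangian a rho0 chiC chi_near chi_box ZC.
rewrite -/G RintegralD //; last 2 first.
- exact: (space_int_integrable f1c f10).
- exact: (space_int_integrable f2c f20).
move=> /eqP; rewrite addr_eq0 => /eqP E; rewrite /space_int E.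
rewrite normrN; apply: (space_int_le f2c f20) => x.
have bnd0 : 0 <= e * (m.+1`!%:R * (Kchi * K ^+ m)).
  by rewrite !mulr_ge0 // exprn_ge0.
have [->|x0] := eqVneq x 0; first by rewrite (G_near 0) ?normr0 // mulr0 normr0.
have [xl|/existsNP[l /negP]] := pselect (forall l, `|x 0 l| <= 1); last first.
  by rewrite -ltNge => /f20 ->; rewrite normr0.
rewrite normrM; apply: ler_pM => //; first exact: Ze.
apply: (det_row_le (a := a)) => [i j ia|j]; last by rewrite mxE eqxx.
by rewrite mxE (negbTE ia); have := ZK x x0 i j ia; rewrite mxE.
Qed.

Lemma derive_coordZ (c : R) (j i : 'I_m.+1) x :
  is_derive x (e_ i) (fun y => c * y 0 j) (c * (j == i)%:R).
Proof.
have D := is_derive_coord x (e_ i) j; rewrite mxE eqxx /= in D.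
have := @is_deriveM R V (fun _ : V => c) (fun y : V => y 0 j) x (e_ i) _ _ (is_derive_cst c x (e_ i)) D.
move=> H; apply: is_derive_eq H _.
by rewrite scaler0 addr0.
Qed.

(** The telescoping of det (DP) - det (c I) row by row consists of Jacobian
    determinants of maps Z a that have the components of P before a, those of c
    y after a, and P_a - c y_a, uniformly small, in position a. *)
Lemma det_weak_continuity (P : 'I_m.+1 -> V -> R) (c K e : R) :
  0 <= e -> 0 <= c -> (forall j, class_C 2 punctured (P j)) ->
  (forall x, x != 0 -> forall j i, `|jacobian_mx P x j i| <= K) ->
  (forall x, x != 0 -> (forall l, `|x 0 l| <= 1) ->
     forall j, `|P j x - c * x 0 j| <= e) ->
  `|ball_integral (fun x => chi x * (\det (jacobian_mx P x) - c ^+ m.+1))| <=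
    m.+1%:R * (e * (m.+1`!%:R * (Kchi * (Num.max K c) ^+ m)) * box_volume).
Proof.
move=> e0 c0 PC PK Pe; have oP := @open_punctured R m.+1.
pose Z (a j : 'I_m.+1) (x : V) : R :=
  if (j < a)%N then P j x else if j == a then P j x - c * x 0 j else c * x 0 j.
have linC r j : class_C r punctured (fun x : V => c * x 0 j).
  by apply: class_CM => //; [exact: class_C_cst|exact: class_C_coord].
have ZC a j : class_C 2 punctured (Z a j).
  rewrite /Z; case: (j < a)%N; first exact: PC.
  by case: (j == a); [apply: class_CB|exact: linC].
have ZJ a x : x != 0 -> jacobian_mx (Z a) x = \matrix_(i, j)
    (if (i < a)%N then jacobian_mx P x i j
     else if i == a then jacobian_mx P x i j - (c%:M : 'M[R]_m.+1) i j else (c%:M : 'M[R]_m.+1) i j).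
  move=> x0; apply/matrixP => j i; rewrite !mxE /Z.
  have [_ L] := derive_coordZ c j i x.
  have Ld : derivable (fun y : V => c * y 0 j) x (e_ i) by have [] := derive_coordZ c j i x.
  case: (j < a)%N => //; case: (j == a); rewrite -mulr_natr; last exact: L.
  by rewrite (@deriveB _ _ _ (P j)) ?L //; have [+ _] := PC j (e_ i); apply.
have ptw x : chi x * (\det (jacobian_mx P x) - c ^+ m.+1) =
    \sum_a chi x * \det (jacobian_mx (Z a) x).
  have [->|x0] := eqVneq x 0.
    by rewrite chi_at0 mul0r big1 // => a _; rewrite mul0r.
  rewrite -mulr_sumr; congr (_ * _); rewrite -(@det_scalar R m.+1 c) det_row_telescope.
  by apply: eq_bigr => a _; rewrite ZJ.
rewrite ball_space_int; last first.
  move=> x xB; rewrite (_ : chi x = 0) ?mul0r //.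
  have [->//|x0] := eqVneq x 0; apply: chi_ball; rewrite leNgt; apply/negP => x1.
  by apply: xB.
rewrite (_ : space_int _ = \sum_a space_int (fun x => chi x * \det (jacobian_mx (Z a) x))).
  apply: le_trans (ler_norm_sum _ _ _) _.
  rewrite mulr_natl -[X in _ *+ X]card_ord -sumr_const; apply: ler_sum => a _.
  have K0 : 0 <= Num.max K c by rewrite le_max c0 orbT.
  apply: (@null_lagrangian_le (Z a) a _ _ e0 K0 (ZC a)).
    move=> x x0 j i ja; rewrite (ZJ a x x0) mxE (negbTE ja) le_max.
    case: (j < a)%N; first by rewrite PK.
    rewrite mxE; case: (j == i); rewrite ?mulr1n ?mulr0n ?normr0 ?c0 ?orbT //.
    by rewrite ger0_norm // lexx orbT.
  by move=> x x0 xl; rewrite /Z ltnn eqxx; exact: Pe.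
rewrite -space_int_sum.
- by apply: eq_Rintegral => t _; rewrite ptw.
- move=> a; apply: class_C0_continuous; apply: (class_C_vanish_near0 rho0).
    by move=> x /chi_near ->; rewrite mul0r.
  have chiP : class_C 1 punctured chi by exact: class_C_sub chiC.
  apply: class_CM => //; first exact: class_CS chiP.
  apply: class_C_det => // i j.
  by apply: jacobian_mx_class_C; exact: (class_CS oP (ZC a i)).
- by move=> a x j /chi_box ->; rewrite mul0r.
Qed.

End WeakContinuity.

Section BallDet.
Context {R : realType} {m : nat}.
Local Notation V := ('rV[R]_m.+1).
Local Notation e_ i := (delta_mx (0 : 'I_1) (i : 'I_m.+1) : V).

Implicit Types (x : V).

Lemma class_C1_gradient_bounded (chi : V -> R) (r : R) :
  class_C 1 setT chi -> (forall (x : V) (j : 'I_m.+1), r < `|x 0 j| -> chi x = 0) ->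
  exists K, forall x i, `|'D_(e_ i) chi x| <= K.
Proof.
move=> chiC chi0.
have ex i : exists C, forall x, `|'D_(e_ i) chi x| <= C.
  have dc : continuous ('D_(e_ i) chi).
    by apply: class_C0_continuous; have [] := chiC (e_ i).
  have [C _ HC] := box_support_bounded dc (derive_outside (e_ i) chi0).
  by exists C.
have [C HC] := choice ex.
exists (\big[Num.max/0]_i C i) => x i; apply: le_trans (HC i x) _.
exact: le_bigmax.
Qed.

(** The cutoff is chosen first, for the region where it differs from 1 to
    contribute at most a third of delta. It determines the constants in front of
    eps in the other contributions, hence eps. *)
Lemma ball_det_close (delta s K : R) : 0 < delta -> 1 <= s -> 0 <= K ->
  exists eps, 0 < eps /\ forall (P : 'I_m.+1 -> V -> R) (beta : V -> R),
    (forall j, class_C 2 punctured (P j)) ->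
    (forall x, x != 0 -> forall j i, `|jacobian_mx P x j i| <= K) ->
    (forall x, x != 0 -> (forall l, `|x 0 l| <= 1) ->
       forall j, `|P j x - (1 + s) * x 0 j| <= eps) ->
    class_C 0 punctured beta -> (forall x, x != 0 -> `|beta x - 1| <= eps) ->
    `|ball_integral (fun x => \det (jacobian_mx P x) / (beta x + s) - (1 + s) ^+ m)|
      <= delta.
Proof.
move=> delta0 s1 K0; have oP := @open_punctured R m.+1.
pose c := 1 + s; have c0 : 0 < c by rewrite /c; lra.
have c1 : 1 <= c by rewrite /c; lra.
pose D := m.+1`!%:R * K ^+ m.+1; have D0 : 0 <= D by rewrite mulr_ge0 // exprn_ge0.
pose C1 := D + c ^+ m; have C10 : 0 < C1 by rewrite ltr_wpDl // exprn_gt0.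
have d1 : 0 < delta / 3 / C1 by rewrite !divr_gt0.
have [chi [rho [rho0 chiC chi_near chi_box [chi01 [chi_ball chi_int]]]]] :=
  @cutoff_exists R m _ d1.
have [Kchi chi_grad] := class_C1_gradient_bounded chiC chi_box.
pose C2 := m.+1%:R * (m.+1`!%:R * (Kchi * (Num.max K c) ^+ m) * (@box_volume R m)).
have Kchi0 : 0 <= Kchi by apply: le_trans (chi_grad 0 ord0).
have C20 : 0 <= C2.
  by rewrite /C2 !mulr_ge0 ?exprn_ge0 ?fine_ge0 // le_max K0.
pose C3 := D * (@ball_volume R m).
have C30 : 0 <= C3 by rewrite mulr_ge0 // ball_volume_ge0.
pose eps := Num.min 1 (Num.min (delta / 3 / (C2 + 1)) (delta / 3 / (C3 + 1))).
have eps0 : 0 < eps.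
  by rewrite /eps !lt_min ltr01 !divr_gt0 // ltr_wpDl.
have eps1 : eps <= 1 by rewrite /eps ge_min lexx.
have e2 : C2 * eps <= delta / 3.
  apply: (@le_trans _ _ ((C2 + 1) * eps)); first by rewrite ler_pM2r // lerDl.
  by rewrite mulrC -ler_pdivlMr ?ltr_wpDl // /eps !ge_min lexx !orbT.
have e3 : C3 * eps <= delta / 3.
  apply: (@le_trans _ _ ((C3 + 1) * eps)); first by rewrite ler_pM2r // lerDl.
  by rewrite mulrC -ler_pdivlMr ?ltr_wpDl // /eps !ge_min lexx !orbT.
exists eps; split => // P beta PC PK Pe betaC beta1.
pose d x := \det (jacobian_mx P x).
have dD x : x != 0 -> `|d x| <= D by move=> x0; apply: det_le => i j; exact: PK.
have dT : tame d.
  split; last by exists D.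
  apply: (class_C_det oP) => i j; apply: jacobian_mx_class_C.
  exact: (class_CS oP (PC i)).
have bs x : x != 0 -> 1 <= beta x + s.
  by move=> /beta1; rewrite ler_norml => /andP[+ _]; lra.
have invle x : x != 0 -> 0 <= (beta x + s)^-1 <= 1.
  by move=> /bs h; rewrite invr_ge0 invf_le1 ?(lt_le_trans ltr01) // h (le_trans ler01).
have invT : tame (fun x => (beta x + s)^-1).
  split; last by exists 1 => x /invle/andP[a b]; rewrite ger0_norm.
  apply: (class_CV oP) => [x /bs h|].
    by rewrite gt_eqF // (lt_le_trans ltr01).
  by apply: (class_CD oP) => //; exact: class_C_cst.
have chi1 x : `|chi x| <= 1 by have /andP[a b] := chi01 x; rewrite ger0_norm.
have chiT : tame chi.
  by split; [apply: (class_CS oP); exact: class_C_sub chiC|exists 1 => x _].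
pose E x := d x / (beta x + s) - c ^+ m.
have ET : tame E := tame_sub (tame_mul dT invT) (tame_cst _).
have cm0 : 0 <= c ^+ m by rewrite exprn_ge0 // ltW.
have ED x : x != 0 -> `|E x| <= C1.
  move=> x0; apply: le_trans (ler_normB _ _) _; rewrite /C1 (ger0_norm cm0) lerD2r.
  rewrite normrM -[D]mulr1; have /andP[a b] := invle x x0.
  by apply: ler_pM => //; [exact: dD|rewrite ger0_norm].
(* E1 lives where the cutoff is not 1, E2 is the null Lagrangian part and E3
   replaces the denominator beta + s by the constant 1 + s *)
pose E1 x := (1 - chi x) * E x.
pose E2 x := c^-1 * (chi x * (d x - c ^+ m.+1)).
pose E3 x := chi x * (d x * ((beta x + s)^-1 - c^-1)).
have Esplit x : E x = E1 x + (E2 x + E3 x).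
  rewrite /E1 /E2 /E3 /E.
  have -> : c^-1 * (chi x * (d x - c ^+ m.+1)) = chi x * (d x / c) - chi x * c ^+ m.
    have -> : c ^+ m = c ^+ m.+1 / c by rewrite exprSr mulfK // gt_eqF.
    by ring.
  ring.
have E2'T : tame (fun x => chi x * (d x - c ^+ m.+1)) :=
  tame_mul chiT (tame_sub dT (tame_cst _)).
have chi'T : tame (fun x => 1 - chi x) := tame_sub (tame_cst _) chiT.
have E1T : tame E1 := tame_mul chi'T ET.
have E2T : tame E2 := tame_mul (tame_cst _) E2'T.
have E3T : tame E3 := tame_mul chiT (tame_mul dT (tame_sub invT (tame_cst _))).
have ic : 0 <= c^-1 <= 1 by rewrite invr_ge0 invf_le1 // c1 ltW.
have E3D x : x != 0 -> `|E3 x| <= D * eps.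
  move=> x0; rewrite /E3 normrM -[leRHS]mul1r; apply: ler_pM => //.
  rewrite normrM; apply: ler_pM => //; first exact: dD.
  have b1 := bs x x0; have bn0 : beta x + s != 0 by rewrite gt_eqF // (lt_le_trans ltr01).
  have cn0 : c != 0 by rewrite gt_eqF.
  have -> : (beta x + s)^-1 - c^-1 = - ((beta x - 1) * ((beta x + s)^-1 * c^-1)).
    by rewrite /c in cn0 *; field; rewrite bn0 cn0.
  have /andP[i1 i2] := invle x x0; have /andP[j1 j2] := ic.
  rewrite normrN normrM -[leRHS]mulr1; apply: ler_pM => //; first exact: beta1.
  by rewrite ger0_norm ?mulr_ge0 // -[leRHS]mulr1 ler_pM.
rewrite -/c -[fun x => _]/E (eq_ball_integral (fun x _ => Esplit x)).
rewrite (ball_integralD E1T (tame_add E2T E3T)) (ball_integralD E2T E3T).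
have B1 : `|ball_integral E1| <= delta / 3.
  apply: (@le_trans _ _ (ball_integral (fun x => C1 * (1 - chi x)))).
    apply: ball_integral_norm_le => // [|x x0].
      exact: (tame_mul (tame_cst _) chi'T).
    rewrite /E1 normrM mulrC ler_pM ?ED //.
    by have /andP[a b] := chi01 x; rewrite ger0_norm // subr_ge0.
  rewrite (ball_integralZ _ chi'T) mulrC.
  by rewrite -ler_pdivlMr // ltW.
have B2 : `|ball_integral E2| <= delta / 3.
  rewrite (ball_integralZ _ E2'T).
  have /andP[j1 j2] := ic.
  rewrite normrM ger0_norm // -[leRHS]mul1r ler_pM //.
  apply: le_trans e2; have := @det_weak_continuity R m chi rho Kchi rho0 chiC chi_near
    chi_box chi_ball chi_grad P c K eps (ltW eps0) (ltW c0) PC PK Pe.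
  by rewrite /C2 -!mulrA [eps * _]mulrC -!mulrA.
have B3 : `|ball_integral E3| <= delta / 3.
  apply: (@le_trans _ _ (ball_integral (fun=> D * eps))).
    by apply: ball_integral_norm_le => //; exact: tame_cst.
  by rewrite ball_integral_cst mulrAC.
apply: le_trans (ler_normD _ _) _.
have : `|ball_integral E2 + ball_integral E3| <= delta / 3 + delta / 3.
  by apply: le_trans (ler_normD _ _) _; exact: lerD.
move: B1; lra.
Qed.

End BallDet.

(** * Derivatives of homogeneous functions *)

Section Homogeneous.
Context {R : realType} {m : nat}.
Local Notation V := ('rV[R]_m).
Local Notation e_ i := (delta_mx (0 : 'I_1) (i : 'I_m) : V).
Implicit Types (f g : V -> R) (x y v : V).

Lemma deriveZv f x v (c : R) : differentiable f x -> 'D_(c *: v) f x = c * 'D_v f x.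
Proof. by move=> df; rewrite !deriveE // linearZ. Qed.

Lemma deriveDv f x v w : differentiable f x -> 'D_(v + w) f x = 'D_v f x + 'D_w f x.
Proof. by move=> df; rewrite !deriveE // linearD. Qed.

Lemma derive_coordE f x v : differentiable f x ->
  'D_v f x = \sum_i v 0 i * 'D_(e_ i) f x.
Proof.
move=> df; rewrite [in LHS](row_sum_delta v) deriveE // linear_sum.
by apply: eq_bigr => i _; rewrite linearZ /= deriveE.
Qed.

Lemma near_punctured x : x != 0 -> \forall y \near x, y != 0.
Proof. by move=> x0; exact: (open_nbhs_nbhs (conj open_punctured x0)). Qed.

Lemma derive_homogeneous f x v (a c : R) : 0 < c -> x != 0 -> differentiable f x ->
  (forall y, y != 0 -> f (c *: y) = a * f y) ->
  'D_v f (c *: x) = a / c * 'D_v f x.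
Proof.
move=> c0 x0 df fc; have cn0 : c != 0 by rewrite gt_eqF.
pose g y := f (c^-1 *: y).
have gr : (fun h : R => h^-1 *: ((g \o shift (c *: x)) (h *: v) - g (c *: x))) =
    (fun h => h^-1 *: ((f \o shift x) (h *: (c^-1 *: v)) - f x)).
  have cK y : c^-1 *: (c *: y) = y by rewrite scalerA mulVf // scale1r.
  apply/funext => h; rewrite /g /= cK; congr (_ *: (f _ - _)).
  by rewrite scalerDr cK !scalerA mulrC.
have dfv : derivable f x (c^-1 *: v) by exact: diff_derivable.
have Dg : is_derive (c *: x) v g (c^-1 * 'D_v f x).
  split; first by rewrite /derivable gr.
  by rewrite /derive gr -(deriveZv v c^-1 df).
have -> : 'D_v f (c *: x) = 'D_v (fun y => a * g y) (c *: x).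
  apply: near_eq_derive.
  have cx0 : c *: x != 0 by rewrite scaler_eq0 negb_or cn0.
  apply: filterS (near_punctured cx0) => y y0.
  by rewrite /g -fc ?scalerA ?mulfV ?scale1r // scaler_eq0 negb_or invr_eq0 cn0.
have D2 := @is_deriveM R V (fun=> a) g (c *: x) v _ _ (is_derive_cst a (c *: x) v) Dg.
have [_ D2'] := D2.
by rewrite -[fun y => a * g y]/((fun=> a) * g) D2' scaler0 addr0 -[_ *: _]/(_ * _) mulrA.
Qed.

Lemma derive_radial f x (phi : R -> R) (d : R) :
  differentiable f x -> is_derive (0 : R) (1 : R) phi d ->
  (forall t : R, `|t| < 1 -> f (x + t *: x) = phi t * f x) ->
  'D_x f x = d * f x.
Proof.
move=> df Dphi fphi.
have d0 : derivable f (x + 0 *: x) x.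
  by rewrite scale0r addr0; exact: diff_derivable.
have [_ D1] := is_derive_line d0; rewrite scale0r addr0 in D1; rewrite -D1.
have [_ D2] := @is_deriveM R R phi (fun=> f x) 0 1 _ _ Dphi (is_derive_cst (f x) (0 : R) (1 : R)).
rewrite (@near_eq_derive _ _ _ _ (phi * (fun=> f x))).
  by rewrite D2 scaler0 add0r -[_ *: _]/(_ * _) mulrC.
apply/nbhs_ballP; exists 1 => //= t; rewrite -ball_normE /= sub0r normrN => t1.
by rewrite fphi.
Qed.

Lemma derive_radial0 f x : differentiable f x ->
  (forall (c : R) y, 0 < c -> y != 0 -> f (c *: y) = f y) -> x != 0 -> 'D_x f x = 0.
Proof.
move=> df fc x0; rewrite (@derive_radial f x (fun=> 1) 0) ?mul0r // => t t1.
rewrite mul1r -{1}[x]scale1r -scalerDl fc //.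
by move: t1; rewrite ltr_norml => /andP[]; lra.
Qed.

(** Euler's relation in degree -1. *)
Lemma derive_radialV f x : differentiable f x ->
  (forall (c : R) y, 0 < c -> y != 0 -> f (c *: y) = c^-1 * f y) -> x != 0 ->
  'D_x f x = - f x.
Proof.
move=> df fc x0.
have D1 : is_derive (0 : R) (1 : R) (fun t : R => 1 + t) 1.
  have := @is_deriveD R R R (fun=> 1) id 0 1 _ _ (is_derive_cst (1:R) (0:R) (1:R)) (is_derive_id (0:R) (1:R)).
  by rewrite add0r.
have n0 : 1 + (0 : R) != 0 by rewrite addr0 oner_eq0.
have [D1a D1b] := D1.
have D2 : is_derive (0 : R) (1 : R) (fun t : R => (1 + t)^-1) (-1).
  split; first exact: (derivableV (f := fun t : R => 1 + t)).
  rewrite (deriveV (f := fun t : R => 1 + t)) // D1b addr0 expr1n invr1.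
  by rewrite -[_ *: _]/(_ * _) mulr1.
rewrite (derive_radial df D2) ?mulN1r // => t t1.
rewrite -{1}[x]scale1r -scalerDl fc //.
by move: t1; rewrite ltr_norml => /andP[]; lra.
Qed.

Lemma class_C_enorm r : class_C r punctured (@enorm R m).
Proof.
apply: class_C_sqrt; [exact: open_punctured| |exact: class_C_dotp open_punctured].
by move=> x x0; rewrite -enorm_sqr exprn_gt0 // enorm_gt0.
Qed.

Lemma dotpC v w : dotp v w = dotp w v.
Proof. by apply: eq_bigr => i _; rewrite mulrC. Qed.

Lemma derive_enorm x i : x != 0 -> 'D_(e_ i) (@enorm R m) x = x 0 i / enorm x.
Proof.
move=> x0; have E0 : 0 < enorm x by rewrite enorm_gt0.
have q0 : 0 < dotp x x by rewrite -enorm_sqr exprn_gt0.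
have dq : differentiable (fun y : V => dotp y y) x.
  by apply: (@class_C1_differentiable _ _ setT); [exact: openT|exact: class_C_dotp openT|].
have [_ ->] := @is_derive_sqrt R m (fun y : V => dotp y y) x (e_ i) q0 dq.
rewrite -/(enorm x).
have -> : 'D_(e_ i) (fun y : V => dotp y y) x = 2 * x 0 i.
  rewrite /dotp.
  have Dc j : is_derive x (e_ i) (fun y : V => y 0 j) ((j == i)%:R).
    by have := is_derive_coord x (e_ i) j; rewrite mxE eqxx.
  have Dj j := @is_deriveM R V (fun y => y 0 j) (fun y => y 0 j) x (e_ i) _ _ (Dc j) (Dc j).
  have [_] := @is_derive_sum R V R m (fun j => (fun y : V => y 0 j) * (fun y : V => y 0 j)) x (e_ i) _ Dj.
  rewrite (_ : \sum_(i < m) _ = (fun y : V => \sum_i y 0 i * y 0 i)); last first.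
    by apply/funext => y; rewrite fct_sumE.
  move=> ->; rewrite (bigD1 i) //= big1 ?addr0 ?eqxx; last first.
    by move=> j ji; rewrite (negbTE ji) mulr0n scaler0 addr0.
  by rewrite -[_ *: _]/(_ * _) mulr1 mulr2n mulrDl mul1r.
by rewrite invfM mulrACA mulVf // mul1r mulrC.
Qed.

End Homogeneous.

(** * Radial graphs and their parallel hypersurfaces *)

Section LambdaDerivatives.
Context {R : realType} {V : normedModType R}.
Implicit Types (f g : V -> R) (x v : V).

Lemma derive_addE f g x v : derivable f x v -> derivable g x v ->
  'D_v (fun y => f y + g y) x = 'D_v f x + 'D_v g x.
Proof. exact: (@deriveD _ _ _ f g). Qed.

Lemma derive_mulE f g x v : derivable f x v -> derivable g x v ->
  'D_v (fun y => f y * g y) x = f x * 'D_v g x + g x * 'D_v f x.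
Proof. exact: (@deriveM _ _ f g). Qed.

Lemma derive_scaleE (c : R) f x v : derivable f x v ->
  'D_v (fun y => c * f y) x = c * 'D_v f x.
Proof.
move=> df; have := derive_mulE (derivable_cst c x v) df.
by rewrite derive_cst mulr0 addr0.
Qed.

Lemma derive_subE f g x v : derivable f x v -> derivable g x v ->
  'D_v (fun y => f y - g y) x = 'D_v f x - 'D_v g x.
Proof. exact: (@deriveB _ _ _ f g). Qed.

Lemma derive_invE f x v : f x != 0 -> derivable f x v ->
  'D_v (fun y => (f y)^-1) x = - ((f x)^-1 * (f x)^-1 * 'D_v f x).
Proof. by move=> fx df; rewrite deriveV // -[_ *: _]/(_ * _) mulNr expr2 invfM. Qed.

Lemma derive_sumE (I : finType) (F : I -> V -> R) x v :
  (forall i, derivable (F i) x v) ->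
  derivable (fun y => \sum_i F i y) x v /\
  'D_v (fun y => \sum_i F i y) x = \sum_i 'D_v (F i) x.
Proof.
move=> Fd.
suff H (s : seq I) : derivable (fun y => \sum_(i <- s) F i y) x v /\
    'D_v (fun y => \sum_(i <- s) F i y) x = \sum_(i <- s) 'D_v (F i) x.
  exact: H.
elim: s => [|i s [IH1 IH2]].
  have -> : (fun y => \sum_(i <- [::]) F i y) = (fun=> 0).
    by apply/funext => y; rewrite big_nil.
  by rewrite big_nil derive_cst; split => //; exact: derivable_cst.
have -> : (fun y => \sum_(j <- i :: s) F j y) = (fun y => F i y + \sum_(j <- s) F j y).
  by apply/funext => y; rewrite big_cons.
rewrite big_cons (derive_addE (Fd i) IH1) IH2; split; last by [].
exact: (@derivableD R _ R (F i) (fun y => \sum_(j <- s) F j y) x v (Fd i) IH1).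
Qed.

End LambdaDerivatives.

Section RadialGraph.
Context {R : realType} {m : nat}.
Local Notation V := ('rV[R]_m).
Local Notation e_ i := (delta_mx (0 : 'I_1) (i : 'I_m) : V).
Implicit Types (f g : V -> R) (x y v w : V) (b i j : 'I_m) (c s : R).

Variable U : V -> R.
Hypothesis UC : class_C 3 punctured U.
Hypothesis Uhom : forall c y, 0 < c -> y != 0 -> U (c *: y) = U y.
Hypothesis U1 : forall y, y != 0 -> 0 < 1 + U y.

(** All the fields below are homogeneous extensions from the sphere: U has
    degree 0, so that its partial derivatives have degree -1. *)
Definition Upart b y := 'D_(e_ b) U y.
(** The radial graph, extended with degree 0. *)
Definition graph b y := (1 + U y) * (y 0 b * (enorm y)^-1).
(** On the unit sphere this is the vector (1 + U) x - grad U, orthogonal to the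
    images (D_v U) x + (1 + U) v of tangent vectors v. *)
Definition conormal b y := graph b y - enorm y * Upart b y.
Definition conormal_norm y := Num.sqrt (\sum_b conormal b y * conormal b y).
Definition normal b y := conormal b y * (conormal_norm y)^-1.
(** The support function <graph, normal>: the radial component of the conormal
    is 1 + U. *)
Definition support y := (1 + U y) * (1 + U y) * (conormal_norm y)^-1.
(** The parallel hypersurface at distance s, extended with degree 1; it is (1 +
    s) y when U = 0. *)
Definition parallel s b y := enorm y * (graph b y + s * normal b y).

Let oP := @open_punctured R m.

Let En0 y : y != 0 -> enorm y != 0. Proof. by rewrite enorm_eq0. Qed.

Let dotE y : \sum_b y 0 b * y 0 b = enorm y * enorm y.
Proof. by rewrite -expr2 enorm_sqr. Qed.

Lemma class_C_ok f y v : class_C 1 punctured f -> y != 0 ->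
  differentiable f y /\ derivable f y v.
Proof.
move=> fC y0; have df := class_C1_differentiable oP fC y0.
by split => //; exact: diff_derivable.
Qed.

Lemma UpartC b : class_C 2 punctured (Upart b).
Proof. exact: class_C_derive. Qed.

Lemma graphC b : class_C 3 punctured (graph b).
Proof.
apply: (class_CM oP); first by apply: (class_CD oP); [exact: class_C_cst|exact: UC].
apply: (class_CM oP); first exact: class_C_coord.
apply: (class_CV oP) => [y|]; [exact: En0|exact: class_C_enorm].
Qed.

Lemma conormalC b : class_C 2 punctured (conormal b).
Proof.
apply: (class_CB oP); first exact: (class_CS oP (graphC b)).
by apply: (class_CM oP); [exact: class_C_enorm|exact: UpartC].
Qed.

Lemma Upart_hom b c y : 0 < c -> y != 0 -> Upart b (c *: y) = c^-1 * Upart b y.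
Proof.
move=> c0 y0; have [dU _] := class_C_ok (e_ b) (class_C_le oP (isT : 1 <= 3)%N UC) y0.
rewrite /Upart (@derive_homogeneous _ _ U y _ 1 c) ?div1r // => z z0.
by rewrite mul1r Uhom.
Qed.

Lemma enorm_hom c y : 0 < c -> enorm (c *: y) = c * enorm y.
Proof. by move=> c0; rewrite enormZ gtr0_norm. Qed.

Lemma graph_hom b c y : 0 < c -> y != 0 -> graph b (c *: y) = graph b y.
Proof.
move=> c0 y0; rewrite /graph Uhom // enorm_hom // mxE invfM.
have cn0 : c != 0 by rewrite gt_eqF.
by rewrite mulrACA mulfV // mul1r.
Qed.

Lemma conormal_hom b c y : 0 < c -> y != 0 -> conormal b (c *: y) = conormal b y.
Proof.
move=> c0 y0; rewrite /conormal graph_hom // Upart_hom // enorm_hom //.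
have cn0 : c != 0 by rewrite gt_eqF.
by rewrite mulrACA mulfV // mul1r.
Qed.

Lemma conormal_norm_hom c y : 0 < c -> y != 0 ->
  conormal_norm (c *: y) = conormal_norm y.
Proof.
move=> c0 y0; congr Num.sqrt; apply: eq_bigr => b _.
by rewrite (conormal_hom b c0 y0).
Qed.

Lemma normal_hom b c y : 0 < c -> y != 0 -> normal b (c *: y) = normal b y.
Proof. by move=> c0 y0; rewrite /normal (conormal_hom b c0 y0) (conormal_norm_hom c0 y0). Qed.

Lemma support_hom c y : 0 < c -> y != 0 -> support (c *: y) = support y.
Proof. by move=> c0 y0; rewrite /support (Uhom c0 y0) (conormal_norm_hom c0 y0). Qed.

Lemma parallel_hom s b c y : 0 < c -> y != 0 ->
  parallel s b (c *: y) = c * parallel s b y.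
Proof.
by move=> c0 y0; rewrite /parallel graph_hom // normal_hom // enorm_hom // mulrA.
Qed.

Lemma Upart_euler y : y != 0 -> \sum_b y 0 b * Upart b y = 0.
Proof.
move=> y0; have [dU _] := class_C_ok y (class_C_le oP (isT : 1 <= 3)%N UC) y0.
by rewrite -(derive_coordE y dU) derive_radial0 // => c z; exact: Uhom.
Qed.

Lemma position_conormal y : y != 0 ->
  \sum_b y 0 b * (enorm y)^-1 * conormal b y = 1 + U y.
Proof.
move=> y0; rewrite /conormal /graph.
under eq_bigr do rewrite mulrBr.
rewrite sumrB [X in _ - X](_ : _ = 0); last first.
  rewrite -[RHS](Upart_euler y0); apply: eq_bigr => b _.
  by field; exact: En0.
rewrite subr0 (eq_bigr (fun b => (1 + U y) * (enorm y)^-1 * (enorm y)^-1 * (y 0 b * y 0 b))).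
  by rewrite -mulr_sumr dotE; field; exact: En0.
by move=> b _; ring.
Qed.

Lemma conormal_sqr y : y != 0 -> \sum_b conormal b y * conormal b y =
  (1 + U y) ^+ 2 + enorm y ^+ 2 * \sum_b Upart b y * Upart b y.
Proof.
move=> y0.
rewrite (eq_bigr (fun b => (1 + U y) * (y 0 b * (enorm y)^-1 * conormal b y) +
    (enorm y ^+ 2 * (Upart b y * Upart b y) - (1 + U y) * (y 0 b * Upart b y)))).
  rewrite big_split /= sumrB -!mulr_sumr position_conormal // Upart_euler //.
  by rewrite mulr0 subr0 expr2.
move=> b _; rewrite {1}/conormal /conormal /graph.
by field; exact: En0.
Qed.

Lemma conormal_norm_ge y : y != 0 -> 1 + U y <= conormal_norm y.
Proof.
move=> y0; rewrite -[leLHS]ger0_norm ?(ltW (U1 y0)) // -sqrtr_sqr ler_wsqrtr //.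
rewrite conormal_sqr // lerDl mulr_ge0 ?sqr_ge0 // sumr_ge0 // => b _.
by rewrite -expr2 sqr_ge0.
Qed.

Lemma conormal_norm_gt0 y : y != 0 -> 0 < conormal_norm y.
Proof. by move=> y0; apply: lt_le_trans (conormal_norm_ge y0); exact: U1. Qed.

Let nn0 y : y != 0 -> conormal_norm y != 0.
Proof. by move=> y0; rewrite gt_eqF // conormal_norm_gt0. Qed.

Lemma conormal_norm_sqr y :
  conormal_norm y * conormal_norm y = \sum_b conormal b y * conormal b y.
Proof.
rewrite -expr2 sqr_sqrtr // sumr_ge0 // => b _.
by rewrite -expr2 sqr_ge0.
Qed.

Lemma conormal_normC : class_C 2 punctured conormal_norm.
Proof.
apply: (class_C_sqrt oP) => [y y0|].
  by rewrite -conormal_norm_sqr mulr_gt0 // conormal_norm_gt0.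
by apply: (@class_C_sum _ _ 2 _ _ _ _ (fun b y => conormal b y * conormal b y) oP) => b _;
  apply: (class_CM oP); exact: conormalC.
Qed.

Lemma conormal_normVC : class_C 2 punctured (fun y => (conormal_norm y)^-1).
Proof. by apply: (class_CV oP) => [y|]; [exact: nn0|exact: conormal_normC]. Qed.

Lemma normalC b : class_C 2 punctured (normal b).
Proof. by apply: (class_CM oP); [exact: conormalC|exact: conormal_normVC]. Qed.

Lemma supportC : class_C 2 punctured support.
Proof.
have U1C : class_C 2 punctured (fun y => 1 + U y).
  by apply: (class_CD oP); [exact: class_C_cst|exact: (class_CS oP UC)].
apply: (class_CM oP); last exact: conormal_normVC.
by apply: (class_CM oP).
Qed.

Lemma parallelC s b : class_C 2 punctured (parallel s b).
Proof.
apply: (class_CM oP); first exact: class_C_enorm.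
apply: (class_CD oP); first exact: (class_CS oP (graphC b)).
by apply: (class_CM oP); [exact: class_C_cst|exact: normalC].
Qed.

Lemma support_gt0 y : y != 0 -> 0 < support y.
Proof. by move=> y0; rewrite /support !mulr_gt0 ?U1 // invr_gt0 conormal_norm_gt0. Qed.

Lemma normal_unit y : y != 0 -> \sum_b normal b y * normal b y = 1.
Proof.
move=> y0; rewrite (eq_bigr (fun b => (conormal_norm y)^-1 * (conormal_norm y)^-1 *
    (conormal b y * conormal b y))).
  by rewrite -mulr_sumr -conormal_norm_sqr; field; exact: nn0.
by move=> b _; rewrite /normal; ring.
Qed.

Lemma graph_normal y : y != 0 -> \sum_b graph b y * normal b y = support y.
Proof.
move=> y0; rewrite (eq_bigr (fun b => (1 + U y) * (conormal_norm y)^-1 *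
    (y 0 b * (enorm y)^-1 * conormal b y))).
  by rewrite -mulr_sumr position_conormal // /support; ring.
by move=> b _; rewrite /normal /graph; ring.
Qed.

Lemma derive_graph b i y : y != 0 -> 'D_(e_ i) (graph b) y =
  Upart i y * (y 0 b * (enorm y)^-1) +
  (1 + U y) * ((b == i)%:R * (enorm y)^-1 - y 0 b * y 0 i * (enorm y)^-1 ^+ 3).
Proof.
move=> y0.
have [_ dU] := class_C_ok (e_ i) (class_C_le oP (isT : 1 <= 3)%N UC) y0.
have [_ dE] := class_C_ok (e_ i) (@class_C_enorm R m 1) y0.
have [dc Dc] := is_derive_coord y (e_ i) b; rewrite mxE eqxx /= in Dc.
have dEV : derivable (fun z : V => (enorm z)^-1) y (e_ i).
  exact: (derivableV (En0 y0) dE).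
have d1U : derivable (fun z => 1 + U z) y (e_ i).
  by apply: (@derivableD R V R (fun=> 1) U y (e_ i)); [exact: derivable_cst|exact: dU].
have dq : derivable (fun z : V => z 0 b * (enorm z)^-1) y (e_ i).
  exact: (@derivableM R V (fun z : V => z 0 b) _ y (e_ i) dc dEV).
have D1 := derive_addE (derivable_cst (1 : R) y (e_ i)) dU.
rewrite derive_cst add0r in D1.
rewrite /graph (derive_mulE d1U dq) (derive_mulE dc dEV) Dc.
rewrite (derive_invE (En0 y0) dE) (derive_enorm _ y0) D1 -/(Upart i y).
by field; exact: En0.
Qed.

Lemma derive_graph_conormal i y : y != 0 ->
  \sum_b 'D_(e_ i) (graph b) y * conormal b y = 0.
Proof.
move=> y0.
rewrite (eq_bigr (fun b => (Upart i y - (1 + U y) * (y 0 i * (enorm y)^-1 ^+ 2)) *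
    (y 0 b * (enorm y)^-1 * conormal b y) +
    (1 + U y) * (enorm y)^-1 * ((b == i)%:R * conormal b y))); last first.
  by move=> b _; rewrite derive_graph //; ring.
rewrite big_split /= -!mulr_sumr position_conormal //.
rewrite (bigD1 i) //= big1 ?addr0 ?eqxx ?mul1r; last first.
  by move=> b bi; rewrite (negbTE bi) mul0r.
by rewrite /conormal /graph; field; exact: En0.
Qed.

Lemma derive_graph_normal i y : y != 0 ->
  \sum_b normal b y * 'D_(e_ i) (graph b) y = 0.
Proof.
move=> y0; rewrite (eq_bigr (fun b => (conormal_norm y)^-1 *
  ('D_(e_ i) (graph b) y * conormal b y))); last by move=> b _; rewrite /normal; ring.
by rewrite -mulr_sumr derive_graph_conormal // mulr0.
Qed.

Lemma derive_normal_normal i y : y != 0 ->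
  \sum_b 'D_(e_ i) (normal b) y * normal b y = 0.
Proof.
move=> y0.
have dn b : derivable (normal b) y (e_ i).
  by have [] := class_C_ok (e_ i) (class_CS oP (normalC b)) y0.
have dnn b : derivable (fun z => normal b z * normal b z) y (e_ i).
  exact: (@derivableM R V (normal b) (normal b) y (e_ i) (dn b) (dn b)).
have [_] := derive_sumE dnn.
rewrite (@near_eq_derive R V R _ (fun=> 1 : R)); last first.
  by apply: filterS (near_punctured y0) => z; exact: normal_unit.
rewrite derive_cst => /esym E.
suff : 2 * (\sum_b 'D_(e_ i) (normal b) y * normal b y) = 0.
  by move=> /eqP; rewrite mulf_eq0 pnatr_eq0 => /eqP.
rewrite mulr_sumr -[RHS]E; apply: eq_bigr => b _.
by rewrite (derive_mulE (dn b) (dn b)); ring.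
Qed.

(** Differentiating <normal, D_l graph> = 0 gives - <normal, D_k D_l graph> for
    the second fundamental form, and second derivatives commute. *)
Lemma second_form_symmetry i j y : y != 0 ->
  \sum_b 'D_(e_ i) (normal b) y * 'D_(e_ j) (graph b) y =
  \sum_b 'D_(e_ j) (normal b) y * 'D_(e_ i) (graph b) y.
Proof.
move=> y0.
have key k l : \sum_b 'D_(e_ k) (normal b) y * 'D_(e_ l) (graph b) y =
    - \sum_b normal b y * 'D_(e_ k) ('D_(e_ l) (graph b)) y.
  have dn b : derivable (normal b) y (e_ k).
    by have [] := class_C_ok (e_ k) (class_CS oP (normalC b)) y0.
  have dg b : derivable ('D_(e_ l) (graph b)) y (e_ k).
    have gC : class_C 2 punctured ('D_(e_ l) (graph b)) by exact: class_C_derive (graphC b).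
    by have [] := class_C_ok (e_ k) (class_CS oP gC) y0.
  have dng b : derivable (fun z => normal b z * 'D_(e_ l) (graph b) z) y (e_ k).
    exact: (@derivableM R V (normal b) _ y (e_ k) (dn b) (dg b)).
  have [_] := derive_sumE dng.
  rewrite (@near_eq_derive R V R _ (fun=> 0 : R)); last first.
    by apply: filterS (near_punctured y0) => z; exact: derive_graph_normal.
  rewrite derive_cst => /esym E.
  apply/eqP; rewrite -addr_eq0 -[X in _ == X]E -big_split /=; apply/eqP.
  by apply: eq_bigr => b _; rewrite (derive_mulE (dn b) (dg b)); ring.
apply: (etrans (key i j)); apply: etrans (esym (key j i)).
have S b := class_C_Schwarz (e_ i) (e_ j) oP (class_CS oP (graphC b)) y0.
have E : \sum_b normal b y * 'D_(e_ i) ('D_(e_ j) (graph b)) y =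
    \sum_b normal b y * 'D_(e_ j) ('D_(e_ i) (graph b)) y.
  by apply: eq_bigr => b _; exact: (congr1 (fun z => normal b y * z) (S b)).
exact: (congr1 -%R E).
Qed.

Lemma graph_radial y b : y != 0 -> \sum_i y 0 i * 'D_(e_ i) (graph b) y = 0.
Proof.
move=> y0; have [dg _] := class_C_ok y (class_C_le oP (isT : 1 <= 3)%N (graphC b)) y0.
rewrite -(derive_coordE y dg); apply: (derive_radial0 dg _ y0) => c z.
exact: graph_hom.
Qed.

Lemma normal_radial y b : y != 0 -> \sum_i y 0 i * 'D_(e_ i) (normal b) y = 0.
Proof.
move=> y0; have [dg _] := class_C_ok y (class_CS oP (normalC b)) y0.
rewrite -(derive_coordE y dg); apply: (derive_radial0 dg _ y0) => c z.
exact: normal_hom.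
Qed.

Lemma derive_parallel s b i y : y != 0 -> 'D_(e_ i) (parallel s b) y =
  y 0 i * (enorm y)^-1 * (graph b y + s * normal b y) +
  enorm y * ('D_(e_ i) (graph b) y + s * 'D_(e_ i) (normal b) y).
Proof.
move=> y0.
have [_ dE] := class_C_ok (e_ i) (@class_C_enorm R m 1) y0.
have [_ dg] := class_C_ok (e_ i) (class_C_le oP (isT : 1 <= 3)%N (graphC b)) y0.
have [_ dn] := class_C_ok (e_ i) (class_CS oP (normalC b)) y0.
have dsn : derivable (fun z => s * normal b z) y (e_ i).
  exact: (@derivableM R V (fun=> s) (normal b) y (e_ i) (derivable_cst _ _ _) dn).
have dgn : derivable (fun z => graph b z + s * normal b z) y (e_ i).
  exact: (@derivableD R V R (graph b) (fun z => s * normal b z) y (e_ i) dg dsn).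
rewrite /parallel (derive_mulE dE dgn) (derive_addE dg dsn) (derive_scaleE s dn).
by rewrite (derive_enorm _ y0) addrC [_ * (y 0 i / _)]mulrC.
Qed.

Lemma jacobian_parallel_hom s b i c y : 0 < c -> y != 0 ->
  'D_(e_ i) (parallel s b) (c *: y) = 'D_(e_ i) (parallel s b) y.
Proof.
move=> c0 y0; have [dp _] := class_C_ok y (class_CS oP (parallelC s b)) y0.
rewrite (@derive_homogeneous _ _ _ y _ c c) ?mulfV ?mul1r ?gt_eqF // => z z0.
exact: parallel_hom.
Qed.

End RadialGraph.

(** * Estimates for a radial graph close to the sphere *)

Section Estimates.
Context {R : realType} {m : nat}.
Local Notation V := ('rV[R]_m).
Local Notation e_ i := (delta_mx (0 : 'I_1) (i : 'I_m) : V).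
Implicit Types (f g : V -> R) (x y v w : V) (b i j : 'I_m) (c s : R).

Variables (U : V -> R) (eps M : R).
Hypothesis UC : class_C 3 punctured U.
Hypothesis Uhom : forall c y, 0 < c -> y != 0 -> U (c *: y) = U y.
Hypothesis U1 : forall y, y != 0 -> 0 < 1 + U y.
Hypothesis eps0 : 0 <= eps.
Hypothesis eps4 : eps <= 1 / 4.
Hypothesis M0 : 0 <= M.
Hypothesis Ule : forall x, enorm x = 1 -> `|U x| <= eps.
Hypothesis gradU_le : forall x v, enorm x = 1 -> dotp x v = 0 -> enorm v = 1 ->
  `|'D_v U x| <= eps.
Hypothesis hessU_le : forall x v w, enorm x = 1 -> dotp x v = 0 -> enorm v = 1 ->
  dotp x w = 0 -> enorm w = 1 -> `|'D_v ('D_w U) x| <= M.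

Let oP := @open_punctured R m.
Let UC1 : class_C 1 punctured U := class_C_le oP (isT : 1 <= 3)%N UC.
Let UC2 : class_C 2 punctured U := class_CS oP UC.

Let unit_n0 x : enorm x = 1 -> x != 0.
Proof. by move=> x1; rewrite -enorm_gt0 x1. Qed.

Lemma dotpZr c x v : dotp x (c *: v) = c * dotp x v.
Proof. by rewrite /dotp mulr_sumr; apply: eq_bigr => i _; rewrite mxE mulrCA. Qed.

Lemma unit_direction v : v != 0 -> enorm (direction v) = 1.
Proof.
move=> v0; rewrite enormZ ger0_norm ?invr_ge0 ?enorm_ge0 // mulVf //.
by rewrite enorm_eq0.
Qed.

Lemma direction_scale v : v != 0 -> v = enorm v *: direction v.
Proof. by move=> v0; rewrite scalerA mulfV ?scale1r // enorm_eq0. Qed.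

Lemma tangent_derive_le x v : enorm x = 1 -> dotp x v = 0 ->
  `|'D_v U x| <= eps * enorm v.
Proof.
move=> x1 xv; have x0 := unit_n0 x1.
have [->|v0] := eqVneq v 0; first by rewrite derive0 normr0 mulr_ge0 // enorm_ge0.
have dU := class_C1_differentiable oP UC1 x0.
rewrite {1}[v]direction_scale // deriveZv // normrM (ger0_norm (enorm_ge0 v)) mulrC.
rewrite ler_wpM2r ?enorm_ge0 //; apply: gradU_le => //; last exact: unit_direction.
by rewrite dotpZr xv mulr0.
Qed.

Lemma tangent_hessian_le x v w : enorm x = 1 -> dotp x v = 0 -> dotp x w = 0 ->
  enorm v <= 1 -> enorm w <= 1 -> `|'D_v ('D_w U) x| <= M.
Proof.
move=> x1 xv xw v1 w1; have x0 := unit_n0 x1.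
have dDC z : class_C 1 punctured ('D_z U) by exact: class_C_derive UC2.
have dD z y : y != 0 -> differentiable ('D_z U) y.
  by move=> y0; exact: class_C1_differentiable oP (dDC z) y0.
have [->|v0] := eqVneq v 0; first by rewrite derive0 normr0.
have [->|w0] := eqVneq w 0.
  rewrite (_ : 'D_0 U = fun=> 0); last by apply/funext => y; rewrite derive0.
  by rewrite derive_cst normr0.
pose v' := direction v; pose w' := direction w.
have -> : 'D_v ('D_w U) x = enorm v * (enorm w * 'D_v' ('D_w' U) x).
  rewrite {1}[v]direction_scale // deriveZv; last exact: dD.
  congr (_ * _); rewrite -derive_scaleE; last exact: diff_derivable (dD _ _ x0).
  apply: near_eq_derive; apply: filterS (near_punctured x0) => y y0.
  by rewrite {1}[w]direction_scale // deriveZv //; exact: class_C1_differentiable oP UC1 y0.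
rewrite !normrM !(ger0_norm (enorm_ge0 _)) mulrA -[leRHS]mul1r.
apply: ler_pM => //; first by rewrite mulr_ge0 // enorm_ge0.
  by rewrite -[leRHS]mulr1 ler_pM ?enorm_ge0.
by apply: hessU_le => //; rewrite ?unit_direction // dotpZr ?xv ?xw mulr0.
Qed.

(** The gradient of U is tangent to the sphere by Euler's relation, so the bound
    on tangential derivatives applies to its own direction. *)
Lemma Upart_sqr_le x : enorm x = 1 -> \sum_b Upart U b x * Upart U b x <= eps ^+ 2.
Proof.
move=> x1; have x0 := unit_n0 x1; pose G : V := \row_b Upart U b x.
have dU := class_C1_differentiable oP UC1 x0.
have GG : \sum_b Upart U b x * Upart U b x = dotp G G.
  by apply: eq_bigr => b _; rewrite mxE.
have xG : dotp x G = 0.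
  by rewrite -(Upart_euler UC Uhom x0); apply: eq_bigr => b _; rewrite mxE.
have [G0|G0] := eqVneq (enorm G) 0.
  by rewrite GG -enorm_sqr G0 expr0n exprn_ge0.
rewrite GG -enorm_sqr ler_pXn2r ?nnegrE ?enorm_ge0 //.
have := tangent_derive_le x1 xG; rewrite derive_coordE //.
have -> : \sum_i G 0 i * 'D_(e_ i) U x = enorm G ^+ 2.
  by rewrite enorm_sqr; apply: eq_bigr => b _; rewrite !mxE.
rewrite ger0_norm ?sqr_ge0 // expr2 ler_pM2r //.
by rewrite lt_def G0 enorm_ge0.
Qed.

Lemma Upart_le x b : enorm x = 1 -> `|Upart U b x| <= eps.
Proof.
move=> x1; rewrite -(ler_pXn2r (n := 2)) ?nnegrE // real_normK ?num_real //.
apply: le_trans (Upart_sqr_le x1).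
rewrite (bigD1 b) //= -expr2 lerDl sumr_ge0 // => j _.
by rewrite -expr2 sqr_ge0.
Qed.

Lemma tangent_part x i : enorm x = 1 ->
  dotp x (e_ i - x 0 i *: x) = 0 /\ enorm (e_ i - x 0 i *: x) <= 1.
Proof.
move=> x1.
have xe : \sum_j x 0 j * (e_ i) 0 j = x 0 i.
  rewrite (bigD1 i) //= mxE !eqxx mulr1 big1 ?addr0 // => j ji.
  by rewrite mxE (negbTE ji) andbF mulr0.
have xx : \sum_j x 0 j * x 0 j = 1 by rewrite -[LHS]enorm_sqr x1 expr1n.
have ee : \sum_j (e_ i) 0 j * (e_ i) 0 j = 1.
  rewrite (bigD1 i) //= mxE !eqxx mulr1 big1 ?addr0 // => j ji.
  by rewrite mxE (negbTE ji) andbF mulr0.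
have ej j : (e_ i - x 0 i *: x) 0 j = (e_ i) 0 j - x 0 i * x 0 j by rewrite !mxE.
split.
  rewrite /dotp (eq_bigr (fun j => x 0 j * (e_ i) 0 j - x 0 i * (x 0 j * x 0 j))).
    by rewrite sumrB -mulr_sumr xe xx mulr1 subrr.
  by move=> j _; rewrite ej; ring.
rewrite -(ler_pXn2r (n := 2)) ?nnegrE ?enorm_ge0 // enorm_sqr expr1n /dotp.
rewrite (eq_bigr (fun j => (e_ i) 0 j * (e_ i) 0 j - 2 * x 0 i * (x 0 j * (e_ i) 0 j)
   + x 0 i ^+ 2 * (x 0 j * x 0 j))).
  rewrite big_split /= sumrB -!mulr_sumr xe xx ee.
  have := sqr_ge0 (x 0 i); lra.
by move=> j _; rewrite ej; ring.
Qed.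

(** The hypotheses bound tangential second derivatives only. Each basis vector
    is split into tangential and radial parts, and the radial derivative of D_z
    U is - D_z U since first derivatives of U have degree -1. *)
Lemma derive_Upart_le x b i : enorm x = 1 -> `|'D_(e_ i) (Upart U b) x| <= M + 1.
Proof.
move=> x1; have x0 := unit_n0 x1.
have xle k : `|x 0 k| <= 1 by rewrite -x1 coord_le_enorm.
have dDC z : class_C 1 punctured ('D_z U) by exact: class_C_derive UC2.
have dD z : differentiable ('D_z U) x.
  exact: class_C1_differentiable oP (dDC z) x0.
have hom z (c : R) y : 0 < c -> y != 0 -> 'D_z U (c *: y) = c^-1 * 'D_z U y.
  move=> c0 y0; have dU := class_C1_differentiable oP UC1 y0.
  by rewrite (@derive_homogeneous _ _ U y _ 1 c) ?div1r // => t t0; rewrite mul1r Uhom.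
have Dx z : 'D_x ('D_z U) x = - 'D_z U x.
  by apply: derive_radialV => // c y; exact: hom.
have split_e k z : 'D_(e_ k) ('D_z U) x =
    'D_(e_ k - x 0 k *: x) ('D_z U) x - x 0 k * 'D_z U x.
  have -> : 'D_(e_ k) ('D_z U) x = 'D_((e_ k - x 0 k *: x) + x 0 k *: x) ('D_z U) x.
    by rewrite subrK.
  by rewrite (deriveDv _ _ (dD z)) (deriveZv _ _ (dD z)) Dx mulrN.
have [xv v1] := tangent_part i x1; have [xw w1] := tangent_part b x1.
rewrite -[Upart U b]/('D_(e_ b) U) split_e.
have -> : 'D_(e_ i - x 0 i *: x) ('D_(e_ b) U) x = 'D_(e_ b) ('D_(e_ i - x 0 i *: x) U) x.
  exact: class_C_Schwarz oP UC2 x0.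
rewrite split_e.
have h1 := tangent_hessian_le x1 xw xv w1 v1.
have h2 : `|'D_(e_ i - x 0 i *: x) U x| <= eps.
  by apply: le_trans (tangent_derive_le x1 xv) _; rewrite ler_piMr.
have h3 : `|'D_(e_ b) U x| <= eps by exact: Upart_le.
apply: le_trans (ler_normB _ _) _.
apply: (@le_trans _ _ ((M + eps) + eps)); last by move: eps4; lra.
apply: lerD; last by rewrite normrM -[leRHS]mul1r ler_pM.
by apply: le_trans (ler_normB _ _) _; apply: lerD => //; rewrite normrM -[leRHS]mul1r ler_pM.
Qed.

Lemma conormal_norm_bounds x : enorm x = 1 ->
  1 / 2 <= conormal_norm U x /\ `|conormal_norm U x - 1| <= 4 * eps.
Proof.
move=> x1; have x0 := unit_n0 x1; set q := conormal_norm U x.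
have U4 := Ule x1; rewrite ler_norml in U4; move: U4 => /andP[Ua Ub].
have qge : 1 + U x <= q by exact: conormal_norm_ge.
have qq : q * q = (1 + U x) ^+ 2 + \sum_b Upart U b x * Upart U b x.
  by rewrite conormal_norm_sqr conormal_sqr // x1 expr1n mul1r.
have S1 := Upart_sqr_le x1.
have S0 : 0 <= \sum_b Upart U b x * Upart U b x.
  by apply: sumr_ge0 => b _; rewrite -expr2 sqr_ge0.
split; first by move: eps4; lra.
rewrite ler_norml; apply/andP; split; first by lra.
by rewrite lerBlDr; move: eps4; nra.
Qed.

(** The normal depends on the first derivatives of U only, hence a bound of
    order eps; the next lemmas bound its derivatives, which contain second
    derivatives of U, in terms of M. *)
Lemma normal_close x b : enorm x = 1 -> `|normal U b x - x 0 b| <= 12 * eps.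
Proof.
move=> x1; have x0 := unit_n0 x1; have [q2 q1] := conormal_norm_bounds x1.
set q := conormal_norm U x in q1 q2 *.
have q0 : 0 < q by lra.
have xb : `|x 0 b| <= 1 by rewrite -x1 coord_le_enorm.
have NE : conormal U b x = (1 + U x) * x 0 b - Upart U b x.
  by rewrite /conormal /graph x1 invr1 mulr1 mul1r.
have -> : normal U b x - x 0 b =
    (U x * x 0 b - Upart U b x - x 0 b * (q - 1)) / q.
  by rewrite /normal -/q NE; field; rewrite gt_eqF.
rewrite normrM normfV (gtr0_norm q0) ler_pdivrMr //.
apply: (@le_trans _ _ (6 * eps)); last by move: eps0; nra.
apply: le_trans (ler_normB _ _) _.
apply: (@le_trans _ _ ((eps + eps) + 4 * eps)); last by lra.
apply: lerD; last by rewrite normrM -[leRHS]mul1r ler_pM.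
apply: le_trans (ler_normB _ _) _; apply: lerD; last exact: Upart_le.
by rewrite normrM -[leRHS]mulr1 ler_pM // Ule.
Qed.

Lemma support_close x : enorm x = 1 -> `|support U x - 1| <= 14 * eps.
Proof.
move=> x1; have [q2 q1] := conormal_norm_bounds x1.
rewrite /support; set q := conormal_norm U x in q1 q2 *.
have q0 : 0 < q by lra.
have U4 := Ule x1; rewrite ler_norml in U4; move: U4 => /andP[Ua Ub].
have -> : (1 + U x) * (1 + U x) * q^-1 - 1 = ((1 + U x) ^+ 2 - q) / q.
  by field; rewrite gt_eqF.
rewrite normrM normfV (gtr0_norm q0) ler_pdivrMr //.
apply: (@le_trans _ _ (7 * eps)); last by move: eps0; nra.
move: q1; rewrite !ler_norml => /andP[qa qb]; move: eps4 => e4.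
by apply/andP; split; nra.
Qed.

Lemma derive_graph_le x b i : enorm x = 1 -> `|'D_(e_ i) (graph U b) x| <= 5.
Proof.
move=> x1; have x0 := unit_n0 x1.
have xle k : `|x 0 k| <= 1 by rewrite -x1 coord_le_enorm.
rewrite derive_graph // x1 invr1 !mulr1 expr1n mulr1.
have U4 := Ule x1; rewrite ler_norml in U4; move: U4 => /andP[Ua Ub].
apply: le_trans (ler_normD _ _) _.
apply: (@le_trans _ _ (1 + 2 * 2)); last by lra.
apply: lerD.
  rewrite normrM -[leRHS]mulr1 ler_pM //; apply: le_trans (Upart_le i x1) _.
  by move: eps4; lra.
rewrite normrM ler_pM //; first by rewrite ger0_norm ?(ltW (U1 x0)) //; move: eps4; lra.
apply: le_trans (ler_normB _ _) _.
apply: (@le_trans _ _ (1 + 1)); last by lra.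
apply: lerD; first by case: (b == i); rewrite ?normr1 ?normr0.
by rewrite normrM -[leRHS]mulr1 ler_pM.
Qed.

Lemma derive_conormal_le x b i : enorm x = 1 -> `|'D_(e_ i) (conormal U b) x| <= M + 7.
Proof.
move=> x1; have x0 := unit_n0 x1.
have xle k : `|x 0 k| <= 1 by rewrite -x1 coord_le_enorm.
have [_ dE] := class_C_ok (e_ i) (@class_C_enorm R m 1) x0.
have [_ dg] := class_C_ok (e_ i) (class_C_le oP (isT : 1 <= 3)%N (graphC UC b)) x0.
have [_ dp] := class_C_ok (e_ i) (class_CS oP (UpartC UC b)) x0.
have dEp := @derivableM R V (@enorm R m) (Upart U b) x (e_ i) dE dp.
have -> : 'D_(e_ i) (conormal U b) x = 'D_(e_ i) (graph U b) x -
    (enorm x * 'D_(e_ i) (Upart U b) x + Upart U b x * 'D_(e_ i) (@enorm R m) x).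
  by rewrite -(derive_mulE dE dp) -(derive_subE dg dEp).
rewrite derive_enorm // x1 divr1 mul1r.
apply: le_trans (ler_normB _ _) _.
apply: (@le_trans _ _ (5 + ((M + 1) + 1))); last by lra.
apply: lerD; first exact: derive_graph_le.
apply: le_trans (ler_normD _ _) _; apply: lerD; first exact: derive_Upart_le.
rewrite normrM -[leRHS]mulr1 ler_pM //; apply: le_trans (Upart_le b x1) _.
by move: eps4; lra.
Qed.

Lemma conormal_le y b : `|conormal U b y| <= conormal_norm U y.
Proof.
rewrite -(ler_pXn2r (n := 2)) ?nnegrE ?sqrtr_ge0 // real_normK ?num_real //.
rewrite [leRHS]expr2 conormal_norm_sqr (bigD1 b) //= -expr2 lerDl sumr_ge0 // => j _.
by rewrite -expr2 sqr_ge0.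
Qed.

Lemma derive_normal_le x b i : enorm x = 1 ->
  `|'D_(e_ i) (normal U b) x| <= 2 * (m.+1%:R * (M + 7)).
Proof.
move=> x1; have x0 := unit_n0 x1.
have [q2 _] := conormal_norm_bounds x1; set q := conormal_norm U x in q2.
have q0 : 0 < q by lra. have qn0 : q != 0 by rewrite gt_eqF.
have dN k : derivable (conormal U k) x (e_ i).
  by have [] := class_C_ok (e_ i) (class_CS oP (conormalC UC k)) x0.
have [_ dq] := class_C_ok (e_ i) (class_CS oP (conormal_normC UC Uhom U1)) x0.
have [_ dqV] := class_C_ok (e_ i) (class_CS oP (conormal_normVC UC Uhom U1)) x0.
have Dq : q * 'D_(e_ i) (conormal_norm U) x = \sum_k conormal U k x * 'D_(e_ i) (conormal U k) x.
  have dNN k : derivable (fun z => conormal U k z * conormal U k z) x (e_ i).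
    exact: (@derivableM R V (conormal U k) (conormal U k) x (e_ i) (dN k) (dN k)).
  have [_] := derive_sumE dNN.
  rewrite (@near_eq_derive R V R _ (fun z => conormal_norm U z * conormal_norm U z)); last first.
    by near=> z; rewrite conormal_norm_sqr.
  rewrite (derive_mulE dq dq) -/q => H.
  have {}H : 2 * (q * 'D_(e_ i) (conormal_norm U) x) =
     2 * (\sum_k conormal U k x * 'D_(e_ i) (conormal U k) x).
    rewrite mulr_sumr (eq_bigr (fun k => 'D_(e_ i) (fun z => conormal U k z * conormal U k z) x)).
      by rewrite -H; ring.
    by move=> k _; rewrite (derive_mulE (dN k) (dN k)); ring.
  by apply: mulfI H; rewrite pnatr_eq0.
have Dqle : `|'D_(e_ i) (conormal_norm U) x| <= m%:R * (M + 7).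
  rewrite -(ler_pM2l q0) -{1}(gtr0_norm q0) -normrM Dq.
  apply: le_trans (ler_norm_sum _ _ _) _.
  rewrite mulrCA mulr_natl -[X in _ *+ X]card_ord -sumr_const; apply: ler_sum => k _.
  by rewrite normrM ler_pM ?conormal_le // derive_conormal_le.
have -> : 'D_(e_ i) (normal U b) x = q^-1 * ('D_(e_ i) (conormal U b) x -
    (conormal U b x * q^-1) * 'D_(e_ i) (conormal_norm U) x).
  rewrite (derive_mulE (dN b) dqV) (derive_invE qn0 dq) -/q; ring.
rewrite normrM (ger0_norm (_ : 0 <= q^-1)) ?invr_ge0 ?(ltW q0) //.
have qi : q^-1 <= 2 by rewrite -[2]invrK lef_pV2 ?posrE ?invr_gt0 //; lra.
apply: ler_pM => //; first by rewrite invr_ge0 ltW.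
apply: le_trans (ler_normB _ _) _; rewrite -[m.+1%:R]natr1 [leRHS]mulrDl mul1r addrC.
apply: lerD; last exact: derive_conormal_le.
rewrite normrM -[leRHS]mul1r; apply: ler_pM => //.
rewrite normrM normfV (gtr0_norm q0) ler_pdivrMr // mul1r; exact: conormal_le.
Unshelve. all: by end_near. Qed.

Lemma normal_le x b : x != 0 -> `|normal U b x| <= 1.
Proof.
move=> x0; have q0 := conormal_norm_gt0 UC Uhom U1 x0.
by rewrite normrM normfV (gtr0_norm q0) ler_pdivrMr // mul1r conormal_le.
Qed.

(** The derivatives have degree 0, so that it suffices to bound them on the
    sphere. *)
Lemma derive_parallel_le s b i y : 0 <= s -> y != 0 ->
  `|'D_(e_ i) (parallel U s b) y| <= 7 + s + s * (2 * (m.+1%:R * (M + 7))).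
Proof.
move=> s0 y0; rewrite [y]direction_scale // jacobian_parallel_hom //; last 2 first.
- by rewrite enorm_gt0.
- by apply: unit_n0; exact: unit_direction.
have x1 := unit_direction y0; set x := direction y in x1 *; have x0 := unit_n0 x1.
have xle k : `|x 0 k| <= 1 by rewrite -x1 coord_le_enorm.
rewrite derive_parallel // x1 invr1 mulr1 mul1r.
have U4 := Ule x1; rewrite ler_norml in U4; move: U4 => /andP[Ua Ub].
apply: le_trans (ler_normD _ _) _.
apply: (@le_trans _ _ ((2 + s) + (5 + s * (2 * (m.+1%:R * (M + 7)))))); last by lra.
apply: lerD.
  rewrite normrM -[leRHS]mul1r ler_pM //; apply: le_trans (ler_normD _ _) _.
  apply: lerD; last by rewrite normrM ger0_norm // -[leRHS]mulr1 ler_pM // normal_le.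
  rewrite /graph x1 invr1 mulr1 normrM -[leRHS]mulr1 ler_pM //.
  by rewrite ger0_norm ?(ltW (U1 x0)) //; move: eps4; lra.
apply: le_trans (ler_normD _ _) _; apply: lerD; first exact: derive_graph_le.
by rewrite normrM ger0_norm // ler_wpM2l // derive_normal_le.
Qed.

Lemma support_close_everywhere y : y != 0 -> `|support U y - 1| <= 14 * eps.
Proof.
move=> y0; rewrite [y]direction_scale // support_hom ?enorm_gt0 //.
- by apply: support_close; exact: unit_direction.
- by apply: unit_n0; exact: unit_direction.
Qed.

Lemma parallel_close s b y : 0 <= s -> y != 0 ->
  `|parallel U s b y - (1 + s) * y 0 b| <= enorm y * ((1 + 12 * s) * eps).
Proof.
move=> s0 y0; have E0 : 0 < enorm y by rewrite enorm_gt0.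
have x1 := unit_direction y0; have x0 := unit_n0 x1.
have yE := direction_scale y0.
have yb : y 0 b = enorm y * direction y 0 b by rewrite {1}yE mxE.
have pE : parallel U s b y = enorm y * parallel U s b (direction y).
  by rewrite {1}yE parallel_hom.
have -> : parallel U s b y - (1 + s) * y 0 b = enorm y *
   (U (direction y) * direction y 0 b + s * (normal U b (direction y) - direction y 0 b)).
  by rewrite pE yb /parallel /graph x1 invr1; ring.
rewrite normrM (gtr0_norm E0) ler_wpM2l ?(ltW E0) //.
apply: le_trans (ler_normD _ _) _; rewrite mulrDl mul1r; apply: lerD.
  rewrite normrM -[leRHS]mulr1 ler_pM ?Ule //.
  by rewrite -x1 coord_le_enorm.
by rewrite normrM ger0_norm // [12 * s]mulrC -mulrA ler_wpM2l // normal_close.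
Qed.

End Estimates.

(** * Steiner's formula for radial graphs *)

Lemma dotpE (R : realType) m (v w : 'rV[R]_m) : v *m w^T = (dotp v w)%:M.
Proof.
apply/matrixP => i j; rewrite !ord1 !mxE eqxx mulr1n.
by apply: eq_bigr => k _; rewrite mxE.
Qed.

Lemma unit_mulmx_tr (R : realType) m (x : 'rV[R]_m) : enorm x = 1 -> x *m x^T = 1%:M.
Proof. by move=> x1; rewrite dotpE -enorm_sqr x1 expr1n. Qed.

Lemma derive_row (R : realType) m p (F : 'I_p -> 'rV[R]_m -> R) x v :
  (forall b, derivable (F b) x v) ->
  'D_v (fun y => \row_b F b y) x = \row_b 'D_v (F b) x.
Proof.
move=> Fd; rewrite derive_mx.
  apply/rowP => b; rewrite !mxE; congr ('D_v _ x).
  by apply/funext => y; rewrite mxE.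
apply/derivable_mxP => i b.
rewrite (_ : (fun y => _) = F b) //; apply/funext => y; by rewrite mxE.
Qed.

Section Link.
Context {R : realType} {n : nat}.
Local Notation V := ('rV[R]_n.+1).
Local Notation e_ i := (delta_mx (0 : 'I_1) (i : 'I_n.+1) : V).
Implicit Types (x y v w : V) (b i j : 'I_n.+1) (c s : R).

Lemma direction_hom c y : 0 < c -> direction (c *: y) = direction y.
Proof.
move=> c0; rewrite /direction enormZ gtr0_norm // scalerA invfM mulrAC.
by rewrite mulVf ?mul1r // gt_eqF.
Qed.

Lemma extend_hom (T : Type) (f : V -> T) c y : 0 < c -> extend f (c *: y) = extend f y.
Proof. by move=> c0; rewrite /extend direction_hom. Qed.

Lemma direction_id x : enorm x = 1 -> direction x = x.
Proof. by move=> x1; rewrite /direction x1 invr1 scale1r. Qed.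

Variable u : V -> R.
Let U : V -> R := extend u.
Hypothesis UC : class_C 3 punctured U.
Hypothesis U1 : forall y, y != 0 -> 0 < 1 + U y.

Let Uhom c y : 0 < c -> y != 0 -> U (c *: y) = U y.
Proof. by move=> c0 _; exact: extend_hom. Qed.

Let oP := @open_punctured R n.+1.

Let unit_n0 x : enorm x = 1 -> x != 0.
Proof. by move=> x1; rewrite -enorm_gt0 x1. Qed.

Lemma extend_radial : extend (radial u) = fun y => \row_b graph U b y.
Proof.
apply/funext => y; apply/rowP => b; rewrite !mxE /graph; congr (_ * _).
by rewrite mulrC.
Qed.

Definition dgraph x : 'M[R]_n.+1 := \matrix_(i, b) 'D_(e_ i) (graph U b) x.
Definition dnormal x : 'M[R]_n.+1 := \matrix_(i, b) 'D_(e_ i) (normal U b) x.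
Definition normal_row x : V := \row_b normal U b x.
Definition graph_row x : V := \row_b graph U b x.

Lemma derive_row_mulmx (F : 'I_n.+1 -> V -> R) x v :
  (forall b, class_C 1 punctured (F b)) -> x != 0 ->
  'D_v (fun y => \row_b F b y) x = v *m \matrix_(i, b) 'D_(e_ i) (F b) x.
Proof.
move=> FC x0.
rewrite derive_row; last by move=> b; have [] := class_C_ok v (FC b) x0.
apply/rowP => b; rewrite !mxE; have [df _] := class_C_ok v (FC b) x0.
by rewrite derive_coordE //; apply: eq_bigr => i _; rewrite mxE.
Qed.

Lemma derive_extend_radial x v : x != 0 ->
  'D_v (extend (radial u)) x = v *m dgraph x.
Proof.
move=> x0; rewrite extend_radial; apply: derive_row_mulmx => // b.
exact: (class_C_le oP (isT : 1 <= 3)%N (graphC UC b)).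
Qed.

Lemma radial_row x : enorm x = 1 -> radial u x = graph_row x.
Proof.
move=> x1; have := congr1 (fun F => F x) extend_radial.
by rewrite /extend /= direction_id.
Qed.

Lemma graph_row_unit x : enorm x = 1 -> graph_row x = (1 + U x) *: x.
Proof. by move=> x1; apply/rowP => b; rewrite !mxE /graph x1 invr1 mulr1. Qed.

Lemma normal_row_unit x : x != 0 -> normal_row x *m (normal_row x)^T = 1%:M.
Proof.
move=> x0; rewrite dotpE; congr (_%:M); rewrite -[RHS](normal_unit UC Uhom U1 x0).
by apply: eq_bigr => b _; rewrite !mxE.
Qed.

Lemma dgraph_normal x : x != 0 -> dgraph x *m (normal_row x)^T = 0.
Proof.
move=> x0; apply/matrixP => i j; rewrite ord1 !mxE.
rewrite -[RHS](derive_graph_normal UC Uhom i x0).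
by apply: eq_bigr => b _; rewrite !mxE mulrC.
Qed.

Lemma dnormal_normal x : x != 0 -> dnormal x *m (normal_row x)^T = 0.
Proof.
move=> x0; apply/matrixP => i j; rewrite ord1 !mxE.
rewrite -[RHS](derive_normal_normal UC Uhom U1 i x0).
by apply: eq_bigr => b _; rewrite !mxE.
Qed.

Lemma dgraph_radial x : x != 0 -> x *m dgraph x = 0.
Proof.
move=> x0; apply/rowP => b; rewrite !mxE -[RHS](graph_radial UC Uhom b x0).
by apply: eq_bigr => i _; rewrite !mxE.
Qed.

Lemma dnormal_radial x : x != 0 -> x *m dnormal x = 0.
Proof.
move=> x0; apply/rowP => b; rewrite !mxE -[RHS](normal_radial UC Uhom U1 b x0).
by apply: eq_bigr => i _; rewrite !mxE.
Qed.

Lemma dnormal_dgraph_sym x : x != 0 ->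
  (dnormal x *m (dgraph x)^T)^T = dnormal x *m (dgraph x)^T.
Proof.
move=> x0; apply/matrixP => i j; rewrite mxE [LHS]mxE [RHS]mxE.
under eq_bigr do rewrite !mxE.
under [RHS]eq_bigr do rewrite !mxE.
exact: (second_form_symmetry UC Uhom U1 j i x0).
Qed.

Lemma graph_row_normal x : x != 0 -> (graph_row x *m (normal_row x)^T) 0 0 = support U x.
Proof.
move=> x0; rewrite dotpE mxE eqxx mulr1n -(graph_normal UC Uhom x0).
by apply: eq_bigr => b _; rewrite !mxE.
Qed.

Lemma dgraph_unit x : enorm x = 1 ->
  dgraph x + x^T *m graph_row x = (1 + U x)%:M + (\row_i Upart U i x)^T *m x.
Proof.
move=> x1; have x0 := unit_n0 x1; rewrite graph_row_unit //.
apply/matrixP => i b; rewrite !mxE big_ord1 [in RHS]big_ord1 !mxE.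
rewrite derive_graph // x1 invr1 !mulr1 expr1n mulr1.
by rewrite eq_sym -[in RHS]mulr_natr; ring.
Qed.

(** On the sphere the matrix is (1 + U) I + N with N = (grad U)^T x, whose
    square is zero because the gradient is tangent. *)
Lemma det_dgraph_gt0 x : enorm x = 1 -> 0 < \det (dgraph x + x^T *m graph_row x).
Proof.
move=> x1; have x0 := unit_n0 x1; rewrite dgraph_unit //.
apply: det_scalar_nilpotent; last exact: U1.
rewrite mulmxA -[X in X *m x]mulmxA.
have -> : x *m (\row_i Upart U i x)^T = 0.
  rewrite dotpE (_ : dotp _ _ = 0) ?raddf0 // -(Upart_euler UC Uhom x0).
  by apply: eq_bigr => b _; rewrite mxE.
by rewrite mulmx0 mul0mx.
Qed.

Lemma jacobian_parallel x s : enorm x = 1 ->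
  (jacobian_mx (parallel U s) x)^T =
  dgraph x + s *: dnormal x + x^T *m (graph_row x + s *: normal_row x).
Proof.
move=> x1; have x0 := unit_n0 x1; apply/matrixP => i b.
rewrite !mxE big_ord1 !mxE (derive_parallel UC Uhom U1) // x1 invr1 mulr1 mul1r.
by rewrite addrC.
Qed.

(** For uniqueness, let nu be another candidate and subtract from it the
    multiple of the conormal with the same radial component. The difference w is
    tangent to the sphere at x, and the orthogonality of nu to the image of w
    gives <w, w> = 0; so nu is a multiple of the conormal. *)
Lemma outer_normal_radial x : enorm x = 1 -> outer_normal (radial u) x = normal_row x.
Proof.
move=> x1; have x0 := unit_n0 x1; have q0 := conormal_norm_gt0 UC Uhom U1 x0.
have dotrow v w : dotp v w = (v *m w^T) 0 0 by rewrite dotpE mxE eqxx mulr1n.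
rewrite /outer_normal; apply: xget_unique.
  split.
  - by rewrite /enorm dotrow normal_row_unit // mxE eqxx sqrtr1.
  - move=> v _; rewrite derive_extend_radial // dotrow trmx_mul mulmxA.
    have -> : normal_row x *m (dgraph x)^T = 0.
      by rewrite -[LHS]trmxK trmx_mul trmxK dgraph_normal // trmx0.
    by rewrite mul0mx mxE.
  - rewrite radial_row // dotrow -[_ *m _]trmxK trmx_mul trmxK mxE graph_row_normal //.
    exact: support_gt0.
move=> nu [nu1 nuT nuX]; set N : V := \row_b conormal U b x.
have U1x := U1 x0; have Un0 : 1 + U x != 0 by rewrite gt_eqF.
have NE b : N 0 b = (1 + U x) * x 0 b - Upart U b x.
  by rewrite mxE /conormal /graph x1 invr1 mulr1 mul1r.
have xN : dotp x N = 1 + U x.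
  rewrite -(position_conormal UC Uhom x0); apply: eq_bigr => b _.
  by rewrite mxE x1 invr1 mulr1.
have xx : dotp x x = 1 by rewrite -enorm_sqr x1 expr1n.
have dotDl v w z : dotp (v - w) z = dotp v z - dotp w z.
  by rewrite /dotp -sumrB; apply: eq_bigr => b _; rewrite !mxE mulrBl.
have dotZl c v z : dotp (c *: v) z = c * dotp v z.
  by rewrite /dotp mulr_sumr; apply: eq_bigr => b _; rewrite !mxE mulrA.
have dotAl v w z : dotp (v + w) z = dotp v z + dotp w z.
  by rewrite /dotp -big_split; apply: eq_bigr => b _; rewrite !mxE mulrDl.
pose a := dotp nu x; pose w := nu - (a / (1 + U x)) *: N.
have wx : dotp x w = 0.
  by rewrite dotpC dotDl dotZl [dotp N x]dotpC xN divfK // subrr.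
have ww : dotp w w = 0.
  have := nuT w wx; rewrite derive_extend_radial //.
  have -> : dotp nu (w *m dgraph x) =
      a * (\sum_i w 0 i * Upart U i x) + (1 + U x) * dotp nu w.
    have -> : dgraph x = (1 + U x)%:M + (\row_i Upart U i x)^T *m x - x^T *m graph_row x.
      by rewrite -dgraph_unit // addrK.
    rewrite graph_row_unit // -scalemxAr mulmxBr mulmxDr -scalemxAr !mulmxA.
    rewrite [w *m x^T]dotpE [dotp w x]dotpC wx raddf0 mul0mx scaler0 subr0.
    rewrite mul_mx_scalar [w *m _^T]dotpE mul_scalar_mx dotpC.
    rewrite (_ : dotp _ nu = (1 + U x) * dotp w nu + dotp w (\row_i Upart U i x) * dotp x nu).
      rewrite addrC [dotp w nu]dotpC [dotp x nu]dotpC mulrC; congr (_ * _ + _).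
      by apply: eq_bigr => i _; congr (_ * _); rewrite mxE.
    by rewrite dotAl !dotZl.
  have -> : \sum_i w 0 i * Upart U i x = - dotp N w.
    rewrite -[LHS](subrK ((1 + U x) * dotp x w)) wx mulr0 subr0 addr0.
    rewrite (_ : dotp N w = (1 + U x) * dotp x w - \sum_i w 0 i * Upart U i x).
      by rewrite wx mulr0 sub0r opprK.
    rewrite /dotp mulr_sumr -sumrB; apply: eq_bigr => b _; rewrite NE; ring.
  move=> H; rewrite {1}/w dotDl dotZl.
  apply: (mulfI Un0); rewrite mulr0 mulrBr mulrA [(1 + U x) * (a / _)]mulrC divfK //.
  by rewrite -[RHS]H; ring.
have w0 : w = 0.
  by apply/eqP; rewrite -enorm_eq0 /enorm ww sqrtr0.
have nuN : nu = (a / (1 + U x)) *: N by apply/eqP; rewrite -subr_eq0 -/w w0.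
pose c := a / (1 + U x).
have c0 : 0 < c.
  move: nuX; rewrite radial_row // graph_row_unit // nuN dotZl dotpC dotZl xN.
  by rewrite pmulr_lgt0 // mulr_gt0.
have Nq : enorm N = conormal_norm U x.
  by congr Num.sqrt; apply: eq_bigr => b _; rewrite !mxE.
have : c * conormal_norm U x = 1.
  by rewrite -Nq -(gtr0_norm c0) -enormZ -nuN.
move=> /(canRL (mulfK (lt0r_neq0 q0))); rewrite mul1r => cE.
apply/rowP => b; rewrite nuN -/c cE !mxE /normal mulrC //.
Qed.

Lemma extend_outer_normal y : y != 0 ->
  extend (outer_normal (radial u)) y = normal_row y.
Proof.
move=> y0; rewrite /extend outer_normal_radial; last exact: unit_direction.
apply/rowP => b; rewrite !mxE (normal_hom UC Uhom) //.
by rewrite invr_gt0 enorm_gt0.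
Qed.

Lemma derive_outer_normal x v : x != 0 ->
  'D_v (extend (outer_normal (radial u))) x = v *m dnormal x.
Proof.
move=> x0; rewrite (@near_eq_derive _ _ _ _ (fun y => \row_b normal U b y)).
  by apply: derive_row_mulmx => // b; exact: (class_CS oP (normalC UC Uhom U1 b)).
by apply: filterS (near_punctured x0) => y; exact: extend_outer_normal.
Qed.

Lemma tangent_frameP x : enorm x = 1 ->
  tangent_frame x *m (tangent_frame x)^T = 1%:M /\ tangent_frame x *m x^T = 0.
Proof.
move=> x1; have [E EP] := orthonormal_complement (unit_mulmx_tr x1).
exact: (@xgetPex _ 0 [set E : 'M[R]_(n, n.+1) | E *m E^T = 1%:M /\ E *m x^T = 0]
  (ex_intro _ E EP)).
Qed.

Lemma first_formE x : enorm x = 1 -> first_form (radial u) x =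
  tangent_frame x *m dgraph x *m (tangent_frame x *m dgraph x)^T.
Proof.
move=> x1; have x0 := unit_n0 x1; apply/matrixP => i j.
rewrite mxE /dframe !derive_extend_radial // -!row_mul /dotp mxE.
by apply: eq_bigr => b _; rewrite !mxE.
Qed.

Lemma second_formE x : enorm x = 1 -> second_form (radial u) x =
  tangent_frame x *m dnormal x *m (tangent_frame x *m dgraph x)^T.
Proof.
move=> x1; have x0 := unit_n0 x1; apply/matrixP => i j.
rewrite mxE /dframe derive_extend_radial // derive_outer_normal // -!row_mul /dotp mxE.
by apply: eq_bigr => b _; rewrite !mxE.
Qed.

(** The characteristic polynomial of h g^-1 splits because h is symmetric, so
    the principal curvatures are its roots and the generating polynomial of the
    sigma_j is det (1 + s h g^-1), which [pencil_det_identity] evaluates. *)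
Lemma curvature_density x : enorm x = 1 ->
  0 < \det (first_form (radial u) x) /\
  forall s, 0 < s ->
    \sum_(j < n.+1) s ^+ j * (sigma (radial u) j x *
       Num.sqrt (\det (first_form (radial u) x))) =
    \det (jacobian_mx (parallel U s) x) / (support U x + s).
Proof.
move=> x1; have x0 := unit_n0 x1; have [EE Ex] := tangent_frameP x1.
have [g0 gs] := pencil_det_identity (unit_mulmx_tr x1) EE Ex (normal_row_unit x0)
  (dgraph_normal x0) (dnormal_normal x0) (dgraph_radial x0) (dnormal_radial x0)
  (etrans (erefl _) (eq_rect_r (fun z => 0 < z) (support_gt0 UC Uhom U1 x0) (graph_row_normal x0)))
  (det_dgraph_gt0 x1).
rewrite -first_formE // -second_formE // in g0 gs; split => // s s0.
have gu : first_form (radial u) x \in unitmx by rewrite unitmxE unitfE gt_eqF.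
have hsym : (second_form (radial u) x)^T = second_form (radial u) x.
  rewrite second_formE // !trmx_mul !trmxK.
  have sym := dnormal_dgraph_sym x0; rewrite trmx_mul trmxK in sym.
  by rewrite !mulmxA -[_ *m dgraph x *m _]mulmxA sym !mulmxA.
have [kappa Hk] : exists kappa : 'rV[R]_n,
    char_poly (second_form (radial u) x *m invmx (first_form (radial u) x)) =
    \prod_(i < n) ('X - (kappa 0 i)%:P).
  rewrite first_formE //; apply: pencil_char_poly_splits => //.
  by rewrite -first_formE.
have Pk := @xgetPex _ 0 [set kappa : 'rV[R]_n |
    char_poly (second_form (radial u) x *m invmx (first_form (radial u) x)) =
    \prod_(i < n) ('X - (kappa 0 i)%:P)] (ex_intro _ kappa Hk).
rewrite -/(principal_curvatures (radial u) x) /= in Pk.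
rewrite -[\det (jacobian_mx _ _)]det_tr jacobian_parallel // -graph_row_normal // -gs //.
rewrite (char_poly_pencil_det Pk) ?gt_eqF // elementary_symmetric_gen mulr_sumr.
by apply: eq_bigr => j _; rewrite mulrA mulrC.
Qed.

End Link.

(** * The lower bound *)

Section SphereIntegral.
Context {R : realType} {m : nat}.
Local Notation V := ('rV[R]_m.+1).
Implicit Types (f g : V -> R).

Let oP := @open_punctured R m.+1.

Lemma tame_neg_part f : tame f -> tame (fun x => neg_part (f x)).
Proof.
move=> [fc [C fC]]; split.
  move=> x x0; apply: (@continuous_max R V (fun=> 0) (fun y => - f y)).
    exact: cst_continuous.
  by apply: (class_CN oP fc).
exists C => x x0; rewrite /neg_part ger0_norm ?le_max ?lexx //.
rewrite ge_max (le_trans (normr_ge0 (f x)) (fC x x0)) /=.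
by apply: le_trans (fC x x0); rewrite -normrN ler_norm.
Qed.

Lemma sphere_integral_ball f g : tame g -> (forall y, y != 0 -> extend f y = g y) ->
  sphere_integral f = m.+1%:R * ball_integral g.
Proof.
move=> [gc [C gC]] fg; rewrite /sphere_integral; congr (_ * _).
rewrite space_integral_ball; first exact: eq_ball_integral.
split; first by apply: (class_C_ext oP _ gc) => x x0; rewrite fg.
by exists C => x x0; rewrite fg // gC.
Qed.

End SphereIntegral.

Section Norms.
Context {R : realType} {n : nat}.
Local Notation V := ('rV[R]_n.+2).
Implicit Types (u : V -> R) (x v w : V).

(** In dimension at least 2 the suprema that make up the norms are taken over
    nonempty sets. They are therefore nonnegative, and each of them is bounded
    by the norm. *)
Lemma unit_tangent_exists : exists x v : V, unit_sphere x /\ unit_tangent x v.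
Proof.
pose x : V := delta_mx 0 0; pose v : V := delta_mx 0 (lift 0 0).
have d_unit (k : 'I_n.+2) : enorm (delta_mx 0 k : V) = 1.
  rewrite /enorm /dotp (bigD1 k) //= mxE !eqxx mulr1 big1 ?addr0 ?sqrtr1 // => j jk.
  by rewrite mxE (negbTE jk) andbF mulr0.
exists x, v; split; [exact: d_unit|split; last exact: d_unit].
rewrite /dotp big1 // => j _; rewrite !mxE eqxx /=.
by case: (eqVneq j 0) => [->|_]; rewrite ?mul0r // (negbTE (neq_lift _ _)) mulr0.
Qed.

Lemma sup_value_ge0 u : (0 <= sup_value u)%E.
Proof.
have [x [_ [x1 _]]] := unit_tangent_exists.
apply: (@le_trans _ _ (`|u x|%:E)); first by rewrite lee_fin.
by apply: ereal_sup_ubound; exists x.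
Qed.

Lemma sup_gradient_ge0 u : (0 <= sup_gradient u)%E.
Proof.
have [x [v [x1 xv]]] := unit_tangent_exists.
apply: (@le_trans _ _ (`|'D_v (extend u) x|%:E)); first by rewrite lee_fin.
by apply: ereal_sup_ubound; exists x, v.
Qed.

Lemma C1_norm_value u (eps : R) x : (C1_norm u < eps%:E)%E -> enorm x = 1 ->
  `|u x| <= eps.
Proof.
move=> ue x1; rewrite -lee_fin; apply: le_trans (ltW ue); rewrite /C1_norm.
apply: (@le_trans _ _ (sup_value u)); last by rewrite leeDl // sup_gradient_ge0.
by apply: ereal_sup_ubound; exists x.
Qed.

Lemma C1_norm_gradient u (eps : R) x v : (C1_norm u < eps%:E)%E -> enorm x = 1 ->
  dotp x v = 0 -> enorm v = 1 -> `|'D_v (extend u) x| <= eps.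
Proof.
move=> ue x1 xv v1; rewrite -lee_fin; apply: le_trans (ltW ue); rewrite /C1_norm.
apply: (@le_trans _ _ (sup_gradient u)); last by rewrite leeDr // sup_value_ge0.
by apply: ereal_sup_ubound; exists x, v.
Qed.

Lemma C2_norm_hessian u (M : R) x v w : (C2_norm u <= M%:E)%E -> enorm x = 1 ->
  dotp x v = 0 -> enorm v = 1 -> dotp x w = 0 -> enorm w = 1 ->
  `|'D_v ('D_w (extend u)) x| <= M.
Proof.
move=> uM x1 xv v1 xw w1; rewrite -lee_fin; apply: le_trans uM; rewrite /C2_norm.
apply: (@le_trans _ _ (sup_hessian u)); last first.
  by rewrite leeDr // adde_ge0 ?sup_value_ge0 ?sup_gradient_ge0.
by apply: ereal_sup_ubound; exists x, v, w.
Qed.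

End Norms.

Section Density.
Context {R : realType} {n : nat}.
Local Notation V := ('rV[R]_n.+1).
Variable u : V -> R.
Hypothesis UC : class_C 3 punctured (extend u).
Hypothesis U1 : forall y : V, y != 0 -> 0 < 1 + extend u y.

Let Uhom (c : R) (y : V) : 0 < c -> y != 0 -> extend u (c *: y) = extend u y.
Proof. by move=> c0 _; exact: extend_hom. Qed.

(** The sum of the s^j sigma_j sqrt (det g), by [curvature_density], extended
    with degree 0. *)
Definition steiner_density (s : R) (y : V) : R :=
  \det (jacobian_mx (parallel (extend u) s) y) / (support (extend u) y + s).

Lemma steiner_density_direction s y : y != 0 ->
  steiner_density s (direction y) = steiner_density s y.
Proof.
move=> y0; have x0 : direction y != 0 by rewrite -enorm_gt0 unit_direction.
have E0 : 0 < enorm y by rewrite enorm_gt0.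
rewrite /steiner_density.
have -> : jacobian_mx (parallel (extend u) s) (direction y) =
    jacobian_mx (parallel (extend u) s) y.
  rewrite [in RHS](direction_scale y0).
  apply/matrixP => j i.
  rewrite [LHS]mxE [RHS]mxE.
  exact/esym/(jacobian_parallel_hom UC Uhom U1 s j i E0 x0).
have := support_hom UC Uhom E0 x0; rewrite -(direction_scale y0) => ->.
reflexivity.
Qed.

Lemma sigma_density (lam : 'I_n.+1 -> R) (k : 'I_n.+1) y :
  (forall j : 'I_n.+1, \sum_s lam s * (s.+1)%:R ^+ j = (j == k)%:R) -> y != 0 ->
  sigma (radial u) k (direction y) *
    Num.sqrt (\det (first_form (radial u) (direction y))) =
  \sum_s lam s * steiner_density (s.+1)%:R y.
Proof.
move=> lamP y0; have x1 := unit_direction y0; set x := direction y in x1 *.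
have [g0 gs] := curvature_density UC U1 x1.
have dE (s : 'I_n.+1) : lam s * steiner_density s.+1%:R y = \sum_(j < n.+1)
    lam s * ((s.+1)%:R ^+ j * (sigma (radial u) j x *
      Num.sqrt (\det (first_form (radial u) x)))).
  by rewrite -mulr_sumr -(steiner_density_direction _ y0) /steiner_density -gs.
rewrite (eq_bigr _ (fun s _ => dE s)) exchange_big /= (bigD1 k) //=.
rewrite [X in _ = _ + X]big1 ?addr0; last first.
  move=> j jk; under eq_bigr do rewrite mulrA.
  by rewrite -mulr_suml lamP (negbTE jk) mul0r.
under eq_bigr do rewrite mulrA.
by rewrite -mulr_suml lamP eqxx mul1r.
Qed.

Lemma steiner_density_tame s K : 1 <= s ->
  (forall x : V, x != 0 -> forall j i,
     `|jacobian_mx (parallel (extend u) s) x j i| <= K) ->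
  tame (steiner_density s).
Proof.
move=> s1 PK; have oP := @open_punctured R n.+1.
have den (x : V) : x != 0 -> 1 <= support (extend u) x + s.
  by move=> x0; have := support_gt0 UC Uhom U1 x0; lra.
apply: tame_mul; split.
- apply: (class_C_det oP) => i j; apply: jacobian_mx_class_C.
  exact: (class_CS oP (parallelC UC Uhom U1 s i)).
- by exists (n.+1`!%:R * K ^+ n.+1) => x x0; apply: det_le => i j; exact: PK.
- apply: (class_CV oP) => [x x0|].
    by rewrite gt_eqF // (lt_le_trans ltr01) // den.
  apply: (class_CD oP); last exact: class_C_cst.
  exact: (class_C_le oP (leq0n 2) (supportC UC Uhom U1)).
- exists 1 => x x0; have d1 := den x x0; have d0 := lt_le_trans ltr01 d1.
  by rewrite ger0_norm ?invr_ge0 ?(ltW d0) // invf_le1.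
Qed.

End Density.

Theorem theorem1p7 (R : realType) (n k : nat) (M : R)
  (n_ge5 : (5 <= n)%N) (k_range : (1 <= k < n %/ 2)%N) (M_gt0 : 0 < M) :
  forall delta : R, 0 < delta ->
  exists epsilon : R, 0 < epsilon /\
  forall u : 'rV[R]_n.+1 -> R,
    sphere_class_C 3 u ->
    barycenter (radial_domain u) = 0 ->
    curvature_integral 0 (radial u) =
      curvature_integral 0 (radial (fun _ : 'rV[R]_n.+1 => 0)) ->
    (C2_norm u <= M%:E)%E ->
    (C1_norm u < epsilon%:E)%E ->
    - delta <=
      surface_integral (radial u)
        (fun x => sigma (radial u) k x +
                  \sum_(1 <= j < k.+1) neg_part (sigma (radial u) j x))
      - sphere_integral (fun _ : 'rV[R]_n.+1 => 'C(n, k)%:R).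
Proof.
move=> delta delta0.
have kn : (k < n.+1)%N.
  by have /andP[_ kn2] := k_range; rewrite (leq_trans kn2) // leqW // leq_div.
have [lam lamP] := choice (@interpolation_weights R n).
(* the distances s = 1, ..., n + 1 at which Steiner's formula is sampled *)
pose nd (i : 'I_n.+1) : R := (i.+1)%:R.
have nd1 i : 1 <= nd i by rewrite ler1n.
(* the bound of [derive_parallel_le] *)
pose K (i : 'I_n.+1) : R := 7 + nd i + nd i * (2 * (n.+2%:R * (M + 7))).
pose kk : 'I_n.+1 := Ordinal kn.
pose L := \sum_s `|lam kk s| + 1.
have L0 : 0 < L by rewrite ltr_wpDl // sumr_ge0.
pose d := delta / (n.+1%:R * L).
have d0 : 0 < d by rewrite divr_gt0 // mulr_gt0.
have K0 i : 0 <= K i.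
  have := nd1 i; rewrite /K => n1.
  have M7 : 0 <= n.+2%:R * (M + 7) by rewrite mulr_ge0 //; move: M_gt0; lra.
  have n0 : 0 <= nd i by lra.
  have := mulr_ge0 n0 (mulr_ge0 (ler0n R 2) M7); lra.
have [es esP] := choice (fun i => ball_det_close (m := n) d0 (nd1 i) (K0 i)).
(* 14 comes from [support_close_everywhere], the rest from [parallel_close]
   together with the bound n + 1 for the Euclidean norm in the unit cube *)
pose C i := 14 + n.+1%:R * (1 + 12 * nd i).
have C0 i : 0 < C i.
  by rewrite /C ltr_wpDr //; apply: mulr_ge0 => //; have := nd1 i; lra.
pose eps := Num.min (1 / 4) (\big[Num.min/1]_i (es i / C i)).
have es0 i : 0 < es i by have [] := esP i.
have eps0 : 0 < eps.
  rewrite /eps lt_min divr_gt0 //=; apply: lt_bigmin => // i _.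
  by rewrite divr_gt0.
have eps4 : eps <= 1 / 4 by rewrite /eps ge_min lexx.
have epsC i : C i * eps <= es i.
  rewrite mulrC -ler_pdivlMr // /eps ge_min; apply/orP; right.
  exact: bigmin_le.
exists eps; split; first exact: eps0.
move=> u UC _ _ uM ue.
(* the sphere needs tangent vectors for the norms to control their parts *)
have [n' nE] : exists n', n = n'.+1 by case: (n) n_ge5 => // n' _; exists n'.
have Ule (x : 'rV[R]_n.+1) : enorm x = 1 -> `|extend u x| <= eps.
  move=> x1; rewrite /extend direction_id //.
  by move: u uM ue x x1 {UC}; rewrite nE => u _ ue x x1; exact: C1_norm_value ue x1.
have grad_le (x v : 'rV[R]_n.+1) : enorm x = 1 -> dotp x v = 0 -> enorm v = 1 ->
    `|'D_v (extend u) x| <= eps.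
  by move: u uM ue x v {UC Ule}; rewrite nE => u _ ue x v; exact: C1_norm_gradient ue.
have hess_le (x v w : 'rV[R]_n.+1) : enorm x = 1 -> dotp x v = 0 -> enorm v = 1 ->
    dotp x w = 0 -> enorm w = 1 -> `|'D_v ('D_w (extend u)) x| <= M.
  by move: u uM ue x v w {UC Ule grad_le}; rewrite nE => u uM _ x v w; exact: C2_norm_hessian uM.
have Uhom (c : R) (y : 'rV[R]_n.+1) : 0 < c -> y != 0 -> extend u (c *: y) = extend u y.
  by move=> c0 _; exact: extend_hom.
have U1 (y : 'rV[R]_n.+1) : y != 0 -> 0 < 1 + extend u y.
  move=> y0; have x1 := unit_direction y0; have := Ule _ x1.
  rewrite /extend direction_id // ler_norml => /andP[+ _]; lra.
have PK i (x : 'rV[R]_n.+1) : x != 0 -> forall j l,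
    `|jacobian_mx (parallel (extend u) (nd i)) x j l| <= K i.
  move=> x0 j l; rewrite mxE.
  exact: (derive_parallel_le UC Uhom U1 (ltW eps0) eps4 (ltW M_gt0) Ule grad_le hess_le
    j l (le_trans ler01 (nd1 i)) x0).
pose F i := steiner_density u (nd i).
have Ft i : tame (F i) by apply: (steiner_density_tame UC U1 (nd1 i) (PK i)).
have F_close i : `|ball_integral (fun x => F i x - (1 + nd i) ^+ n)| <= d.
  have [_ H] := esP i; apply: H => //.
  - by move=> j; exact: (parallelC UC Uhom U1).
  - exact: PK.
  - move=> x x0 xbox j.
    apply: le_trans (parallel_close UC Uhom U1 (ltW eps0) eps4 Ule grad_le
      j (le_trans ler01 (nd1 i)) x0) _.
    have xn : enorm x <= n.+1%:R.
      rewrite -(ler_pXn2r (n := 2)) ?nnegrE ?enorm_ge0 // enorm_sqr /dotp.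
      apply: (@le_trans _ _ (\sum_(i < n.+1) 1)).
        apply: ler_sum => l _; rewrite -expr2 -real_normK ?num_real //.
        by rewrite expr_le1 // xbox.
      by rewrite sumr_const card_ord -natrX ler_nat leq_pmulr.
    apply: le_trans (epsC i).
    have n0 : 0 <= (1 + 12 * nd i) * eps.
      by apply: mulr_ge0 (ltW eps0); have := nd1 i; lra.
    apply: le_trans (ler_wpM2r n0 xn) _; rewrite /C [leRHS]mulrDl mulrA lerDr.
    by apply: mulr_ge0 (ltW eps0).
  - exact: (class_C_le (@open_punctured R n.+1) (leq0n 2) (supportC UC Uhom U1)).
  - move=> x x0.
    apply: le_trans (support_close_everywhere UC Uhom U1 (ltW eps0) eps4 Ule grad_le x0) _.
    apply: le_trans (epsC i); rewrite /C [leRHS]mulrDl lerDl.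
    apply: mulr_ge0 (ltW eps0).
    by apply: mulr_ge0 => //; have := nd1 i; lra.
(* S j is sigma_j sqrt (det g) for j <= k, which is where [inord j] has value j
   *)
pose S (j : nat) y := \sum_s lam (inord j) s * F s y.
have St j : tame (S j).
  by apply: tame_sum => s; apply: tame_mul; [exact: tame_cst|exact: Ft].
pose H y := S k y + \sum_(1 <= j < k.+1) neg_part (S j y).
have Ht : tame H.
  by apply: tame_add => //; apply: tame_sum => j; exact: tame_neg_part.
have sigmaS (j : nat) (y : 'rV[R]_n.+1) : (j <= k)%N -> y != 0 ->
    sigma (radial u) j (direction y) *
      Num.sqrt (\det (first_form (radial u) (direction y))) = S j y.
  move=> jk y0; have := sigma_density UC U1 (lamP (inord j)) y0.
  by rewrite inordK // (leq_ltn_trans jk).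
have extH y : y != 0 -> extend (fun x => (sigma (radial u) k x +
      \sum_(1 <= j < k.+1) neg_part (sigma (radial u) j x)) *
      Num.sqrt (\det (first_form (radial u) x))) y = H y.
  move=> y0; rewrite /extend mulrDl sigmaS // /H; congr (_ + _).
  rewrite mulr_suml big_nat [RHS]big_nat; apply: eq_bigr => j /andP[_ jk].
  rewrite /neg_part -sigmaS // maxr_pMl ?sqrtr_ge0 //.
  by rewrite mul0r mulNr.
rewrite /surface_integral (sphere_integral_ball Ht extH).
rewrite (@sphere_integral_ball _ _ _ (fun=> 'C(n, k)%:R)); [|exact: tame_cst|by []].
have HS : ball_integral (S k) <= ball_integral H.
  apply: ball_integral_le => // x _; rewrite /H lerDl sumr_ge0 // => j _.
  by rewrite /neg_part le_max lexx.
(* the weights applied to the expansion of (1 + s)^n *)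
have weights : \sum_s lam kk s * (1 + nd s) ^+ n = 'C(n, k)%:R.
  have ndP (j : 'I_n.+1) : \sum_s lam kk s * nd s ^+ j = (j == kk)%:R := lamP kk j.
  under eq_bigr do rewrite exprDn mulr_sumr.
  rewrite exchange_big /= (bigD1 kk) //= [X in _ + X]big1 ?addr0; last first.
    move=> j jk; under eq_bigr do rewrite expr1n mul1r -mulr_natr mulrA.
    by rewrite -mulr_suml ndP (negbTE jk) mul0r.
  under eq_bigr do rewrite expr1n mul1r -mulr_natr mulrA.
  by rewrite -mulr_suml [X in X * _](ndP kk) eqxx mul1r.
have kkE : inord k = kk by apply/val_inj; rewrite /= inordK.
pose cst_bin (x : 'rV[R]_n.+1) : R := 'C(n, k)%:R.
have SE : ball_integral (S k) - ball_integral cst_bin =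
    \sum_s lam kk s * ball_integral (fun x => F s x - (1 + nd s) ^+ n).
  rewrite -(ball_integralB (St k) (tame_cst _)).
  have Gt s : tame (fun x => F s x - (1 + nd s) ^+ n) := tame_sub (Ft s) (tame_cst _).
  under [RHS]eq_bigr => s _ do rewrite -(ball_integralZ _ (Gt s)).
  rewrite -ball_integral_sum; last by move=> s; exact: (tame_mul (tame_cst _) (Gt s)).
  apply: eq_ball_integral => x _; rewrite -weights /S kkE -sumrB.
  by apply: eq_bigr => s _; rewrite mulrBr.
have SEle : `|ball_integral (S k) - ball_integral cst_bin| <= L * d.
  rewrite SE; apply: le_trans (ler_norm_sum _ _ _) _.
  rewrite /L mulrDl mul1r mulr_suml; apply: (@le_trans _ _ (\sum_s `|lam kk s| * d)).
    by apply: ler_sum => s _; rewrite normrM ler_wpM2l.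
  by rewrite lerDl ltW.
rewrite -mulrBr; have m0 : 0 < (n.+1%:R : R) by [].
apply: (@le_trans _ _ (n.+1%:R * (ball_integral (S k) - ball_integral cst_bin))).
  have -> : delta = n.+1%:R * (L * d) by rewrite /d mulrA mulrCA mulfV ?mulr1 // mulf_neq0 ?gt_eqF.
  rewrite -mulrN ler_pM2l //.
  by move: SEle; rewrite ler_norml => /andP[].
by rewrite ler_pM2l // lerB.
Qed.
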